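(* Relative to the algebraic hyperbolic structure, the moduli space ${\cal A}_5$ of planar equilateral pentagons modulo similarity is a hyperbolic surface of Euler characteristic $-3$. The space is tiled by $12$ regular right-angled hyperbolic pentagons which meet $4$ around each vertex.
   Context: The following is for general $N\ge5$; the claim concerns $N=5$. Convex part. Polygons are labelled. Strictly convex polygons are oriented counterclockwise and considered up to similarity. For a convex $N$-gon $P$ with vertices $P_1,\dots,P_N$, a balance point is a point $p$ in the region bounded by $P$, not a vertex, with $\sum_k (P_k-p)/\|P_k-p\|=0$. Each strictly convex equiangular $N$-gon $P$ (all interior angles equal) has a unique balance point $p$, and the strictly convex equilateral $N$-gon $L$ with successive edge vectors $(P_k-p)/\|P_k-p\|$ gives a bijection $[P]\leftrightarrow[L]$ between similarity classes of strictly convex equiangular $N$-gons and similarity classes of strictly convex equilateral $N$-gons. Let ${\cal C}_N$ be the set of these classes. Hyperbolic structure on ${\cal C}_N$. Equiangular $N$-gons (possibly non-convex or degenerate), normalized so that successive sides are parallel to the successive $N$th roots of unity, are given by $N$-tuples of lines $\ell_1,\dots,\ell_N$, with $\ell_j$ parallel to the $j$th root of unity and vertices $\ell_j\cap\ell_{j+1}$. Modulo translation they form a vector space $\cong\mathbb{R}^{N-2}$ on which signed area is a quadratic form $Q$ of signature $(1,N-3)$. Scaling to area $1$ identifies similarity classes of strictly convex equiangular $N$-gons with an open subset of one sheet of $\{Q(V,V)=1\}$, the Lorentz model of $\mathbb{H}^{N-3}$. This subset is the interior of a convex polytope, and through the bijection above it gives the algebraic hyperbolic structure on ${\cal C}_N$.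 Let $\overline{{\cal C}}_N$ be the closure of ${\cal C}_N$ in $\mathbb{H}^{N-3}$. Points of $\partial{\cal C}_N$ in $\mathbb{H}^{N-3}$ are classes of positive-area convex equiangular polygons with some edges collapsed to points; the correspondence extends continuously to them, such a point representing the weakly convex equilateral $N$-gon with edge vectors $(P_k-p)/\|P_k-p\|$, where $p$ is the balance point of the degenerate polygon (its vertices counted with multiplicity). The space ${\cal A}_N$. General equilateral $N$-gons are considered up to all similarities (not necessarily orientation-preserving); such a polygon is encoded by an ordered list $e_1,\dots,e_N$ of unit vectors with sum $0$. The symmetric group $S_N$ acts by permuting the list. For $\sigma\in S_N$ and $x\in\overline{{\cal C}}_N$ representing the polygon with edges $e_1,\dots,e_N$, the pair $(x,\sigma)$ represents the class of the polygon with edges $e_{\sigma(1)},\dots,e_{\sigma(N)}$. The polygons that some permutation makes strictly convex form $N!/(2N)$ disjoint copies of ${\cal C}_N$, each given the hyperbolic structure of ${\cal C}_N$ (permutations in the dihedral group of order $2N$ map the convex component to itself). ${\cal A}_N$ is the identification space obtained from the closures (copies of $\overline{{\cal C}}_N$) of all these components by identifying points which represent the same equivalence class of equilateral $N$-gon, with the induced hyperbolic structure. *)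

(* Defs.v *)
From HB Require Import structures.
From mathcomp Require Import all_boot all_order all_algebra perm.
From mathcomp Require Import all_classical all_reals all_analysis.
From mathcomp Require Import complex.

Set Implicit Arguments.
Unset Strict Implicit.
Unset Printing Implicit Defensive.

Import Order.TTheory GRing.Theory Num.Theory.
Import numFieldNormedType.Exports.

Local Open Scope classical_set_scope.
Local Open Scope complex_scope.
Local Open Scope ring_scope.
Local Open Scope quotient_scope.

Definition acosh (R : realType) (t : R) : R := ln (t + Num.sqrt (t ^+ 2 - 1)).

(** * Planar polygons

    The plane is [R[i]].  A labelled N-gon is the list of its vertices
    ['I_N -> R[i]]; labels are cyclic, the label [0] standing for [N], and the
    k-th edge goes from vertex [ord_pred k] to vertex [k]. *)

Definition cross (R : realType) (u v : R[i]) : R := complex.Im (conjc u * v).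

Definition signed_area (R : realType) (N : nat) (P : 'I_N -> R[i]) : R :=
  2^-1 * \sum_k cross (P k) (P (ordS k)).

(* Strictly convex and counterclockwise: every other vertex lies strictly to
   the left of each oriented side. *)
Definition strictly_convex (R : realType) (N : nat) (P : 'I_N -> R[i]) : Prop :=
  forall k j, j != k -> j != ordS k ->
    0 < cross (P (ordS k) - P k) (P j - P k).

Definition in_hull (R : realType) (N : nat) (P : 'I_N -> R[i]) (p : R[i]) :
    Prop :=
  exists c : 'I_N -> R,
    [/\ forall k, 0 <= c k, \sum_k c k = 1 & p = \sum_k (c k)%:C * P k].

Definition unit_directions (R : realType) (N : nat) (P : 'I_N -> R[i])
    (p : R[i]) : 'I_N -> R[i] :=
  fun k => (P k - p) / `|P k - p|.

(* The region bounded by a (possibly degenerate) convex polygon is the convex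
   hull of its vertices. *)
Definition balance_point (R : realType) (N : nat) (P : 'I_N -> R[i])
    (p : R[i]) : Prop :=
  [/\ in_hull P p, forall k, P k != p & \sum_k unit_directions P p k = 0].

(* Similarity, possibly orientation-reversing, of polygons given by their edge
   vectors. *)
Definition similar_edges (R : realType) (N : nat) (e e' : 'I_N -> R[i]) :
    Prop :=
  exists2 a : R[i], a != 0 &
    (forall k, e' k = a * e k) \/ (forall k, e' k = a * conjc (e k)).

(** * Normalized equiangular polygons modulo translation

    A normalized equiangular polygon, with k-th edge on a line parallel to
    [zeta ^+ k], is given modulo translation by the signed lengths [x 0 k] of
    its edges (lemma [equiangular_mod_translation]). *)

Definition zeta (R : realType) (N : nat) : R[i] :=
  cos (2 * pi / N%:R) +i* sin (2 * pi / N%:R).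

Definition closes_up (R : realType) (N : nat) (x : 'rV[R]_N) : Prop :=
  \sum_(k < N) (x 0 k)%:C * zeta R N ^+ k = 0.

Definition vertices (R : realType) (N : nat) (x : 'rV[R]_N) (k : 'I_N) : R[i] :=
  \sum_(j < N | (j <= k)%N) (x 0 j)%:C * zeta R N ^+ j.

Lemma verticesS (R : realType) (N : nat) (x : 'rV[R]_N) (i k : 'I_N) :
  k = i.+1 :> nat ->
  vertices x k = vertices x i + (x 0 k)%:C * zeta R N ^+ k.
Proof.
move=> ki; rewrite /vertices (bigD1 k) //= addrC; congr (_ + _).
apply: eq_bigl => j; rewrite -val_eqE /= ki leq_eqVlt ltnS.
by case: (eqVneq (j : nat) i.+1) => [->|_]; rewrite ?ltnn ?andbT.
Qed.

Lemma equiangular_mod_translation (R : realType) (N : nat) (P : 'I_N -> R[i])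
    (x : 'rV[R]_N) :
  (forall k, P k - P (ord_pred k) = (x 0 k)%:C * zeta R N ^+ k) <->
  closes_up x /\ exists w : R[i], forall k, P k = vertices x k + w.
Proof.
case: N P x => [|n] P x.
  split=> [_|_ []//]; split; first by rewrite /closes_up big_ord0.
  by exists 0; case.
have predS (i k : 'I_n.+1) : k = i.+1 :> nat -> ord_pred k = i.
  by move=> ki; apply: val_inj; rewrite /= ki addSn /= modnDr modn_small.
have pred0 : ord_pred (ord0 : 'I_n.+1) = ord_max.
  by apply: val_inj; rewrite /= modn_small.
have v0 : vertices x ord0 = (x 0 ord0)%:C.
  rewrite /vertices (bigD1 ord0) //= expr0 mulr1 big1 ?addr0// => j.
  by rewrite leqn0 -val_eqE /= => /andP[->].
have vmax : closes_up x <-> vertices x ord_max = 0.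
  rewrite /closes_up /vertices; suff -> : \sum_(j < n.+1 | (j <= @ord_max n)%N)
    (x 0 j)%:C * zeta R n.+1 ^+ j = \sum_(j < n.+1) (x 0 j)%:C * zeta R n.+1 ^+ j
    by [].
  by apply: eq_bigl => j; rewrite -ltnS ltn_ord.
split=> [Px|[/vmax x0 [w Pw]] k].
  have Pv k : P k = vertices x k + P ord_max.
    case: k => k; elim: k => [|k IH] kn.
      rewrite (_ : Ordinal kn = ord0); last exact: val_inj.
      have := Px ord0; rewrite pred0 expr0 mulr1 v0 => <-; by rewrite subrK.
    have kn' := ltnW kn.
    rewrite (@verticesS _ _ _ (Ordinal kn'))// addrAC -IH.
    by rewrite -Px (predS (Ordinal kn')) // addrC subrK.
  split; last by exists (P ord_max).
  by apply/vmax; apply: (addIr (P ord_max)); rewrite -Pv add0r.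
rewrite !Pw opprD addrACA subrr addr0.
case: k => -[|k] kn.
  rewrite (_ : Ordinal kn = ord0); last exact: val_inj.
  by rewrite pred0 x0 subr0 v0 expr0 mulr1.
have kn' := ltnW kn.
by rewrite (predS (Ordinal kn'))// (@verticesS _ _ _ (Ordinal kn'))// addrC addKr.
Qed.

(** * The hyperbolic structure on [C_N] *)

Definition area (R : realType) (N : nat) (x : 'rV[R]_N) : R :=
  signed_area (vertices x).

Definition area_form (R : realType) (N : nat) (x y : 'rV[R]_N) : R :=
  2^-1 * (area (x + y) - area x - area y).

(* [const_mx 1] is the regular polygon; it selects the sheet. *)
Definition lorentz (R : realType) (N : nat) : set 'rV[R]_N :=
  [set x | [/\ closes_up x, area x = 1 & 0 < area_form x (const_mx 1)]].

Definition lorentz_dist (R : realType) (N : nat) (x y : 'rV[R]_N) : R :=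
  acosh (area_form x y).

Definition convex_classes (R : realType) (N : nat) : set 'rV[R]_N :=
  [set x | lorentz x /\ strictly_convex (vertices x)].

(* Closure relative to the hyperboloid sheet. *)
Definition closed_convex_classes (R : realType) (N : nat) : set 'rV[R]_N :=
  closure (@convex_classes R N) `&` @lorentz R N.

(** * The identification space [A_N] *)

Definition cell (R : realType) (N : nat) : topologicalType :=
  set_type (@closed_convex_classes R N).

(* The pairs (x, sigma).  Pairs whose permutations lie in one coset of the
   dihedral group give the same component of the space of polygons. *)
Definition copies (R : realType) (N : nat) : topologicalType :=
  {s : 'S_N & (fun _ : 'S_N => cell R N) s}.

Definition polygon_class (R : realType) (N : nat) (c : copies R N) :
    set ('I_N -> R[i]) :=
  [set e | exists2 p : R[i],
     balance_point (vertices (\val (projT2 c))) p &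
     similar_edges
       (fun k => unit_directions (vertices (\val (projT2 c))) p (projT1 c k)) e].

Definition same_class (R : realType) (N : nat) (c d : copies R N) : bool :=
  `[< polygon_class c = polygon_class d >].

Lemma same_class_refl (R : realType) (N : nat) :
  reflexive (@same_class R N).
Proof. by move=> c; apply/asboolP. Qed.

Lemma same_class_sym (R : realType) (N : nat) :
  symmetric (@same_class R N).
Proof. by move=> c d; apply/asboolP/asboolP. Qed.

Lemma same_class_trans (R : realType) (N : nat) :
  transitive (@same_class R N).
Proof. by move=> d c f /asboolP cd /asboolP df; apply/asboolP; rewrite cd. Qed.

Canonical same_class_equiv (R : realType) (N : nat) :=
  EquivRel (@same_class R N) (@same_class_refl R N) (@same_class_sym R N)
    (@same_class_trans R N).

Definition moduli (R : realType) (N : nat) : topologicalType :=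
  quotient_topology {eq_quot (@same_class_equiv R N)}.

Definition cell_map (R : realType) (N : nat) (s : 'S_N) (x : cell R N) :
    moduli R N :=
  \pi_{eq_quot (@same_class_equiv R N)} (existT (fun _ => cell R N) s x).

(** * The hyperbolic plane (hyperboloid model) *)

Definition lorentz_form (R : realType) (v w : 'rV[R]_3) : R :=
  v 0 0 * w 0 0 - v 0 1 * w 0 1 - v 0 2%:R * w 0 2%:R.

Definition hplane (R : realType) : set 'rV[R]_3 :=
  [set v | lorentz_form v v = 1 /\ 0 < v 0 0].

Definition hdist (R : realType) (v w : 'rV[R]_3) : R := acosh (lorentz_form v w).

(* The component of w tangent to the hyperboloid at v; it points along the
   geodesic from v to w.  The Riemannian metric is [- lorentz_form]. *)
Definition toward (R : realType) (v w : 'rV[R]_3) : 'rV[R]_3 :=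
  w - lorentz_form v w *: v.

Definition hangle (R : realType) (a v b : 'rV[R]_3) : R :=
  let s := toward v a in let t := toward v b in
  acos (- lorentz_form s t /
        (Num.sqrt (- lorentz_form s s) * Num.sqrt (- lorentz_form t t))).

(* Positive iff a, b, c is a positively oriented triangle. *)
Definition orient (R : realType) (a b c : 'rV[R]_3) : R :=
  \det (col_mx a (col_mx b c) : 'M[R]_3).

Definition regular_right_angled (R : realType) (n : nat)
    (v : 'I_n -> 'rV[R]_3) : Prop :=
  [/\ forall i, hplane (v i),
      forall i k, k != i -> k != ordS i -> 0 < orient (v i) (v (ordS i)) (v k),
      forall i j, hdist (v i) (v (ordS i)) = hdist (v j) (v (ordS j)) &
      forall i, hangle (v (ord_pred i)) (v i) (v (ordS i)) = pi / 2].

Definition hregion (R : realType) (n : nat) (v : 'I_n -> 'rV[R]_3) :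
    set 'rV[R]_3 :=
  [set z | hplane z /\ forall i, 0 <= orient (v i) (v (ordS i)) z].

(* The relatively open face of the convex polygon v lying on exactly the sides
   in J: the interior for J empty, a side without endpoints for J a singleton,
   a vertex for J a pair of successive sides, and empty otherwise. *)
Definition hface (R : realType) (n : nat) (v : 'I_n -> 'rV[R]_3)
    (J : {set 'I_n}) : set 'rV[R]_3 :=
  [set z | hregion v z /\
     forall i, orient (v i) (v (ordS i)) z = 0 <-> i \in J].

(** * Hyperbolic surfaces *)

Record chart (R : realType) (X : topologicalType) := Chart {
  chart_dom : set X;
  chart_fun : X -> 'rV[R]_3 }.

(* A homeomorphism from an open set onto an open subset of the plane. *)
Definition hyperbolic_chart (R : realType) (X : topologicalType)
    (phi : chart R X) : Prop :=
  [/\ open (chart_dom phi),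
      {within chart_dom phi, continuous (chart_fun phi)},
      {in chart_dom phi &, injective (chart_fun phi)} &
      forall W : set X, open W -> W `<=` chart_dom phi ->
        exists2 O : set 'rV[R]_3, open O &
          chart_fun phi @` W = O `&` @hplane R].

Definition compatible_charts (R : realType) (X : topologicalType)
    (phi psi : chart R X) : Prop :=
  forall x, chart_dom phi x -> chart_dom psi x ->
    exists2 W, nbhs x W &
      forall y z, W y -> W z ->
        [/\ chart_dom phi y, chart_dom psi y, chart_dom phi z & chart_dom psi z]
        -> hdist (chart_fun phi y) (chart_fun phi z) =
           hdist (chart_fun psi y) (chart_fun psi z).

Definition hyperbolic_surface (R : realType) (X : topologicalType)
    (atlas : set (chart R X)) : Prop :=
  [/\ hausdorff_space X /\ @second_countable X,
      forall phi, atlas phi -> hyperbolic_chart phi,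
      forall x, exists2 phi, atlas phi & chart_dom phi x &
      forall phi psi, atlas phi -> atlas psi -> compatible_charts phi psi].

(* f, defined on the subset S of T with distance d, is a local isometry to the
   hyperbolic surface X. *)
Definition local_isometry (R : realType) (X : topologicalType)
    (atlas : set (chart R X)) (T : topologicalType) (S : set T)
    (d : T -> T -> R) (f : T -> X) : Prop :=
  forall phi s, atlas phi -> S s -> chart_dom phi (f s) ->
    exists2 W, nbhs s W &
      forall t u, W t -> S t -> W u -> S u ->
        [/\ chart_dom phi (f t), chart_dom phi (f u) &
            hdist (chart_fun phi (f t)) (chart_fun phi (f u)) = d t u].

(* All inclusions of the copies of the closure of C_N are local isometries;
   since the copies cover A_N, this determines the structure. *)
Definition induced_structure (R : realType) (N : nat)
    (atlas : set (chart R (moduli R N))) : Prop :=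
  forall s : 'S_N,
    local_isometry atlas [set: cell R N]
      (fun x y => lorentz_dist (\val x) (\val y)) (@cell_map R N s).

(* Tiling by m regular right-angled n-gons, edge to edge, with q corners at
   each vertex.  The faces of two tiles coincide as soon as they meet. *)
Definition regular_right_angled_tiling (R : realType) (X : topologicalType)
    (atlas : set (chart R X)) (m n q : nat) : Prop :=
  exists (v : 'I_m -> 'I_n -> 'rV[R]_3) (f : 'I_m -> 'rV[R]_3 -> X),
    [/\ forall k, [/\ regular_right_angled (v k),
          {in hregion (v k) &, injective (f k)} &
          local_isometry atlas (hregion (v k)) (@hdist R) (f k)],
        \bigcup_k (f k @` hregion (v k)) = [set: X],
        forall k l, f k @` hface (v k) finset.set0 `&`
          f l @` hface (v l) finset.set0 !=set0 -> k = l,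
        forall k l (J K : {set 'I_n}),
          f k @` hface (v k) J `&` f l @` hface (v l) K !=set0 ->
          f k @` hface (v k) J = f l @` hface (v l) K &
        forall k i, #|[pred c : 'I_m * 'I_n |
          `[< f c.1 (v c.1 c.2) = f k (v k i) >]]| = q].

(** * Euler characteristic *)

Definition sqnorm (R : realType) (n : nat) (u : 'rV[R]_n) : R :=
  \sum_(i < n) u 0 i ^+ 2.

(* A finite CW structure on a Hausdorff space is a finite family of
   characteristic maps of closed balls: injective on the open balls, whose
   images partition X, and sending each boundary sphere to the union of the
   cells of lower dimension. *)
Definition CW_structure (R : realType) (X : topologicalType) (I : finType)
    (dim : I -> nat) (Phi : forall i, 'rV[R]_(dim i) -> X) : Prop :=
  [/\ hausdorff_space X,
      forall i, {within [set u | sqnorm u <= 1], continuous (Phi i)},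
      forall x, exists i, exists2 u, sqnorm u < 1 & Phi i u = x,
      forall i j u w, sqnorm u < 1 -> sqnorm w < 1 -> Phi i u = Phi j w ->
        existT (fun i => 'rV[R]_(dim i)) i u = existT _ j w &
      forall i u, sqnorm u = 1 -> exists2 j, (dim j < dim i)%N &
        exists2 w, sqnorm w < 1 & Phi j w = Phi i u].

Definition euler_characteristic (R : realType) (X : topologicalType)
    (chi : int) : Prop :=
  exists (I : finType) (dim : I -> nat) (Phi : forall i, 'rV[R]_(dim i) -> X),
    CW_structure Phi /\ chi = \sum_i (-1) ^+ dim i.

(* Main.v *)
Require Import Defs.
From mathcomp Require Import all_boot all_order all_algebra all_fingroup.
From mathcomp Require Import all_classical all_reals all_analysis.
From mathcomp Require Import complex ring lra.

Set Implicit Arguments.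
Unset Strict Implicit.
Unset Printing Implicit Defensive.

Import Order.TTheory GRing.Theory Num.Theory.
Import numFieldNormedType.Exports.

Local Open Scope classical_set_scope.
Local Open Scope complex_scope.
Local Open Scope ring_scope.

(* An equiangular pentagon is recorded by its five side lengths.  On the
   three-dimensional space of closed pentagons the area is a Lorentz form, and
   the closure of [C_5] is the set of closed pentagons of area 1 with
   nonnegative sides: a right-angled pentagon of the hyperbolic plane, on which
   no two adjacent sides vanish at once.

   The balance point of a pentagon of the closure lies strictly inside it, so
   the cyclic order of the vertices seen from there, with coincidences exactly
   at the collapsed sides, is an invariant of the equilateral pentagon.  Hence
   two pairs [(x, s)] and [(y, t)] represent the same class iff a dihedral
   symmetry takes [x] to [y] and [s], [t] agree through it up to permuting
   labels of coinciding vertices.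

   Consequently four tiles meet at each corner: they are exchanged by the two
   commuting transpositions of coinciding labels, and unfold through the
   reflections in the two perpendicular sides to a neighbourhood in the plane.
   These unfoldings are the charts.  The group generated by the dihedral
   symmetries and the transpositions fixing a face has order 10, 4, 8 for
   faces of dimension 2, 1, 0, and its cosets in [S_5] count the faces:
   12 - 30 + 15 = -3. *)

(** The step from directions back to labels and shapes has no closed formula: the balance point is
    obtained only as a minimum of the sum of distances to the vertices, and the correspondence has
    to be inverted also where vertices coincide. Two observations do this. Which directions coincide
    and which one follows which is a finite datum, determined by the collapsed sides; that it fixes
    the labels up to rotation and coincidences is checked over all patterns and permutations. Once
    the labels match, the vertices of both pentagons lie on the same rays up to a turn; the ratios
    of the distances along these rays then vary monotonically around the pentagon, hence are
    constant, and the pentagons agree.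

    Coordinates are chosen so that the two sides of the cell at a corner lie on coordinate planes,
    and unfolding is a change of signs. Distances agree in charts at different corners because the
    unfolded Lorentz product has an expression in the pairs [(x, s)] alone, in which no corner
    occurs. *)

Lemma sum5 (V : zmodType) (F : 'I_5 -> V) :
  \sum_k F k = F 0 + F 1 + F 2 + F 3 + F 4.
Proof.
rewrite !big_ord_recl big_ord0 addr0 !addrA.
by congr (F _ + F _ + F _ + F _ + F _); apply: val_inj.
Qed.

(** Labels are treated as elements of the ring ['I_5], so that [ring] handles cyclic indices; the
    cases are stated at numerals, on which functions given by [nth] compute. *)
Lemma ord5P (P : 'I_5 -> Prop) :
  P 0 -> P 1 -> P 2 -> P 3 -> P 4 -> forall k, P k.
Proof.
move=> P0 P1 P2 P3 P4 [[|[|[|[|[|//]]]]] lt_k5].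
- by rewrite (_ : Ordinal _ = 0)//; apply: val_inj.
- by rewrite (_ : Ordinal _ = 1)//; apply: val_inj.
- by rewrite (_ : Ordinal _ = 2)//; apply: val_inj.
- by rewrite (_ : Ordinal _ = 3)//; apply: val_inj.
- by rewrite (_ : Ordinal _ = 4)//; apply: val_inj.
Qed.

Lemma ordS5 (k : 'I_5) : ordS k = k + 1.
Proof. by move: k; apply: ord5P; apply: val_inj. Qed.

Lemma ord_pred5 (k : 'I_5) : ord_pred k = k - 1.
Proof. by move: k; apply: ord5P; apply: val_inj. Qed.

Lemma sum5S (V : zmodType) (F : 'I_5 -> 'I_5 -> V) :
  \sum_k F k (ordS k) = F 0 1 + F 1 2 + F 2 3 + F 3 4 + F 4 0.
Proof. by rewrite sum5; congr (F _ _ + F _ _ + F _ _ + F _ _ + F _ _); apply: val_inj. Qed.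

(** * Fifth roots of unity *)

Section Constants.
Variable R : realType.

(** The inverse golden ratio. The fifth roots of unity have coordinates in the field generated by
    [psi] and [sn], so metric identities reduce to [ring] and [field] modulo [psi2]. *)
Definition psi : R := 2 * cos (2 * pi / 5).
Definition sn : R := sin (2 * pi / 5).

Lemma psi_gt0 : 0 < psi.
Proof.
have := pi_gt0 R => pi0.
by rewrite /psi mulr_gt0 // cos_gt0_pihalf //; apply/andP; split; lra.
Qed.

Lemma sn_gt0 : 0 < sn.
Proof.
have := pi_gt0 R => pi0.
by rewrite /sn sin_gt0_pi //; apply/andP; split; lra.
Qed.

(* [cos (2 t) = cos (3 t)] for [t = 2 * pi / 5], as [3 t = 2 * pi - 2 t]. *)
Lemma psi2 : psi ^+ 2 = 1 - psi.
Proof.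
set t : R := 2 * pi / 5; have sn0 := sn_gt0; have p0 := psi_gt0.
have e : cos (t *+ 2) = cos (t *+ 2 + t).
  rewrite -(cosN (t *+ 2 + t)) -[in RHS](cosD2pi (- _)).
  by congr (cos _); rewrite /t; field.
have s2 := sin2cos2 t.
move: e; rewrite (cosD (t *+ 2)) sin_mulr2n cos_mulr2n => e.
have {e} : (psi - 2) * (psi ^+ 2 + psi - 1) = 0.
  rewrite /psi -/t; move: e s2; set c := cos t; set s := sin t => e s2.
  have -> : (2 * c - 2) * ((2 * c) ^+ 2 + 2 * c - 1) =
     2 * ((c ^+ 2 *+ 2 - 1) * c - (c * s *+ 2) * s - (c ^+ 2 *+ 2 - 1))
      by ring: s2.
  by rewrite -e; ring.
have : psi - 2 != 0.
  rewrite subr_eq0; apply/eqP => psi_2; have c1 : cos t = 1.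
    by move: psi_2; rewrite /psi -/t; lra.
  have : 0 < sn ^+ 2 by rewrite exprn_gt0.
  by rewrite /sn -/t s2 c1; lra.
by move=> n0 /eqP; rewrite mulf_eq0 (negbTE n0) /= => /eqP; lra.
Qed.

Lemma sn2 : sn ^+ 2 = (3 + psi) / 4.
Proof.
have -> : sn ^+ 2 = 1 - psi ^+ 2 / 4 by rewrite /sn /psi sin2cos2; field.
by rewrite psi2; field.
Qed.

Lemma psi_bounds : 3 / 5 < psi < 2 / 3.
Proof. by have := psi2; have := psi_gt0 => *; apply/andP; split; nra. Qed.

Lemma zetaE : zeta R 5 = (psi / 2) +i* sn.
Proof.
rewrite /zeta /psi /sn; congr (_ +i* _).
by field.
Qed.

Definition zre (k : 'I_5) : R :=
  nth 0 [:: 1; psi / 2; - (1 + psi) / 2; - (1 + psi) / 2; psi / 2] k.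
Definition zim (k : 'I_5) : R :=
  nth 0 [:: 0; sn; psi * sn; - (psi * sn); - sn] k.

Definition zeta5 (k : 'I_5) : R[i] := zre k +i* zim k.

Lemma zetaX (k : 'I_5) : zeta R 5 ^+ k = zeta5 k.
Proof.
have p2 := psi2; have s2 := sn2; rewrite zetaE /zeta5 /zre /zim.
have s2p : psi * sn ^+ 2 = (3 * psi + psi ^+ 2) / 4 :> R by rewrite s2; field.
have p2s : psi ^+ 2 * sn = sn - psi * sn :> R by rewrite p2; ring.
have mulE (a b c d : R) : (a +i* b) * (c +i* d) =
  (a * c - b * d) +i* (a * d + b * c) by [].
have z2 : (psi / 2 +i* sn) ^+ 2 = (- (1 + psi) / 2) +i* (psi * sn).
  by rewrite expr2 mulE; congr (_ +i* _); lra.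
have z3 : (psi / 2 +i* sn) ^+ 3 = (- (1 + psi) / 2) +i* (- (psi * sn)).
  by rewrite exprS z2 mulE; congr (_ +i* _); lra.
have z4 : (psi / 2 +i* sn) ^+ 4 = (psi / 2) +i* (- sn).
  by rewrite exprS z3 mulE; congr (_ +i* _); lra.
by move: k; apply: ord5P; rewrite ?expr0 ?expr1 ?z2 ?z3 ?z4.
Qed.

End Constants.
Arguments psi {R}.
Arguments sn {R}.

(** * Area and shape of equiangular pentagons *)

Section Coordinates.
Variable R : realType.
Implicit Types (x y : 'rV[R]_5) (u v : R[i]).

Lemma crossE u v :
  cross u v = complex.Re u * complex.Im v - complex.Im u * complex.Re v.
Proof. by case: u v => a b [c d]; rewrite /cross /= mulNr. Qed.

Lemma complex_sum (I : finType) (P : pred I) (F G : I -> R) :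
  \sum_(i | P i) (F i +i* G i) = (\sum_(i | P i) F i) +i* (\sum_(i | P i) G i).
Proof.
by apply: (big_rec3 (fun a b c => c = a +i* b)) => // i a b c _ ->.
Qed.

Lemma scale_zeta5 (r : R) (k : 'I_5) :
  r%:C * zeta5 R k = (r * zre R k) +i* (r * zim R k).
Proof.
rewrite /zeta5; set a := zre R k; set b := zim R k.
have -> : r%:C * (a +i* b) = (r * a - 0 * b) +i* (r * b + 0 * a) by [].
by rewrite !mul0r subr0 addr0.
Qed.

Lemma verticesE x k : vertices x k =
  (\sum_(j < 5 | (j <= k)%N) x 0 j * zre R j) +i*
  (\sum_(j < 5 | (j <= k)%N) x 0 j * zim R j).
Proof.
rewrite /vertices -complex_sum; apply: eq_bigr => j _.
by rewrite zetaX scale_zeta5.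
Qed.

Lemma closes_upE x : closes_up x <->
  \sum_j x 0 j * zre R j = 0 /\ \sum_j x 0 j * zim R j = 0.
Proof.
rewrite /closes_up (eq_bigr (fun j => (x 0 j * zre R j) +i* (x 0 j * zim R j))).
  by rewrite complex_sum; split=> [[]//|[-> ->]].
by move=> j _; rewrite zetaX scale_zeta5.
Qed.

(* The coordinates [tcoord x], [x 0 1] and [x 0 3] are orthogonal for the area
   form; the polygon with [x 0 1 = x 0 3 = 0] is a vertex of the cell. *)
Definition tcoord x : R := x 0 2 + (1 + psi) * (x 0 1 + x 0 3).

Lemma closes_upP x : closes_up x <->
  x 0 0 = psi * tcoord x - (1 + psi) * x 0 1 /\
  x 0 4 = psi * tcoord x - (1 + psi) * x 0 3.
Proof.
rewrite closes_upE !sum5 /zre /zim /tcoord /=.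
have p2 := @psi2 R; have s0 := @sn_gt0 R; have p0 := @psi_gt0 R.
set x0 := x 0 0; set x1 := x 0 1; set x2 := x 0 2; set x3 := x 0 3.
set x4 := x 0 4; split=> [[e1 e2]|[-> ->]]; last first.
  by split; field: p2.
have {}e2 : x1 - x4 + psi * (x2 - x3) = 0.
  apply: (mulfI (lt0r_neq0 s0)); rewrite mulr0 -e2; ring.
have e3 : x4 = x1 + psi * (x2 - x3) by lra.
have {}e1 : 2 * x0 + psi * (x1 + x4) - (1 + psi) * (x2 + x3) = 0 by lra.
split; last by rewrite e3; ring: p2.
have e4 : 2 * x0 = (1 + psi) * (x2 + x3) - psi * (x1 + x4) by lra.
apply: (mulfI (_ : 2 != 0 :> R)) => //; rewrite e4 e3; ring: p2.
Qed.

Lemma area5 x : closes_up x -> area x =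
  sn / 2 * ((1 - psi) * tcoord x ^+ 2 - (1 + psi) * (x 0 1 ^+ 2 + x 0 3 ^+ 2)).
Proof.
move=> /[dup] /closes_upE [c1 c2] /closes_upP [e0 e4].
have e2 : x 0 2 = tcoord x - (1 + psi) * (x 0 1 + x 0 3) by rewrite /tcoord; ring.
have p2 := @psi2 R.
have v0 : vertices x 0 = x 0 0 +i* 0.
  by rewrite verticesE; congr (_ +i* _);
    rewrite big_mkcond sum5 /= /zre /zim /=; ring.
have v1 : vertices x 1 = (x 0 0 + x 0 1 * (psi / 2)) +i* (x 0 1 * sn).
  by rewrite verticesE; congr (_ +i* _);
    rewrite big_mkcond sum5 /= /zre /zim /=; ring.
have v2 : vertices x 2 =
  (x 0 0 + x 0 1 * (psi / 2) + x 0 2 * (- (1 + psi) / 2)) +i*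
  (x 0 1 * sn + x 0 2 * (psi * sn)).
  by rewrite verticesE; congr (_ +i* _);
    rewrite big_mkcond sum5 /= /zre /zim /=; ring.
(* Closing up allows counting backwards: vertex [4] is the origin and vertex [3] is minus the last
   edge. *)
have v3 : vertices x 3 = (- (x 0 4 * (psi / 2))) +i* (x 0 4 * sn).
  rewrite verticesE; congr (_ +i* _);
    rewrite big_mkcond sum5 /=; move: c1 c2; rewrite !sum5 /zre /zim /=; lra.
have v4 : vertices x 4 = 0 +i* 0.
  by rewrite verticesE; congr (_ +i* _); [rewrite -[RHS]c1|rewrite -[RHS]c2];
    rewrite big_mkcond sum5 [RHS]sum5 /=.
rewrite /area /signed_area (sum5S (fun i j => cross (vertices x i) (vertices x j))).
rewrite v0 v1 v2 v3 v4 !crossE /=.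
by rewrite e0 e4 e2; field: p2.
Qed.

End Coordinates.

(** * The Lorentz form and its dihedral symmetries *)

Section Dihedral.
Variable R : realType.
Implicit Types (x y : 'rV[R]_5).

(** The polarized area in orthogonal coordinates; it is Lorentzian of signature (1, 2) because
    [psi < 1]. *)
Definition gram x y : R := sn / 2 *
  ((1 - psi) * (tcoord x * tcoord y) - (1 + psi) * (x 0 1 * y 0 1 + x 0 3 * y 0 3)).

Lemma closes_upD x y : closes_up x -> closes_up y -> closes_up (x + y).
Proof.
rewrite /closes_up => ex ey.
transitivity (\sum_(k < 5) ((x 0 k)%:C * zeta R 5 ^+ k + (y 0 k)%:C * zeta R 5 ^+ k)).
  by apply: eq_bigr => k _; rewrite mxE rmorphD mulrDl.
by rewrite big_split /= ex ey addr0.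
Qed.

Lemma closes_upZ (r : R) x : closes_up x -> closes_up (r *: x).
Proof.
rewrite /closes_up => ex.
transitivity (r%:C * \sum_(k < 5) (x 0 k)%:C * zeta R 5 ^+ k).
  by rewrite mulr_sumr; apply: eq_bigr => k _; rewrite mxE rmorphM mulrA.
by rewrite ex mulr0.
Qed.

Lemma area_gram x : closes_up x -> area x = gram x x.
Proof. by move=> cx; rewrite area5 // /gram; ring. Qed.

Lemma area_formE x y : closes_up x -> closes_up y -> area_form x y = gram x y.
Proof.
move=> cx cy; rewrite /area_form !area_gram //; last exact: closes_upD.
by rewrite /gram /tcoord !mxE; field.
Qed.

(* On closed polygons the area form is also a combination of the two
   quadratic forms which are visibly invariant under relabelling. *)
Definition gram_sum : R := sn / 50 * (4 + 3 * psi).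
Definition gram_diag : R := sn / 10 * (1 + 2 * psi).

Lemma gram_symmetric x y : closes_up x -> closes_up y -> gram x y =
  gram_sum * ((\sum_k x 0 k) * (\sum_k y 0 k)) - gram_diag * \sum_k x 0 k * y 0 k.
Proof.
move=> /closes_upP[x0 x4] /closes_upP[y0 y4]; rewrite !sum5.
have x2 : x 0 2 = tcoord x - (1 + psi) * (x 0 1 + x 0 3) by rewrite /tcoord; ring.
have y2 : y 0 2 = tcoord y - (1 + psi) * (y 0 1 + y 0 3) by rewrite /tcoord; ring.
have p2 := @psi2 R; rewrite /gram /gram_sum /gram_diag x0 x4 y0 y4 x2 y2.
by field: p2.
Qed.

Lemma zeta5D (j k : 'I_5) : zeta5 R (j + k) = zeta5 R j * zeta5 R k.
Proof.
have z5 : zeta R 5 ^+ 5 = 1.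
  have p2 := @psi2 R; have s2 := @sn2 R.
  have s2p : psi * sn ^+ 2 = (3 * psi + psi ^+ 2) / 4 :> R by rewrite s2; field.
  rewrite exprS (zetaX R 4) zetaE /zeta5 /zre /zim /=.
  have -> : ((psi / 2 +i* sn) * (psi / 2 +i* - sn) : R[i]) =
     (psi / 2 * (psi / 2) - sn * - sn) +i* (psi / 2 * - sn + sn * (psi / 2)) by [].
  by congr (_ +i* _); lra.
by rewrite -!zetaX -exprD -(expr_mod (j + k)%N z5).
Qed.

Lemma zeta5N (k : 'I_5) : zeta5 R (- k) = conjc (zeta5 R k).
Proof.
by move: k; apply: ord5P; rewrite /zeta5 /zre /zim /= ?oppr0 ?opprK.
Qed.

Lemma norm_zeta5 (k : 'I_5) : `|zeta5 R k| = 1.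
Proof.
have z0 : zeta5 R 0 = 1 by [].
apply: (@pexpIrn _ 2) => //; rewrite ?nnegrE ?normr_ge0 ?ler01 //.
by rewrite normCK expr1n; rewrite -[X in _ * X]zeta5N -zeta5D subrr.
Qed.

Lemma vertices_step x (k : 'I_5) : closes_up x ->
  vertices x k - vertices x (k - 1) = (x 0 k)%:C * zeta5 R k.
Proof.
move=> cx; have [_ H] := equiangular_mod_translation (vertices x) x.
rewrite -ord_pred5 -zetaX; apply: H.
by split=> //; exists 0 => j; rewrite addr0.
Qed.

(** A pair [(b, a)] is a reflection if [b] holds and a rotation otherwise. A bare finite type lets
    its elements be matched on and enumerated by computation. *)
Definition dih : finType := (bool * 'I_5)%type.

Definition dvert (g : dih) (k : 'I_5) := if g.1 then g.2 - k else g.2 + k.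

(* The side [k] joins the vertices [k - 1] and [k]. *)
Definition dside (g : dih) (k : 'I_5) := if g.1 then g.2 + 1 - k else g.2 + k.

Definition dact x (g : dih) : 'rV[R]_5 := \row_k x 0 (dside g k).

Definition conj_if (b : bool) (u : R[i]) := if b then conjc u else u.

Lemma dact_vertices x g : closes_up x -> closes_up (dact x g) /\
  exists mu w : R[i], `|mu| = 1 /\
    forall k, vertices (dact x g) k = mu * conj_if g.1 (vertices x (dvert g k)) + w.
Proof.
move=> cx; have main mu : `|mu| = 1 ->
    (forall k, mu * conj_if g.1 (vertices x (dvert g k)) -
      mu * conj_if g.1 (vertices x (dvert g (k - 1))) =
      (x 0 (dside g k))%:C * zeta5 R k) ->
    closes_up (dact x g) /\ exists mu w : R[i], `|mu| = 1 /\
      forall k, vertices (dact x g) k = mu * conj_if g.1 (vertices x (dvert g k)) + w.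
  move=> mu1 step; have [H _] := equiangular_mod_translation
    (fun k => mu * conj_if g.1 (vertices x (dvert g k))) (dact x g).
  case: H => [k|cg [w Hw]].
    by rewrite ord_pred5 zetaX step mxE.
  by split=> //; exists mu, (- w); split=> // k; rewrite Hw addrK.
case: g main => [[] a] /= main.
  apply: (main (- zeta5 R (a + 1))); first by rewrite normrN norm_zeta5.
  move=> k; rewrite /dvert /dside /= opprB addrCA -mulrBr -rmorphB.
  rewrite -opprB rmorphN mulrNN (_ : a - k = a + 1 - k - 1); last by ring.
  rewrite (_ : 1 + (a + 1 - k - 1) = a + 1 - k); last by ring.
  rewrite vertices_step // rmorphM /= mulrCA.
  rewrite (_ : zeta5 R k = zeta5 R (a + 1) * zeta5 R (- (a + 1 - k))).
    by rewrite zeta5N oppr0.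
  by rewrite -zeta5D; congr zeta5; ring.
apply: (main (zeta5 R (- a))); first by rewrite norm_zeta5.
move=> k; rewrite /dvert /dside /= addrA -mulrBr vertices_step // mulrCA.
by rewrite -zeta5D addrA addNr add0r.
Qed.

Lemma dact_closes_up x g : closes_up x -> closes_up (dact x g).
Proof. by move=> cx; case: (dact_vertices g cx). Qed.

Lemma dside_inj g : injective (dside g).
Proof.
by case: g => [[] a] j k; rewrite /dside /= => /addrI; rewrite // => /oppr_inj.
Qed.

Lemma dact_gram x y g : closes_up x -> closes_up y ->
  gram (dact x g) (dact y g) = gram x y.
Proof.
move=> cx cy; rewrite !gram_symmetric //; try exact: dact_closes_up.
have sumE (F : 'I_5 -> R) : \sum_k F (dside g k) = \sum_k F k.
  by rewrite [RHS](reindex_inj (@dside_inj g)).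
congr (_ * (_ * _) - _ * _); rewrite -[RHS]sumE; apply: eq_bigr => k _;
  by rewrite !mxE.
Qed.

End Dihedral.

(** * The closed cell as the set of pentagons with nonnegative sides *)

Section Cell.
Variable R : realType.
Implicit Types (x y : 'rV[R]_5) (u v w : R[i]).

Lemma crossDr u v w : cross u (v + w) = cross u v + cross u w.
Proof. by rewrite /cross mulrDr raddfD. Qed.
Lemma crossDl u v w : cross (u + v) w = cross u w + cross v w.
Proof. by rewrite /cross rmorphD mulrDl raddfD. Qed.
Lemma crossNr u v : cross u (- v) = - cross u v.
Proof. by rewrite /cross mulrN raddfN. Qed.
Lemma crossNl u v : cross (- u) v = - cross u v.
Proof. by rewrite /cross rmorphN mulNr raddfN. Qed.
Lemma crossZr (r : R) u v : cross u (r%:C * v) = r * cross u v.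
Proof. by rewrite !crossE; case: u v => a b [c d] /=; ring. Qed.
Lemma crossZl (r : R) u v : cross (r%:C * u) v = r * cross u v.
Proof. by rewrite !crossE; case: u v => a b [c d] /=; ring. Qed.
Lemma cross0 u : cross u 0 = 0. Proof. by rewrite /cross mulr0. Qed.
Lemma crossC u v : cross v u = - cross u v.
Proof. by rewrite !crossE; ring. Qed.

Lemma crossvv u : cross u u = 0. Proof. by rewrite !crossE; ring. Qed.

Lemma cross_zeta5 (j k : 'I_5) : cross (zeta5 R j) (zeta5 R k) = zim R (k - j).
Proof. by rewrite /cross -zeta5N -zeta5D addrC. Qed.

(* Distances of the vertices from the line carrying the side [k], counted from
   that side. *)
Definition side_height x (k m : 'I_5) : R :=
  nth 0 [:: 0; x 0 (k + 1) * sn; (x 0 (k + 1) + x 0 (k + 2) * psi) * sn;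
            x 0 (k - 1) * sn; 0] m.

Lemma vertices_stepS x (k : 'I_5) : closes_up x ->
  vertices x (k + 1) = vertices x k + (x 0 (k + 1))%:C * zeta5 R (k + 1).
Proof. by move=> cx; rewrite -vertices_step // addrK [RHS]addrC subrK. Qed.

Lemma side_heightE x (k m : 'I_5) : closes_up x ->
  cross (zeta5 R k) (vertices x (k + m) - vertices x k) = side_height x k m.
Proof.
move=> cx; have st j : vertices x (j + 1) = vertices x j + (x 0 (j + 1))%:C * zeta5 R (j + 1).
  exact: vertices_stepS.
move: m; apply: ord5P; rewrite /side_height /=.
- by rewrite addr0 subrr cross0.
- rewrite st addrC addKr crossZr cross_zeta5 (_ : k + 1 - k = 1); last by ring.
  by rewrite /zim.
- rewrite (_ : k + 2 = k + 1 + 1) ?st; last by ring.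
  rewrite [X in cross _ X](_ : _ = (x 0 (k + 1))%:C * zeta5 R (k + 1) +
     (x 0 (k + 1 + 1))%:C * zeta5 R (k + 1 + 1)); last by ring.
  rewrite crossDr !crossZr !cross_zeta5 (_ : k + 1 - k = 1); last by ring.
  rewrite (_ : k + 1 + 1 - k = 2); last by ring.
  by rewrite /zim /=; ring.
- rewrite -(subrK (vertices x (k - 1)) (vertices x k)) vertices_step //.
  rewrite -[vertices x (k - 1)](subrK (vertices x (k - 1 - 1))) vertices_step //.
  rewrite (_ : k - 1 - 1 = k + 3); last by rewrite -addrA; congr (_ + _); apply: val_inj.
  rewrite [X in cross _ X](_ : _ = - ((x 0 k)%:C * zeta5 R k) +
     - ((x 0 (k - 1))%:C * zeta5 R (k - 1))); last by ring.
  rewrite crossDr !crossNr !crossZr !cross_zeta5 subrr.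
  rewrite (_ : k - 1 - k = - 1); last by ring.
  by rewrite /zim /=; ring.
- rewrite (_ : k + 4 = k - 1); last by congr (_ + _); apply: val_inj.
  rewrite -opprB crossNr vertices_step // crossZr cross_zeta5 subrr.
  by rewrite /zim /= mulr0 oppr0.
Qed.

Lemma positive_strictly_convex x : closes_up x -> (forall k, 0 < x 0 k) ->
  strictly_convex (vertices x).
Proof.
move=> cx x0 k j; rewrite ordS5 => jk jk1.
have s0 := @sn_gt0 R; have p0 := @psi_gt0 R.
have Vk : vertices x (k + 1) - vertices x k = (x 0 (k + 1))%:C * zeta5 R (k + 1).
  by rewrite vertices_stepS // addrC addKr.
rewrite Vk crossZl mulr_gt0 //.
have -> : vertices x j - vertices x k = (vertices x j - vertices x (k + 1))
   + (vertices x (k + 1) - vertices x k) by ring.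
rewrite crossDr Vk crossZr cross_zeta5 subrr /= mulr0 addr0.
have -> : j = k + 1 + (j - k - 1) by ring.
rewrite side_heightE //.
have : j - k - 1 != 0 by apply: contraNneq jk1 => e; rewrite -subr_eq0 opprD addrA e.
have : j - k - 1 != 4.
  apply: contraNneq jk => e; rewrite -subr_eq0.
  by rewrite -[_ - k](subrK 1) e.
move: (j - k - 1); apply: ord5P => //= _ _; rewrite /side_height /=.
- by rewrite mulr_gt0.
- by rewrite mulr_gt0 // addr_gt0 // mulr_gt0.
- by rewrite mulr_gt0.
Qed.

(** The triangle on the vertices [k - 1], [k], [k + 1] has doubled signed area
    [x 0 k * x 0 (k + 1) * sn]. *)
Lemma strictly_convex_sides x (k : 'I_5) : closes_up x ->
  strictly_convex (vertices x) -> 0 < x 0 k * x 0 (k + 1).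
Proof.
move=> cx /(_ (k - 1) (k + 1)); rewrite ordS5 subrK => /(_ _ _)/wrap[].
- by rewrite -subr_eq0 opprB addrA addrC (_ : _ + _ = 2)//; ring.
- by rewrite -subr_eq0 addrAC subrr.
have s0 := @sn_gt0 R.
rewrite vertices_step // crossZl.
have -> : vertices x (k + 1) - vertices x (k - 1) = (vertices x (k + 1) - vertices x k)
   + (vertices x k - vertices x (k - 1)) by ring.
rewrite crossDr side_heightE // vertices_step // crossZr cross_zeta5 subrr.
by rewrite /side_height /= mulr0 addr0 mulrA pmulr_lgt0.
Qed.

Lemma closes_up1 : closes_up (const_mx 1 : 'rV[R]_5).
Proof.
by apply/closes_upP; rewrite /tcoord !mxE; split; ring: (@psi2 R).
Qed.

Definition gram_one : R := sn / 10 * (3 + psi).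
Lemma gram_one_gt0 : 0 < gram_one.
Proof. by rewrite /gram_one; have := @sn_gt0 R; have := @psi_gt0 R => *; nra. Qed.

(** Up to a factor the perimeter is the mixed area with the regular pentagon, so the sheet condition
    in [lorentz] says that the perimeter is positive. *)
Lemma gram_const x : closes_up x -> gram x (const_mx 1) = gram_one * \sum_k x 0 k.
Proof.
move=> cx; rewrite gram_symmetric //; last exact: closes_up1.
under [X in _ - _ * X]eq_bigr do rewrite mxE mulr1.
under [X in _ * (_ * X)]eq_bigr do rewrite mxE.
by rewrite [X in _ * (_ * X)]sum5 /gram_one /gram_sum /gram_diag; field.
Qed.

Definition is_cell x := [/\ closes_up x, gram x x = 1 & forall k, 0 <= x 0 k].

Lemma is_cell_sum x : is_cell x -> 0 < \sum_k x 0 k.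
Proof.
move=> [cx gx x0]; rewrite lt_def sumr_ge0 // andbT.
apply: contra_eq_neq gx => /eqP; rewrite psumr_eq0 // => /allP x00.
have {}x00 k : x 0 k = 0 by apply/eqP/x00; rewrite mem_index_enum.
by rewrite /gram /tcoord !x00 !(mulr0, addr0, subrr, mul0r) eq_sym oner_eq0.
Qed.

(** Strict convexity only gives all sides the same sign, as a half turn makes all of them negative;
    the sheet excludes the negative sign. *)
Lemma convex_classes_gt0 x : convex_classes x -> forall k, 0 < x 0 k.
Proof.
move=> [[cx ax]]; rewrite area_formE //; last exact: closes_up1.
rewrite gram_const // pmulr_rgt0 ?gram_one_gt0 // => sx scx.
have H (k j : 'I_5) : val j = val (k + 1) -> 0 < x 0 k * x 0 j.
  by move=> /val_inj ->; exact: strictly_convex_sides.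
move: sx (H 3 4 erefl) (H 2 3 erefl) (H 1 2 erefl) (H 0 1 erefl); rewrite sum5.
 set x0 := x 0 0; set x1 := x 0 1; set x2 := x 0 2; set x3 := x 0 3.
set x4 := x 0 4 => sx h3 h2 h1 h0 {H}.
have x00 : 0 < x0.
  rewrite ltNge; apply/negP => x0le.
  have x0lt : x0 < 0 by rewrite lt_def x0le andbT; apply/eqP => e; move: h0; rewrite -e mul0r ltxx.
  move: h0; rewrite nmulr_rgt0 // => x1lt.
  move: h1; rewrite nmulr_rgt0 // => x2lt.
  move: h2; rewrite nmulr_rgt0 // => x3lt.
  move: h3; rewrite nmulr_rgt0 // => x4lt; lra.
move: h0; rewrite pmulr_rgt0 // => x10.
move: h1; rewrite pmulr_rgt0 // => x20.
move: h2; rewrite pmulr_rgt0 // => x30.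
by move: h3; rewrite pmulr_rgt0 // => x40; apply: ord5P.
Qed.

Lemma cellP x : closed_convex_classes x <-> is_cell x.
Proof.
split=> [[clx [cx ax _]]|cex].
  split=> //; first by rewrite -area_gram.
  move=> k; have clk : closed [set y : 'rV[R]_5 | 0 <= y 0 k].
    apply: (@preimage_closed _ _ (fun y : 'rV[R]_5 => y 0 k) [set r : R | 0 <= r]) => //.
    - by move=> y _; exact: coord_continuous.
  suff : closure (@convex_classes R 5) `<=` [set y : 'rV[R]_5 | 0 <= y 0 k] by exact.
  rewrite (closure_id [set y : 'rV[R]_5 | 0 <= y 0 k]).1 //.
  by apply: closure_subset => y /convex_classes_gt0 /(_ k) /ltW.
have [cx gx x0] := cex; have sx := is_cell_sum cex; have c1 := closes_up1.
have g1 := gram_one_gt0; split; last first.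
  by split; rewrite ?area_gram // area_formE // gram_const // mulr_gt0.
(* Adding a small multiple of the regular pentagon makes all sides positive; rescaling to area 1
   then gives nearby strictly convex pentagons. *)
pose y e : 'rV[R]_5 := x + e *: const_mx 1.
have cy e : closes_up (y e) by apply: closes_upD => //; exact: closes_upZ.
pose b := gram_one * \sum_k x 0 k.
have gy e : gram (y e) (y e) = 1 + e * (2 * b) + e ^+ 2 * (5 * gram_one).
  have -> : gram (y e) (y e) = gram x x + 2 * e * gram x (const_mx 1) +
      e ^+ 2 * gram (const_mx 1) (const_mx 1).
    by rewrite /gram /tcoord !mxE; ring.
  rewrite gx !gram_const // -/b.
  under eq_bigr do rewrite mxE.
  by rewrite sum5; ring.
pose f e : 'rV[R]_5 := (Num.sqrt (1 + e * (2 * b) + e ^+ 2 * (5 * gram_one)))^-1 *: y e.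
have fx : f e @[e --> (0 : R)] --> x.
  have -> : x = (Num.sqrt (1 + 0 * (2 * b) + 0 ^+ 2 * (5 * gram_one)))^-1 *: y 0.
    by rewrite /y scale0r addr0 expr0n /= !mul0r !addr0 sqrtr1 invr1 scale1r.
  apply: cvgZ; last first.
    by apply: cvgD; [exact: cvg_cst|apply: cvgZr_tmp; exact: cvg_id].
  apply: cvgV; first by rewrite expr0n /= !mul0r !addr0 sqrtr1 oner_neq0.
  apply: continuous_cvg; first exact: sqrt_continuous.
  apply: cvgD; first apply: cvgD; first exact: cvg_cst.
    by apply: cvgMr_tmp; exact: cvg_id.
  by apply: cvgMr_tmp; exact: exprn_continuous.
move=> B /fx /nbhs_ballP[e /= e0 He].
have e20 : 0 < e / 2 by rewrite divr_gt0.
exists (f (e / 2)); split; last first.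
  by apply: He; rewrite /ball /= sub0r normrN gtr0_norm // ltr_pdivrMr // ltr_pMr // ltr1n.
have bge : 0 <= b by rewrite mulr_ge0 // ltW.
have gy0 : 0 < gram (y (e / 2)) (y (e / 2)).
  have h1 : 0 <= e / 2 * (2 * b) by apply: mulr_ge0; [exact: ltW|exact: mulr_ge0].
  have h2 : 0 <= (e / 2) ^+ 2 * (5 * gram_one) by apply: mulr_ge0; [exact: sqr_ge0|apply: mulr_ge0 => //; exact: ltW].
  by rewrite gy; lra.
have f0 k : 0 < f (e / 2) 0 k.
  rewrite !mxE mulr_gt0 // ?invr_gt0 ?sqrtr_gt0 -?gy //.
  by rewrite mulr1 ltr_wpDl.
have cf : closes_up (f (e / 2)) by exact: closes_upZ.
split; last exact: positive_strictly_convex.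
split=> //.
  rewrite area_gram // /f -gy; set r := Num.sqrt _.
  have -> : gram (r^-1 *: y (e / 2)) (r^-1 *: y (e / 2)) =
      r^-1 ^+ 2 * gram (y (e / 2)) (y (e / 2)).
    by rewrite /gram /tcoord !mxE; ring.
  by rewrite exprVn sqr_sqrtr ?mulVf // ?ltW // gt_eqF.
by rewrite area_formE // gram_const // mulr_gt0 // sum5 !addr_gt0.
Qed.

End Cell.

(** * Balance points *)

Section GeometricMedian.
Variable R : realType.
Implicit Types (u v d p q : R[i]).

Definition cmod u : R := Num.sqrt (complex.Re u ^+ 2 + complex.Im u ^+ 2).
Definition dotc u v : R :=
  complex.Re u * complex.Re v + complex.Im u * complex.Im v.

Lemma normcmod u : `|u| = (cmod u)%:C. Proof. exact: normc_def. Qed.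

Lemma cmod_ge0 u : 0 <= cmod u. Proof. exact: sqrtr_ge0. Qed.

Lemma cmodD u v : cmod (u + v) <= cmod u + cmod v.
Proof. by have := ler_normD u v; rewrite !normcmod -rmorphD lecR. Qed.

Lemma cmodN u : cmod (- u) = cmod u.
Proof. by rewrite /cmod !raddfN /= !sqrrN. Qed.

Lemma cmodZ (r : R) u : cmod (r%:C * u) = `|r| * cmod u.
Proof.
have : `|r%:C * u| = (`|r| * cmod u)%:C.
  by rewrite normrM (normcmod u) normc_def /= expr0n addr0 sqrtr_sqr -rmorphM.
by rewrite normcmod => -[].
Qed.

Lemma sqr_cmod u : cmod u ^+ 2 = dotc u u.
Proof. by rewrite sqr_sqrtr ?addr_ge0 ?sqr_ge0 // /dotc -!expr2. Qed.

Lemma cmod_eq0 u : (cmod u == 0) = (u == 0).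
Proof. by rewrite -(normr_eq0 u) normcmod -(inj_eq (@complexI R)). Qed.

Lemma cmod_gt0 u : (0 < cmod u) = (u != 0).
Proof. by rewrite lt_def cmod_eq0 cmod_ge0 andbT. Qed.

Lemma dotcDl u v d : dotc (u + v) d = dotc u d + dotc v d.
Proof. by case: u v d => ? ? [? ?] [? ?]; rewrite /dotc /=; ring. Qed.
Lemma dotcZl (r : R) u v : dotc (r%:C * u) v = r * dotc u v.
Proof. by case: u v => ? ? [? ?]; rewrite /dotc /=; ring. Qed.

Lemma dotc_sum (I : finType) (P : pred I) (u : I -> R[i]) d :
  dotc (\sum_(k | P k) u k) d = \sum_(k | P k) dotc (u k) d.
Proof.
by elim/big_rec2: _ => [|k a b _ <-]; rewrite ?dotcDl // /dotc /= !mul0r addr0.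
Qed.

(** This second-order bound takes the place of differentiating the norm. With [r = cmod u] and
    [c = cmod (u - t%:C * d)], one has [c <= (r ^+ 2 + c ^+ 2) / (2 * r)], and the right side is
    exactly the quadratic polynomial in [t]. *)
Lemma cmod_move u d (t : R) : u != 0 ->
  cmod (u - t%:C * d) <=
  cmod u - t * dotc ((cmod u)^-1%:C * u) d + t ^+ 2 * (dotc d d / (2 * cmod u)).
Proof.
rewrite -cmod_gt0 => u0; rewrite dotcZl.
set r := cmod u; set b := (X in _ <= X); have r2 := sqr_cmod u; rewrite -/r in r2 u0.
have bE : b = (2 * r ^+ 2 - 2 * t * dotc u d + t ^+ 2 * dotc d d) / (2 * r).
  by rewrite /b; field; rewrite gt_eqF.
have E : cmod (u - t%:C * d) ^+ 2 = r ^+ 2 - 2 * t * dotc u d + t ^+ 2 * dotc d d.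
  rewrite sqr_cmod r2; case: (u) (d) => a a' [c c']; rewrite /dotc /=; ring.
have E0 := sqr_ge0 (cmod (u - t%:C * d)).
have rr : 0 < r ^+ 2 by rewrite exprn_gt0.
have b0 : 0 <= b by rewrite bE divr_ge0 // ?mulr_ge0 // ?ltW //; lra.
rewrite -(ler_pXn2r (n := 2)) ?nnegrE ?cmod_ge0 // E.
have {b0}bb : 2 * r * b = r ^+ 2 + (r ^+ 2 - 2 * t * dotc u d + t ^+ 2 * dotc d d).
  by rewrite bE; field; rewrite gt_eqF.
rewrite -E in bb *; set c := cmod _ ^+ 2 in bb *.
have : 0 <= (r - b) ^+ 2 by exact: sqr_ge0.
by nra.
Qed.

Variable P : 'I_5 -> R[i].

Definition total_dist p : R := \sum_k cmod (P k - p).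

Lemma unit_directionsE p k :
  unit_directions P p k = (cmod (P k - p))^-1%:C * (P k - p).
Proof. by rewrite /unit_directions normcmod mulrC fmorphV. Qed.

Lemma geometric_median : exists p, forall q, total_dist p <= total_dist q.
Proof.
(* Outside the square of half-width [M] around [P 0] the distance to [P 0] alone exceeds [M], so a
   minimum over the square is global. *)
pose M := total_dist (P 0).
pose c (i : 'I_2) := if i == 0 then complex.Re (P 0) else complex.Im (P 0).
pose box := [set v : 'rV[R]_2 | forall i, v ord0 i \in `[c i - M, c i + M]].
pose pt (v : 'rV[R]_2) : R[i] := v ord0 0 +i* v ord0 1.
have box_compact : compact box.
  apply: (@rV_compact _ _ (fun i => `[c i - M, c i + M]%classic)).
  by move=> i; apply: segment_compact.
have M0 : 0 <= M by apply: sumr_ge0 => k _; exact: cmod_ge0.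
have box0 : box (\row_i c i) by move=> i; rewrite mxE in_itv /=; apply/andP; split; lra.
have cont : {within box, continuous (fun v : 'rV[R]_2 => total_dist (pt v))}.
  apply: continuous_subspaceT => v; rewrite /total_dist.
  have H k : {for v, continuous (fun w : 'rV[R]_2 => cmod (P k - pt w))}.
    pose sq (w : 'rV[R]_2) :=
      (complex.Re (P k) - w ord0 0) ^+ 2 + (complex.Im (P k) - w ord0 1) ^+ 2.
    have -> : (fun w => cmod (P k - pt w)) = (@Num.sqrt R) \o sq.
      by apply/funext => w; rewrite /cmod /= /sq; case: (P k).
    have sqc : {for v, continuous sq}.
      apply: (@continuousD _ R^o); rewrite /continuous_at;
        apply: (@continuous_comp _ R R _ (fun r : R => r ^+ 2)); try exact: exprn_continuous;
        by apply: (@continuousB _ R^o); [exact: cst_continuous|exact: coord_continuous].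
    exact: (continuous_comp sqc (@sqrt_continuous R _)).
  rewrite (_ : (fun w : 'rV[R]_2 => _) = (fun w : 'rV[R]_2 => cmod (P 0 - pt w) + cmod (P 1 - pt w) +
    cmod (P 2 - pt w) + cmod (P 3 - pt w) + cmod (P 4 - pt w))); last first.
    by apply/funext => w; rewrite sum5.
  have CD (f g : 'rV[R]_2 -> R) : {for v, continuous f} -> {for v, continuous g} ->
      {for v, continuous (fun w => f w + g w)} by exact: (@continuousD _ R^o).
  exact: (CD _ _ (CD _ _ (CD _ _ (CD _ _ (H 0) (H 1)) (H 2)) (H 3)) (H 4)).
have [v _ vmin] := compact_EVT_min (ex_intro _ _ box0) box_compact cont.
exists (pt v) => -[a b]; pose w : 'rV[R]_2 := \row_i (if i == 0 then a else b).
have wE : pt w = a +i* b by rewrite /pt !mxE.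
have [wbox|nwbox] := pselect (box w); first by rewrite -wE; apply: vmin; rewrite inE.
have : M < total_dist (a +i* b).
  apply: (@lt_le_trans _ _ (cmod (P 0 - (a +i* b)))); last first.
    rewrite /total_dist sum5 -!addrA lerDl !addr_ge0 ?cmod_ge0 //.
  rewrite ltNge; apply: contra_notN nwbox => le_M.
  have sq : dotc (P 0 - (a +i* b)) (P 0 - (a +i* b)) <= M ^+ 2.
    by rewrite -sqr_cmod ler_pXn2r // ?nnegrE // cmod_ge0.
  have H (r : R) : r ^+ 2 <= M ^+ 2 -> - M <= r <= M.
    by move=> r2; apply/andP; split; nra.
  move: sq; rewrite /dotc !raddfB /= => sq.
  have /andP[h1 h2] : - M <= complex.Re (P 0) - a <= M.
    by apply: H; apply: le_trans sq; rewrite expr2 lerDl -expr2 sqr_ge0.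
  have /andP[h3 h4] : - M <= complex.Im (P 0) - b <= M.
    by apply: H; apply: le_trans sq; rewrite expr2 lerDr -expr2 sqr_ge0.
  by move=> i; rewrite mxE in_itv /= /c; case: eqP => _; apply/andP; split; lra.
move=> /ltW; apply: le_trans; have := vmin _ (mem_set box0).
have -> : pt (\row_i c i) = P 0 by rewrite /pt !mxE /c /=; case: (P 0).
by [].
Qed.

(** Moving [p] by [t%:C * d] costs [t * cmod d] for each vertex at [p] and gains [t] times the left
    side from the others, up to order [t ^+ 2]. Divide by [t] and let it tend to 0. *)
Lemma median_first_order p d : (forall q, total_dist p <= total_dist q) ->
  dotc (\sum_(k | P k != p) unit_directions P p k) d <=
  #|[pred k | P k == p]|%:R * cmod d.
Proof.
move=> pmin; set m := _%:R; set S := dotc _ d.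
pose C := \sum_(k | P k != p) dotc d d / (2 * cmod (P k - p)).
have C0 : 0 <= C.
  apply: sumr_ge0 => k _; rewrite -sqr_cmod divr_ge0 ?sqr_ge0 //.
  by rewrite mulr_ge0 // cmod_ge0.
have main t : 0 < t -> S - m * cmod d <= t * C.
  move=> t0; have := pmin (p + t%:C * d).
  rewrite /total_dist (bigID (fun k => P k == p)) /= [leRHS](bigID (fun k => P k == p)) /=.
  rewrite [X in X + _ <= _]big1 ?add0r; last first.
    by move=> k /eqP->; apply/eqP; rewrite subrr cmod_eq0.
  have -> : \sum_(k | P k == p) cmod (P k - (p + t%:C * d)) = m * (t * cmod d).
    rewrite (eq_bigr (fun=> t * cmod d)); last first.
      by move=> k /eqP ->; rewrite opprD addNKr cmodN cmodZ gtr0_norm.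
    by rewrite sumr_const -mulr_natl.
  have : \sum_(k | P k != p) cmod (P k - (p + t%:C * d)) <=
    \sum_(k | P k != p) (cmod (P k - p) - t * dotc (unit_directions P p k) d +
      t ^+ 2 * (dotc d d / (2 * cmod (P k - p)))).
    apply: ler_sum => k Pk; rewrite opprD addrA.
    have := @cmod_move (P k - p) d t; rewrite subr_eq0 => /(_ Pk).
    by rewrite unit_directionsE.
  have -> : \sum_(k | P k != p) (cmod (P k - p) - t * dotc (unit_directions P p k) d +
      t ^+ 2 * (dotc d d / (2 * cmod (P k - p)))) =
      \sum_(k | P k != p) cmod (P k - p) - t * S + t ^+ 2 * C.
    by rewrite /S /C dotc_sum !mulr_sumr -sumrN -!big_split.
  by move=> h1 h2; rewrite -(ler_pM2l t0); lra.
have [C00|Cn0] := eqVneq C 0.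
  by have := main 1 ltr01; rewrite C00 mulr0 subr_le0.
have {C0}C0 : 0 < C by rewrite lt_def Cn0.
rewrite -subr_le0; apply/ler_addgt0Pr => e e0.
by have := main (e / C); rewrite divr_gt0 // divfK // add0r => /(_ isT).
Qed.

End GeometricMedian.

(** * Existence and position of balance points *)

Section BalancePoint.
Variable R : realType.
Implicit Types (x y : 'rV[R]_5) (u v d p q : R[i]).

Lemma is_cell_dact x g : is_cell x -> is_cell (dact x g).
Proof.
move=> [cx gx x0]; split; first exact: dact_closes_up.
  by rewrite dact_gram.
by move=> k; rewrite mxE.
Qed.

(** Two adjacent collapsed sides would leave three consecutive edge directions, which lie in an open
    half plane and cannot close up. The rotation [g] moves the two sides to [0] and [1], where
    [closes_upP] gives [tcoord = 0]. *)
Lemma no_adjacent_zeros x (k : 'I_5) : is_cell x -> x 0 k = 0 -> 0 < x 0 (k + 1).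
Proof.
move=> cex xk; rewrite lt_def (let: And3 _ _ x0 := cex in x0 _) andbT.
apply/eqP => xk1; pose g : dih := (false, k).
have := is_cell_sum (is_cell_dact g cex); have [cy _ y0] := is_cell_dact g cex.
have /closes_upP := cy; set y := dact x g in cy y0 *.
have y00 : y 0 0 = 0 by rewrite mxE /dside /= addr0.
have y01 : y 0 1 = 0 by rewrite mxE /dside /= xk1.
rewrite y00 y01 mulr0 subr0 => -[e0 e4].
have t0 : tcoord y = 0.
  by move/esym/eqP: e0; rewrite mulf_eq0 gt_eqF ?psi_gt0 //= => /eqP.
move: e4; rewrite t0 mulr0 sub0r => e4.
have p0 := @psi_gt0 R; have h3 := y0 3; have h4 := y0 4.
have y3 : y 0 3 = 0 by nra.
have y4 : y 0 4 = 0 by rewrite e4 y3 mulr0 oppr0.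
have y2 : y 0 2 = 0 by move: t0; rewrite /tcoord y01 y3 !addr0 mulr0 addr0.
by rewrite sum5 y00 y01 y2 y3 y4 !addr0 ltxx.
Qed.

Lemma side_height_ge0 x (k m : 'I_5) : is_cell x -> 0 <= side_height x k m.
Proof.
move=> [_ _ x0]; have s0 := ltW (@sn_gt0 R); have p0 := ltW (@psi_gt0 R).
by move: m; apply: ord5P; rewrite /side_height //= mulr_ge0 // addr_ge0 // mulr_ge0.
Qed.

(** The vertex opposite to a side stays off its line even in degenerate pentagons, as the sides
    [k + 1] and [k + 2] do not both vanish. *)
Lemma side_height2_gt0 x (k : 'I_5) : is_cell x -> 0 < side_height x k 2.
Proof.
move=> cex; rewrite /side_height /= mulr_gt0 ?sn_gt0 //.
have [_ _ x0] := cex; have p0 := @psi_gt0 R.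
have [xk|xk] := eqVneq (x 0 (k + 1)) 0.
  rewrite xk add0r mulr_gt0 //; have := no_adjacent_zeros cex xk.
  by rewrite -addrA (_ : 1 + 1 = 2).
by rewrite ltr_pwDl // ?lt_def ?xk ?x0 // mulr_ge0 // ltW.
Qed.

Lemma half_plane x (k j : 'I_5) : is_cell x ->
  0 <= cross (zeta5 R k) (vertices x j - vertices x k).
Proof.
move=> cex; have [cx _ _] := cex.
by rewrite (_ : j = k + (j - k)) ?side_heightE ?side_height_ge0 //; ring.
Qed.

Lemma cross_side x (k : 'I_5) : closes_up x ->
  cross (zeta5 R k) (vertices x (k - 1)) = cross (zeta5 R k) (vertices x k).
Proof.
move=> cx; rewrite -[in RHS](subrK (vertices x (k - 1)) (vertices x k)).
by rewrite vertices_step // crossDr crossZr cross_zeta5 subrr /zim /= mulr0 add0r.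
Qed.

(** Vertices two apart never coincide, by [side_height2_gt0]; this leaves neighbours, which coincide
    when the side between them collapses. *)
Lemma vertices_eq x (k m : 'I_5) : is_cell x ->
  (vertices x (k + m) == vertices x k) =
  [|| m == 0, (m == 1) && (x 0 (k + 1) == 0) | (m == 4) && (x 0 k == 0)].
Proof.
move=> cex; have [cx _ x0] := cex; have s0 := @sn_gt0 R.
have ne2 j : (vertices x (j + 2) == vertices x j) = false.
  apply/eqP => e; have := side_height2_gt0 j cex.
  by rewrite -side_heightE // e subrr cross0 ltxx.
have eq1 j : (vertices x (j + 1) == vertices x j) = (x 0 (j + 1) == 0).
  apply/eqP/eqP => [e|e]; last by rewrite vertices_stepS // e mul0r addr0.
  have : cross (zeta5 R j) (vertices x (j + 1) - vertices x j) = 0.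
    by rewrite e subrr cross0.
  by rewrite side_heightE // /side_height /= => /eqP; rewrite mulf_eq0 (gt_eqF s0) orbF => /eqP.
move: m; apply: ord5P => /=.
- by rewrite addr0 eqxx.
- by rewrite eq1 orbF.
- by rewrite ne2.
- rewrite eq_sym -[X in vertices x X == _](_ : k + 3 + 2 = k) ?ne2 //.
  by rewrite -addrA -[RHS]addr0; congr (_ + _); apply: val_inj.
- rewrite eq_sym -[X in vertices x X == _](_ : k + 4 + 1 = k) ?eq1.
    by congr (x 0 _ == _); rewrite -addrA -[RHS]addr0; congr (_ + _); apply: val_inj.
  by rewrite -addrA -[RHS]addr0; congr (_ + _); apply: val_inj.
Qed.

(** The conditions on [q] describe the angle from [v] to [- u], bisected by [v - u]. Writing [q] as
    [a * v - b * u] with nonnegative [a] and [b], its length is at most [a + b], while its product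
    with [v - u] is [a + b] times the left side. *)
Lemma cone_dotc u v q : dotc u u = 1 -> dotc v v = 1 -> 0 < cross u v -> q != 0 ->
  0 <= cross u q -> 0 <= cross v q ->
  dotc (v - u) (v - u) / 2 <= dotc ((cmod q)^-1%:C * q) (v - u).
Proof.
move=> u1 v1 K0 q0 uq vq; have r0 : 0 < cmod q by rewrite cmod_gt0.
rewrite dotcZl [leRHS]mulrC ler_pdivlMr // mulrC.
have D0 : 0 <= dotc (v - u) (v - u) by rewrite -sqr_cmod sqr_ge0.
pose a := cross u q / cross u v; pose b := cross v q / cross u v.
have a0 : 0 <= a by rewrite divr_ge0 // ltW.
have b0 : 0 <= b by rewrite divr_ge0 // ltW.
have qE : q = a%:C * v + - (b%:C * u).
  have Kn : cross u v != 0 by rewrite gt_eqF.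
  apply: (mulfI (_ : (cross u v)%:C != 0)).
    by apply: contra_neq Kn => -[].
  rewrite mulrDr mulrN !mulrA -!rmorphM /a /b !(mulrC (cross u v)) !divfK //.
  rewrite !crossE; case: (u) (v) (q) => u1' u2 [v1' v2] [q1 q2] /=.
  have CM (s : R) (z1 z2 : R) : s%:C * (z1 +i* z2) = (s * z1 - 0 * z2) +i* (s * z2 + 0 * z1) by [].
  have CB (z1 z2 w1 w2 : R) : (z1 +i* z2) - (w1 +i* w2) = (z1 - w1) +i* (z2 - w2) by [].
  by rewrite mulrC !CM CB; congr (_ +i* _); ring.
have qD : dotc q (v - u) = (a + b) * (dotc (v - u) (v - u) / 2).
  rewrite {1}qE; move: (a) (b) u1 v1 => a' b'; case: (u) (v) => u1' u2 [v1' v2].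
  rewrite /dotc /= => e1 e2.
  have -> : ((v1' - u1') * (v1' - u1') + (v2 - u2) * (v2 - u2)) / 2 = 1 - (u1' * v1' + u2 * v2).
    by lra.
  transitivity (a' * (v1' * v1' + v2 * v2) + b' * (u1' * u1' + u2 * u2) -
    (a' + b') * (u1' * v1' + u2 * v2)); first by ring.
  by rewrite e1 e2; ring.
have qr : cmod q <= a + b.
  rewrite [X in cmod X]qE; apply: le_trans (cmodD _ _) _.
  rewrite cmodN !cmodZ !ger0_norm //.
  have cu : cmod u = 1 by apply: (@pexpIrn _ 2); rewrite ?nnegrE ?cmod_ge0 // sqr_cmod expr1n.
  have cv : cmod v = 1 by apply: (@pexpIrn _ 2); rewrite ?nnegrE ?cmod_ge0 // sqr_cmod expr1n.
  by rewrite cu cv !mulr1.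
by rewrite qD ler_wpM2r // divr_ge0.
Qed.

Lemma dotc_zeta5 (j k : 'I_5) : dotc (zeta5 R j) (zeta5 R k) = zre R (k - j).
Proof.
have : complex.Re (conjc (zeta5 R j) * zeta5 R k) = zre R (k - j).
  by rewrite -zeta5N -zeta5D addrC.
by move=> <-; rewrite /dotc /zeta5 /= mulNr opprK.
Qed.

(** If [m] vertices coincide here, the other [5 - m] lie in the angle of [cone_dotc], and minimality
    gives [cmod d <= 2 * m / (5 - m)] for [d = v - u]. But [cmod d ^+ 2] is [2 - psi] for [m = 1]
    and [3 + psi] for [m = 2], which is too large. The hypothesis on [x 0 (j + 1)] makes [j] the
    last label at its point. *)
Lemma median_not_vertex x (j : 'I_5) : is_cell x -> 0 < x 0 (j + 1) ->
  ~ (forall q, total_dist (vertices x) (vertices x j) <= total_dist (vertices x) q).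
Proof.
move=> cex xj1 pmin; have [cx _ x0] := cex; have [p0 s0] := (@psi_gt0 R, @sn_gt0 R).
pose N := #|[pred k | vertices x k == vertices x j]|.
have NE : N = (1 + (x ord0 j == 0%R))%N.
  rewrite /N -sum1_card big_mkcond /= (reindex_inj (addrI j)) /=.
  rewrite !big_ord_recl big_ord0 /= !inE.
  have V m := vertices_eq j m cex.
  rewrite !V /= (gt_eqF xj1) /=.
  by case: (x 0 j == 0).
have others : #|[pred k | vertices x k != vertices x j]| = (5 - N)%N.
  by rewrite -[X in (X - _)%N](card_ord 5) -(cardC [pred k | vertices x k == vertices x j]) addKn.
have main u v : dotc u u = 1 -> dotc v v = 1 -> 0 < cross u v ->
    (forall k, 0 <= cross u (vertices x k - vertices x j)) ->
    (forall k, 0 <= cross v (vertices x k - vertices x j)) ->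
    (5 - N)%:R * (dotc (v - u) (v - u) / 2) <= N%:R * cmod (v - u).
  move=> u1 v1 uv hu hv; apply: le_trans (median_first_order (v - u) pmin).
  rewrite dotc_sum -others mulr_natl -sumr_const; apply: ler_sum => k kj.
  rewrite unit_directionsE; apply: cone_dotc => //.
  by rewrite subr_eq0.
(* When the side [j] collapses, the sides [j - 1] and [j + 1] bound the angle at the double
   vertex. *)
have [xj|xj] := eqVneq (x 0 j) 0.
  have Vj : vertices x j = vertices x (j - 1).
    by apply/eqP; rewrite -subr_eq0 vertices_step // xj mul0r.
  have := main (zeta5 R (j - 1)) (zeta5 R (j + 1)).
  rewrite NE xj eqxx /= !dotc_zeta5 !subrr cross_zeta5 (_ : j + 1 - (j - 1) = 2); last by ring.
  have D : dotc (zeta5 R (j + 1) - zeta5 R (j - 1)) (zeta5 R (j + 1) - zeta5 R (j - 1)) = 3 + psi.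
    transitivity (dotc (zeta5 R (j + 1)) (zeta5 R (j + 1)) + dotc (zeta5 R (j - 1)) (zeta5 R (j - 1))
      - 2 * dotc (zeta5 R (j - 1)) (zeta5 R (j + 1))).
      by rewrite /dotc !raddfB /=; ring.
    rewrite !dotc_zeta5 !subrr (_ : j + 1 - (j - 1) = 2); last by ring.
    by rewrite /zre /=; lra.
  have h1 : 0 < zim R 2 by rewrite /zim /= mulr_gt0.
  have h2 k : 0 <= cross (zeta5 R (j - 1)) (vertices x k - vertices x j).
    by rewrite Vj; exact: half_plane.
  have h3 k : 0 <= cross (zeta5 R (j + 1)) (vertices x k - vertices x j).
    have := half_plane (j + 1) k cex; rewrite !(crossDr, crossNr).
    by rewrite -cross_side // addrK.
  rewrite D => /(_ erefl erefl h1 h2 h3).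
  have := sqr_cmod (zeta5 R (j + 1) - zeta5 R (j - 1)); rewrite D.
  have := cmod_ge0 (zeta5 R (j + 1) - zeta5 R (j - 1)).
  set r := cmod _ => r0 r2; rewrite -r2 => h; have {}h : 3 * (r ^+ 2 / 2) <= 2 * r by [].
  have : r <= 4 / 3 by nra.
  by nra.
have := main (zeta5 R j) (zeta5 R (j + 1)).
rewrite NE (negbTE xj) /= !dotc_zeta5 !subrr cross_zeta5 (_ : j + 1 - j = 1); last by ring.
have D : dotc (zeta5 R (j + 1) - zeta5 R j) (zeta5 R (j + 1) - zeta5 R j) = 2 - psi.
  transitivity (dotc (zeta5 R (j + 1)) (zeta5 R (j + 1)) + dotc (zeta5 R j) (zeta5 R j)
    - 2 * dotc (zeta5 R j) (zeta5 R (j + 1))).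
    by rewrite /dotc !raddfB /=; ring.
  rewrite !dotc_zeta5 !subrr (_ : j + 1 - j = 1); last by ring.
  by rewrite /zre /=; lra.
have h3 k : 0 <= cross (zeta5 R (j + 1)) (vertices x k - vertices x j).
  have := half_plane (j + 1) k cex; rewrite !(crossDr, crossNr).
  by rewrite -cross_side // addrK.
rewrite D => /(_ erefl erefl s0 (fun k => half_plane j k cex) h3).
have := sqr_cmod (zeta5 R (j + 1) - zeta5 R j); rewrite D.
have := cmod_ge0 (zeta5 R (j + 1) - zeta5 R j); have := @psi_bounds R.
set r := cmod _ => /andP[_ p23] r0 r2; rewrite -r2 => h.
have {}h : 4 * (r ^+ 2 / 2) <= 1 * r by [].
have : r <= 1 / 2 by nra.
by nra.
Qed.

Lemma balance_point_exists x : is_cell x -> exists p, balance_point (vertices x) p.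
Proof.
move=> cex; have [p pmin] := geometric_median (vertices x); exists p.
have Vp k : vertices x k != p.
  apply/eqP => e; have [xk|xk] := eqVneq (x 0 (k + 1)) 0; last first.
    apply: (@median_not_vertex x k) => //; last by rewrite e.
    by case: cex => _ _ x0; rewrite lt_def xk x0.
  apply: (@median_not_vertex x (k + 1)) => //; first exact: no_adjacent_zeros.
  by rewrite vertices_stepS ?xk ?mul0r ?addr0 ?e //; case: cex.
(* No vertex is at [p], so testing the first-order bound on the sum itself shows that its squared
   length is at most 0. *)
have S0 : \sum_k unit_directions (vertices x) p k = 0.
  have := median_first_order (\sum_k unit_directions (vertices x) p k) pmin.
  rewrite (eq_bigl xpredT) => [|k]; last by rewrite Vp.
  rewrite (@eq_card0 _ [pred k | vertices x k == p]) ?mul0r => [|k]; last first.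
    by rewrite !inE (negbTE (Vp k)).
  rewrite -sqr_cmod => S0; apply/eqP; rewrite -cmod_eq0 -sqrf_eq0.
  by rewrite eq_le S0 sqr_ge0.
have r0 k : 0 < cmod (vertices x k - p) by rewrite cmod_gt0 subr_eq0.
(* The vanishing sum of unit vectors, read as a sum weighted by inverse distances, exhibits [p] as a
   convex combination of the vertices. *)
split=> //; pose w k := (cmod (vertices x k - p))^-1.
have w0 k : 0 < w k by rewrite invr_gt0.
have W0 : 0 < \sum_k w k by rewrite sum5 !addr_gt0.
exists (fun k => w k / \sum_k w k); split.
- by move=> k; rewrite divr_ge0 // ltW.
- by rewrite -mulr_suml divff // gt_eqF.
have S0' : \sum_k (w k)%:C * (vertices x k - p) = 0.
  rewrite -[RHS]S0; apply: eq_bigr => k _.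
  by rewrite unit_directionsE.
apply: (mulfI (_ : (\sum_k w k)%:C != 0)).
  by apply/eqP => -[e]; move: W0; rewrite e ltxx.
rewrite mulr_sumr; transitivity (\sum_k (w k)%:C * vertices x k); last first.
  apply: eq_bigr => k _; rewrite mulrA -rmorphM; congr (_%:C * _).
  by rewrite mulrC divfK // gt_eqF.
move: S0'; under eq_bigr do rewrite mulrBr.
rewrite sumrB => /eqP; rewrite subr_eq0 => /eqP ->.
by rewrite -mulr_suml rmorph_sum.
Qed.

(* [p] lies strictly to the left of the line carrying each side, whether or not
   that side is collapsed. *)
Definition inside x p := forall k : 'I_5, 0 < cross (zeta5 R k) (p - vertices x k).

(** Were [p] on or beyond the line of the side [k], all unit directions would point weakly to one
    side of that line; having sum 0 they would all be parallel to it, which fails for the vertex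
    [k + 2]. *)
Lemma balance_point_inside x p : is_cell x -> balance_point (vertices x) p -> inside x p.
Proof.
move=> cex [_ Vp S0] k; rewrite ltNge; apply/negP => hk.
have [cx _ _] := cex.
pose f j := (cmod (vertices x j - p))^-1 * cross (zeta5 R k) (vertices x j - p).
have fE j : f j = cross (zeta5 R k) (unit_directions (vertices x) p j).
  by rewrite unit_directionsE crossZr.
have split j : cross (zeta5 R k) (vertices x j - p) =
    cross (zeta5 R k) (vertices x j - vertices x k) - cross (zeta5 R k) (p - vertices x k).
  by rewrite -crossNr -crossDr; congr cross; ring.
have r0 j : 0 < (cmod (vertices x j - p))^-1 by rewrite invr_gt0 cmod_gt0 subr_eq0.
have f0 j : 0 <= f j.
  by apply: mulr_ge0; [exact: ltW|rewrite split subr_ge0 (le_trans hk) ?half_plane].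
have sf : \sum_j f j = 0.
  have cross_sum (F : 'I_5 -> R[i]) : \sum_j cross (zeta5 R k) (F j) = cross (zeta5 R k) (\sum_j F j).
    by rewrite /cross mulr_sumr raddf_sum.
  by under eq_bigr do rewrite fE; rewrite cross_sum S0 cross0.
have : f (k + 2) = 0.
  by apply/eqP; move/eqP: sf; rewrite psumr_eq0 // => /allP; apply; rewrite mem_index_enum.
move/eqP; rewrite mulf_eq0 gt_eqF //= split side_heightE //.
have := side_height2_gt0 k cex => h2 /eqP; lra.
Qed.

End BalancePoint.

(** * Which pentagons are equivalent *)

Section Sectors.
Variable R : realType.
Implicit Types (x y : 'rV[R]_5) (u v d p q : R[i]).

(** Comparing heights over the line of the side [k] gives [a + b <= 1], over that of the side [j] it
    gives [1 <= a + b]. Hence a vertex seen from [p] within a side lies on the line of that side. *)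
Lemma sector_empty x p (j k : 'I_5) (a b : R) : is_cell x -> inside x p ->
  0 <= a -> 0 <= b ->
  vertices x j - p = a%:C * (vertices x (k - 1) - p) + b%:C * (vertices x k - p) ->
  a + b = 1 /\ side_height x k (j - k) = 0.
Proof.
move=> cex inp a0 b0 e; have [cx _ _] := cex.
have := congr1 (cross (zeta5 R k)) e; have := congr1 (cross (zeta5 R j)) e.
rewrite !crossDr !crossZr.
have hk := inp k; have hj := inp j.
have H i l : cross (zeta5 R i) (vertices x l - p) =
    cross (zeta5 R i) (vertices x l - vertices x i) - cross (zeta5 R i) (p - vertices x i).
  by rewrite -crossNr -crossDr; congr cross; ring.
rewrite -!crossDr !H subrr cross0.
have -> : vertices x j - vertices x k = vertices x (k + (j - k)) - vertices x k.
  by congr (vertices x _ - _); ring.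
rewrite (side_heightE k (j - k) cx) subrr cross0.
have -> : cross (zeta5 R k) (vertices x (k - 1) - vertices x k) = 0.
  by rewrite crossDr crossNr cross_side // subrr.
have h1 := half_plane j (k - 1) cex; have h2 := half_plane j k cex.
have h3 := side_height_ge0 k (j - k) cex.
move: hk hj; rewrite !sub0r.
move: (cross _ (p - vertices x k)) (cross _ (p - vertices x j)) h1 h2 h3.
move: (cross _ _) (cross _ _) (side_height _ _ _) => c1 c2 H0 B1 B2 h1 h2 h3 hk hj e1 e2.
have le1 : a + b <= 1 by nra.
have ge1 : 1 <= a + b by nra.
have ab : a + b = 1 by apply/eqP; rewrite eq_le le1.
split=> //; nra.
Qed.

Lemma same_ray x p (i j : 'I_5) (a : R) : is_cell x -> inside x p -> 0 <= a ->
  vertices x j - p = a%:C * (vertices x i - p) -> vertices x j = vertices x i.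
Proof.
move=> cex inp a0 e; have := @sector_empty x p j i 0 a cex inp (lexx 0) a0.
rewrite mul0r add0r => /(_ e)[]; rewrite add0r => a1 _.
by move: e; rewrite a1 mul1r => /addIr.
Qed.

Lemma cross_edge x p (k : 'I_5) : closes_up x ->
  cross (vertices x (k - 1) - p) (vertices x k - p) =
  x 0 k * cross (zeta5 R k) (p - vertices x k).
Proof.
move=> cx; have -> : vertices x (k - 1) - p = (vertices x k - p) -
    (vertices x k - vertices x (k - 1)) by ring.
rewrite vertices_step // crossDl crossNl crossZl -(opprB p) crossNr crossNl opprK.
rewrite crossvv.
by rewrite crossNr mulrN opprK add0r.
Qed.

(** The counterclockwise successor among directions, expressed by signs of cross products only; it
    is thus insensitive to positive scaling of each direction and to a common turn. *)
Definition succb (u : 'I_5 -> R[i]) (i j : 'I_5) : bool :=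
  (0 < cross (u i) (u j)) &&
  [forall l, ~~ ((0 < cross (u i) (u l)) && (0 < cross (u l) (u j)))].

Lemma cross_combination u v q : cross u v != 0 ->
  q = (cross q v / cross u v)%:C * u + (cross u q / cross u v)%:C * v.
Proof.
move=> Kn; apply: (mulfI (_ : (cross u v)%:C != 0)).
  by apply: contra_neq Kn => -[].
rewrite mulrDr !mulrA -!rmorphM /= !(mulrC (cross u v)) !divfK //.
rewrite !crossE; case: (u) (v) (q) => u1' u2 [v1' v2] [q1 q2] /=.
have CM (s : R) (z1 z2 : R) : s%:C * (z1 +i* z2) = (s * z1 - 0 * z2) +i* (s * z2 + 0 * z1) by [].
have CB (z1 z2 w1 w2 : R) : (z1 +i* z2) + (w1 +i* w2) = (z1 + w1) +i* (z2 + w2) by [].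
by rewrite mulrC !CM CB; congr (_ +i* _); ring.
Qed.

(** The sector of a noncollapsed side contains no vertex strictly inside, by [sector_empty], so its
    ends are successive. Conversely, two successors of the same direction cannot separate one
    another, so they lie on one ray, and [same_ray] identifies the vertices. *)
Lemma succbP x p (i j : 'I_5) : is_cell x -> inside x p ->
  reflect (exists k, [/\ 0 < x 0 k, vertices x (k - 1) = vertices x i &
                         vertices x k = vertices x j])
          (succb (fun k => vertices x k - p) i j).
Proof.
move=> cex inp; have [cx _ x0] := cex.
pose q k := vertices x k - p; rewrite -/q.
have edge k : 0 < x 0 k -> 0 < cross (q (k - 1)) (q k).
  by move=> xk; rewrite /q cross_edge // mulr_gt0.
have empty k l : 0 < x 0 k -> ~~ ((0 < cross (q (k - 1)) (q l)) && (0 < cross (q l) (q k))).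
  move=> xk; apply/negP => /andP[c1 c2].
  have c0 := edge k xk; have e := cross_combination (q l) (lt0r_neq0 c0).
  have b0 : 0 < cross (q (k - 1)) (q l) / cross (q (k - 1)) (q k) by rewrite divr_gt0.
  have a0 : 0 < cross (q l) (q k) / cross (q (k - 1)) (q k) by rewrite divr_gt0.
  have [ab] := sector_empty cex inp (ltW a0) (ltW b0) e.
  have Vk : vertices x l = vertices x k \/ vertices x l = vertices x (k - 1) -> False.
    by case=> E; [move: c2|move: c1]; rewrite /q E crossvv ltxx.
  have lk : l = k + (l - k) by ring.
  have := vertices_eq k (l - k) cex; rewrite -lk => E.
  have := vertices_eq (k - 1) (l - k + 1) cex.
  have lk' : l = k - 1 + (l - k + 1) by ring.
  rewrite -lk' subrK => E' h.
  apply: Vk; have := h; have x1 := @sn_gt0 R; move: h E E'; clear lk lk'.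
  move: (l - k); apply: ord5P => //= h E E' _.
  - by left; apply/eqP; rewrite E.
  - by left; apply/eqP; rewrite E; move/eqP: h; rewrite /side_height /= mulf_eq0 (gt_eqF x1) orbF.
  - by have := side_height2_gt0 k cex; rewrite h ltxx.
  - right; apply/eqP; rewrite E' /=.
    by move/eqP: h; rewrite /side_height /= mulf_eq0 (gt_eqF x1) orbF.
  - by right; apply/eqP; rewrite E'.
apply: (iffP idP) => [/andP[cij /forallP nl]|[k [xk ei ej]]]; last first.
  have ei' : q i = q (k - 1) by rewrite /q ei.
  have ej' : q j = q k by rewrite /q ej.
  rewrite /succb ei' ej' edge //=; apply/forallP => l; exact: empty.
have [k [xk ek]] : exists k, 0 < x 0 k /\ vertices x (k - 1) = vertices x i.
  have [xi|xi] := eqVneq (x 0 (i + 1)) 0; last first.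
    by exists (i + 1); rewrite lt_def xi x0 addrK.
  exists (i + 1 + 1); rewrite addrK vertices_stepS // xi mul0r addr0.
  by split=> //; exact: no_adjacent_zeros.
exists k; split=> //; have c0 := edge k xk.
have qi : q i = q (k - 1) by rewrite /q ek.
have := nl k; have := empty k j xk; rewrite -qi in c0 *; rewrite cij c0 /= -!leNgt.
move=> h1 h2.
have ckj : cross (q k) (q j) = 0.
  by apply/eqP; rewrite eq_le h2 /= crossC oppr_ge0.
apply/esym; apply: (@same_ray x p k j (cross (q i) (q j) / cross (q i) (q k))) => //.
  by rewrite divr_ge0 // ltW.
have := cross_combination (q j) (lt0r_neq0 c0).
by rewrite [cross (q j) (q k)]crossC ckj oppr0 !mul0r add0r.
Qed.

Lemma cyclic_le_const (t : 'I_5 -> R) :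
  (forall k, t (k - 1) <= t k) -> forall k, t k = t 0.
Proof.
move=> H; have {}H (k j : 'I_5) : val j = val (k - 1) -> t j <= t k.
  by move=> /val_inj ->.
have := H 0 4 erefl; have := H 1 0 erefl; have := H 2 1 erefl.
have := H 3 2 erefl; have := H 4 3 erefl; move=> h4 h3 h2 h1 h0.
by apply: (ord5P (P := fun k => t k = t 0)); lra.
Qed.

(** Both pentagons have their side [k] parallel to [zeta5 k], which gives
    [t k * B k k = t (k - 1) * B k (k - 1)], while [B k k - B k (k - 1)] is [x 0 k] times the
    imaginary part of [a]. So [t] is monotone around the cycle, in a direction set by one sign, and
    therefore constant. This makes [a] real and [y] a positive multiple of [x], and the area fixes
    the multiple. *)
Lemma unique_position x y p q (a : R[i]) : is_cell x -> is_cell y ->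
  inside x p -> inside y q -> a != 0 ->
  (forall k, exists2 t : R, 0 < t & vertices y k - q = t%:C * (a * (vertices x k - p))) ->
  y = x.
Proof.
move=> cex cey inp inq a0 H; have [[cx gx x0] [cy gy y0]] := (cex, cey).
pose t k := sval (cid2 (H k)).
have t0 k : 0 < t k by rewrite /t; case: cid2.
have E k : vertices y k - q = (t k)%:C * (a * (vertices x k - p)).
  by rewrite /t; case: cid2.
clearbody t; pose B k j := cross (zeta5 R k) (a * (vertices x j - p)).
have BE k : B k k - B k (k - 1) = x 0 k * complex.Im a.
  rewrite /B -crossNr -crossDr -mulrBr opprB addrA subrK vertices_step //.
  rewrite mulrCA crossZr; congr (_ * _).
  have : `|zeta5 R k| ^+ 2 = 1 by rewrite norm_zeta5 expr1n.
  rewrite sqr_normc /cross; set z := zeta5 R k => zz.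
  by rewrite mulrCA (mulrC _ z) zz mulr1.
have Bt k : t k * B k k = t (k - 1) * B k (k - 1).
  rewrite /B -!crossZr -!E !crossDr cross_side //.
have Bneg k : B k k < 0 /\ B k (k - 1) < 0.
  have : t k * B k k < 0.
    by rewrite /B -crossZr -E -opprB crossNr oppr_lt0.
  move=> h; have h' := h; rewrite Bt in h'.
  by move: h h'; rewrite !pmulr_rlt0.
have tconst : forall k, t k = t 0.
  have step k : (0 <= complex.Im a -> t (k - 1) <= t k) /\
      (complex.Im a <= 0 -> t k <= t (k - 1)).
    have := BE k; have := Bt k; have [] := Bneg k; have := x0 k.
    have := t0 k; have := t0 (k - 1).
    move: (t k) (t (k - 1)) (B k k) (B k (k - 1)) (x 0 k) (complex.Im a) => T1 T2 B1 B2 X A.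
    move=> _ T10 X0 _ B20 e1 e2.
    have e : (T1 - T2) * B2 = - (T1 * (X * A)) by rewrite -e2; lra.
    split=> A0; rewrite -subr_ge0.
      rewrite -(nmulr_lle0 _ B20) e oppr_le0 mulr_ge0 ?mulr_ge0 // ltW //.
    rewrite -(nmulr_lle0 _ B20) -opprB mulNr e opprK mulr_ge0_le0 //; first exact: ltW.
    exact: mulr_ge0_le0.
  have [ia|/ltW ia] := leP 0 (complex.Im a).
    by apply: cyclic_le_const => k; exact: (step k).1.
  move=> k; apply: oppr_inj; move: k.
  by apply: (@cyclic_le_const (fun k => - t k)) => k; rewrite lerN2; exact: (step k).2.
have Ima : complex.Im a = 0.
  have : x 0 0 * complex.Im a = 0 /\ x 0 1 * complex.Im a = 0.
    split; rewrite -BE; apply/eqP; rewrite subr_eq0; apply/eqP;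
      apply: (mulfI (lt0r_neq0 (t0 0))); [have := Bt 0|have := Bt 1];
      by rewrite !(tconst (_ - _)) ?tconst.
  have [x00|x00] := eqVneq (x 0 0) 0.
    have := no_adjacent_zeros cex x00; rewrite add0r => x1 [_] /eqP.
    by rewrite mulf_eq0 (gt_eqF x1) => /eqP.
  by move=> [/eqP]; rewrite mulf_eq0 (negbTE x00) => /eqP.
pose r := t 0 * complex.Re a.
have aE : a = (complex.Re a)%:C by move: Ima; case: (a) => ? ? /= ->.
have yx k : y 0 k = r * x 0 k.
  have : vertices y k - vertices y (k - 1) = r%:C * (vertices x k - vertices x (k - 1)).
    transitivity ((vertices y k - q) - (vertices y (k - 1) - q)); first by ring.
    have rE : r%:C = (t 0)%:C * a by rewrite [in RHS]aE -rmorphM.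
    by rewrite !E !tconst rE; ring.
  rewrite !vertices_step // mulrA -rmorphM => /mulIf.
  have z0 : zeta5 R k != 0 by rewrite -normr_eq0 norm_zeta5 oner_eq0.
  by move=> /(_ z0) /complexI.
have r0 : 0 < r.
  have := is_cell_sum cey; have := is_cell_sum cex.
  under [\sum_k y 0 k]eq_bigr do rewrite yx.
  by rewrite -mulr_sumr => sx; rewrite pmulr_lgt0.
have r1 : r = 1.
  apply: (@pexpIrn _ 2); rewrite ?nnegrE // ?ltW // expr1n -gy.
  have -> : gram y y = r ^+ 2 * gram x x by rewrite /gram /tcoord !yx; ring.
  by rewrite gx mulr1.
by apply/rowP => k; rewrite yx r1 mul1r.
Qed.

End Sectors.

(** * The dihedral group law *)

Definition dcomp (g h : dih) : dih :=
  if g.1 then (~~ h.1, g.2 - h.2) else (h.1, g.2 + h.2).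
Definition dinv (g : dih) : dih := if g.1 then g else (false, - g.2).

Lemma dvert_comp g h k : dvert (dcomp g h) k = dvert g (dvert h k).
Proof. by case: g h => [[] a] [[] b]; rewrite /dvert /dcomp /=; ring. Qed.

Lemma dside_comp g h k : dside (dcomp g h) k = dside g (dside h k).
Proof. by case: g h => [[] a] [[] b]; rewrite /dside /dcomp /=; ring. Qed.

Lemma dvertK g : cancel (dvert g) (dvert (dinv g)).
Proof. by case: g => [[] a] k; rewrite /dvert /dinv /=; ring. Qed.

Lemma dvertVK g : cancel (dvert (dinv g)) (dvert g).
Proof. by case: g => [[] a] k; rewrite /dvert /dinv /=; ring. Qed.

Lemma dvert_inj g : injective (dvert g).
Proof. exact: can_inj (dvertK g). Qed.

Lemma dsideVK g : cancel (dside (dinv g)) (dside g).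
Proof. by case: g => [[] a] k; rewrite /dside /dinv /=; ring. Qed.

Section DihedralAction.
Variable R : realType.
Implicit Types (x y : 'rV[R]_5) (u v p q : R[i]).

Lemma dact_comp x g h : dact (dact x g) h = dact x (dcomp g h).
Proof. by apply/rowP => k; rewrite !mxE dside_comp. Qed.

Lemma dactK x g : dact (dact x g) (dinv g) = x.
Proof. by apply/rowP => k; rewrite !mxE dsideVK. Qed.

Lemma conj_ifB b u v : conj_if b (u - v) = conj_if b u - conj_if b v.
Proof. by case: b => //=; rewrite rmorphB. Qed.

Lemma conj_ifM b u v : conj_if b (u * v) = conj_if b u * conj_if b v.
Proof. by case: b => //=; rewrite rmorphM. Qed.

Lemma conj_if_real b (r : R) : conj_if b r%:C = r%:C.
Proof. by case: b => //=; rewrite oppr0. Qed.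

Lemma conj_ifK b : involutive (conj_if b : R[i] -> R[i]).
Proof. by case: b => // -[r s] /=; rewrite opprK. Qed.

Lemma conj_if_sum b (F : 'I_5 -> R[i]) :
  conj_if b (\sum_k F k) = \sum_k conj_if b (F k).
Proof. by case: b => //=; rewrite rmorph_sum. Qed.

Lemma cmod_conj_if b u : cmod (conj_if b u) = cmod u.
Proof. by case: b u => // -[r s]; rewrite /cmod /= sqrrN. Qed.

Lemma balance_dact x g p : closes_up x -> balance_point (vertices x) p ->
  exists mu p' : R[i], [/\ `|mu| = 1, balance_point (vertices (dact x g)) p' &
    forall k, unit_directions (vertices (dact x g)) p' k =
              mu * conj_if g.1 (unit_directions (vertices x) p (dvert g k))].
Proof.
move=> cx [[c [c0 c1 pE]] Vp S0].
have [_ [mu [w [mu1 VE]]]] := dact_vertices g cx.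
pose p' := mu * conj_if g.1 p + w; exists mu, p'.
have mu0 : mu != 0 by rewrite -normr_eq0 mu1 oner_eq0.
have cmu : cmod mu = 1 by move: mu1; rewrite normcmod => -[].
have dE k : vertices (dact x g) k - p' = mu * conj_if g.1 (vertices x (dvert g k) - p).
  by rewrite VE /p' conj_ifB; ring.
have cmodM u v : cmod (u * v) = cmod u * cmod v.
  by have := normrM u v; rewrite !normcmod -rmorphM => -[].
have UE k : unit_directions (vertices (dact x g)) p' k =
    mu * conj_if g.1 (unit_directions (vertices x) p (dvert g k)).
  rewrite !unit_directionsE dE cmodM cmu mul1r cmod_conj_if conj_ifM conj_if_real.
  by rewrite mulrCA.
have sumE (F : 'I_5 -> R[i]) : \sum_k F (dvert g k) = \sum_k F k.
  by rewrite [RHS](reindex_inj (@dvert_inj g)).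
split=> //; split.
- exists (fun k => c (dvert g k)); split=> //.
    by rewrite -c1 [RHS](reindex_inj (@dvert_inj g)).
  under eq_bigr do rewrite VE mulrDr.
  rewrite (sumE (fun k => (c k)%:C * (mu * conj_if g.1 (vertices x k)) + (c k)%:C * w)).
  rewrite big_split /= -mulr_suml -rmorph_sum c1 mul1r /p'; congr (_ + w).
  rewrite pE conj_if_sum mulr_sumr; apply: eq_bigr => k _.
  by rewrite conj_ifM conj_if_real mulrCA.
- by move=> k; rewrite -subr_eq0 dE -cmod_eq0 cmodM cmu mul1r cmod_conj_if cmod_eq0 subr_eq0.
- under eq_bigr do rewrite UE.
  rewrite -mulr_sumr (sumE (fun k => conj_if g.1 (unit_directions (vertices x) p k))).
  by rewrite -conj_if_sum S0 -[0]/(0%:C) conj_if_real mulr0.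
Qed.

End DihedralAction.

(* The combinatorial type of a polygon of the cell, given the list of its
   collapsed sides: which vertices coincide, and which vertex direction follows
   which one around the balance point. *)
Definition linkn (Z : seq bool) (i j : nat) : bool :=
  (let m := (j + 5 - i) %% 5 in
  [|| m == 0, (m == 1) && nth false Z j | (m == 4) && nth false Z i])%N.

Definition succn (Z : seq bool) (i j : nat) : bool :=
  has (fun k => [&& ~~ nth false Z k, linkn Z ((k + 4) %% 5)%N i & linkn Z k j])
      (iota 0 5).

Definition no_adjacent (Z : seq bool) : bool :=
  all (fun k => ~~ (nth false Z k && nth false Z (k.+1 %% 5)%N)) (iota 0 5).

Definition same_type (Zx Zy : seq bool) (pi : seq nat) : bool :=
  all (fun i => all (fun j =>
    (linkn Zy i j == linkn Zx (nth 0%N pi i) (nth 0%N pi j)) &&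
    (succn Zy i j == succn Zx (nth 0%N pi i) (nth 0%N pi j))) (iota 0 5)) (iota 0 5).

Definition is_rotation (Zx : seq bool) (pi : seq nat) : bool :=
  has (fun a => all (fun k => linkn Zx ((a + k) %% 5)%N (nth 0%N pi k)) (iota 0 5))
      (iota 0 5).

Definition bitseqs5 : seq (seq bool) :=
  iter 5 (fun s => map (cons true) s ++ map (cons false) s) [:: [::]].

(** A check over 11 patterns of collapsed sides for each pentagon and 120 permutations, on plain
    lists so that it evaluates. Reflections do not occur, because [succn] records the
    orientation. *)
Lemma same_type_rotation_bool :
  all (fun Zx => all (fun Zy => all (fun pi =>
    same_type Zx Zy pi ==> is_rotation Zx pi) (permutations (iota 0 5)))
    (seq.filter no_adjacent bitseqs5)) (seq.filter no_adjacent bitseqs5).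
Proof. by vm_cast_no_check (erefl true). Qed.

Lemma mem_bitseqs5 (b : nat -> bool) : mkseq b 5 \in bitseqs5.
Proof. by rewrite /mkseq /=; case: (b 0%N) (b 1%N) (b 2%N) (b 3%N) (b 4%N) => [] [] [] [] []. Qed.

(** * Labels recovered from directions *)

Section CombinatorialType.
Variable R : realType.
Implicit Types (x y : 'rV[R]_5) (u v p q : R[i]).

Definition zlist x : seq bool := mkseq (fun n => x 0 (inord n) == 0) 5.

Lemma nth_zlist x (k : 'I_5) : nth false (zlist x) k = (x 0 k == 0).
Proof. by rewrite nth_mkseq // inord_val. Qed.

Lemma zlist_no_adjacent x : is_cell x -> no_adjacent (zlist x).
Proof.
move=> cex; apply/allP => n; rewrite mem_iota /= => n5.
have -> : n = Ordinal n5 by [].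
have -> : ((Ordinal n5).+1 %% 5)%N = (Ordinal n5 + 1 : 'I_5).
  by rewrite /= addn1.
rewrite !nth_zlist; apply/negP => /andP[/eqP x1 /eqP x2].
by have := no_adjacent_zeros cex x1; rewrite x2 ltxx.
Qed.

Lemma vertices_eq_linkn x (i j : 'I_5) : is_cell x ->
  (vertices x j == vertices x i) = linkn (zlist x) i j.
Proof.
move=> cex; have -> : j = i + (j - i) by ring.
rewrite (vertices_eq i (j - i) cex) /linkn.
have -> : i + (j - i) = j by ring.
rewrite !nth_zlist.
have -> : ((j + 5 - i) %% 5)%N = (j - i : 'I_5).
  by move: i j; apply: ord5P; apply: ord5P.
rewrite -!(inj_eq val_inj) /=.
case: (eqVneq (val (j - i)) 1%N) => [e1|//].
have -> // : i + 1 = j by rewrite -[RHS](subrK i) addrC; congr (_ + _); apply: val_inj.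
Qed.

Lemma succb_succn x p (i j : 'I_5) : is_cell x -> inside x p ->
  succb (fun k => vertices x k - p) i j = succn (zlist x) i j.
Proof.
move=> cex inp; apply/(succbP i j cex inp)/hasP.
  move=> [k [xk ei ej]]; exists (k : nat); first by rewrite mem_iota /= ltn_ord.
  rewrite nth_zlist gt_eqF //=.
  have -> : ((k + 4) %% 5)%N = (k - 1 : 'I_5) by [].
  by rewrite -!vertices_eq_linkn // ei ej !eqxx.
move=> [n]; rewrite mem_iota /= => n5; set k : 'I_5 := Ordinal n5.
have -> : n = k by [].
have -> : ((k + 4) %% 5)%N = (k - 1 : 'I_5) by [].
rewrite nth_zlist -!vertices_eq_linkn // => /and3P[xk /eqP ei /eqP ej].
by exists k; rewrite ei ej lt_def xk; case: cex => _ _ ->.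
Qed.

Lemma cross_unit (P : 'I_5 -> R[i]) p (i j : 'I_5) : (forall k, P k != p) ->
  (0 < cross (unit_directions P p i) (unit_directions P p j)) =
  (0 < cross (P i - p) (P j - p)).
Proof.
move=> Pp; have r0 k : 0 < (cmod (P k - p))^-1 by rewrite invr_gt0 cmod_gt0 subr_eq0.
by rewrite !unit_directionsE crossZl crossZr !pmulr_rgt0.
Qed.

Lemma cross_scale (a u v : R[i]) : cross (a * u) (a * v) = cmod a ^+ 2 * cross u v.
Proof.
rewrite sqr_cmod !crossE /dotc; case: a u v => a1 a2 [u1 u2] [v1 v2] /=; ring.
Qed.

Lemma unit_eq x p (i j : 'I_5) : is_cell x -> balance_point (vertices x) p ->
  (unit_directions (vertices x) p j == unit_directions (vertices x) p i) =
  (vertices x j == vertices x i).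
Proof.
move=> cex bal; have [_ Vp _] := bal; have inp := balance_point_inside cex bal.
apply/eqP/eqP => [|e]; last by rewrite /unit_directions e.
have r0 k : 0 < cmod (vertices x k - p) by rewrite cmod_gt0 subr_eq0.
rewrite !unit_directionsE => e.
apply: (@same_ray _ x p i j (cmod (vertices x j - p) / cmod (vertices x i - p))) => //.
  by rewrite divr_ge0 // ltW.
rewrite rmorphM -mulrA -e mulrA -rmorphM divff ?mul1r // gt_eqF //.
Qed.

(** The finite check matches the labels up to coinciding vertices. After the rotation it provides,
    all directions agree up to the single factor [a / mu], where [mu] is the turn caused by
    relabelling, and [unique_position] applies. *)
Lemma direct_similarity x y p q (pi : {perm 'I_5}) (a : R[i]) :
  is_cell x -> is_cell y ->
  balance_point (vertices x) p -> balance_point (vertices y) q -> a != 0 ->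
  (forall k, unit_directions (vertices y) q k =
             a * unit_directions (vertices x) p (pi k)) ->
  exists2 b : 'I_5, y = dact x (false, b) &
    forall k, vertices x (pi k) = vertices x (dvert (false, b) k).
Proof.
move=> cex cey balx baly a0 E; have [[_ Vp _] [_ Vq _]] := (balx, baly).
have inx := balance_point_inside cex balx; have iny := balance_point_inside cey baly.
have ca : 0 < cmod a ^+ 2 by rewrite exprn_gt0 // cmod_gt0.
have linkE (i j : 'I_5) : linkn (zlist y) i j = linkn (zlist x) (pi i) (pi j).
  rewrite -!vertices_eq_linkn // -(unit_eq _ _ cex balx) -(unit_eq _ _ cey baly).
  by rewrite !E (inj_eq (mulfI a0)).
have cE i j : (0 < cross (vertices y i - q) (vertices y j - q)) =
              (0 < cross (vertices x (pi i) - p) (vertices x (pi j) - p)).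
  by rewrite -!cross_unit // !E cross_scale pmulr_rgt0.
have succE (i j : 'I_5) : succn (zlist y) i j = succn (zlist x) (pi i) (pi j).
  rewrite -(succb_succn _ _ cex inx) -(succb_succn _ _ cey iny) /succb cE; congr (_ && _).
  apply/forallP/forallP => H l; last by rewrite !cE.
  by have := H (pi^-1%g l); rewrite !cE permKV.
pose s := [seq val (pi (inord n)) | n <- iota 0 5].
have nth_s (k : 'I_5) : nth 0%N s k = pi k.
  by rewrite (nth_map 0%N) ?size_iota // nth_iota // add0n inord_val.
have s_perm : s \in permutations (iota 0 5).
  rewrite mem_permutations; apply: uniq_perm; rewrite ?iota_uniq //.
    rewrite map_inj_in_uniq ?iota_uniq // => m n; rewrite !mem_iota /= => m5 n5.
    by move=> /val_inj /perm_inj /(congr1 (@nat_of_ord 5)); rewrite !inordK.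
  move=> n; rewrite mem_iota /=; apply/mapP/idP => [[m _ ->]|n5]; first exact: ltn_ord.
  exists (pi^-1%g (Ordinal n5) : nat); first by rewrite mem_iota /= ltn_ord.
  by rewrite inord_val permKV.
have mem_Z w : is_cell w -> zlist w \in seq.filter no_adjacent bitseqs5.
  by move=> cw; rewrite mem_filter zlist_no_adjacent // mem_bitseqs5.
have /allP/(_ _ (mem_Z _ cex))/allP/(_ _ (mem_Z _ cey))/allP/(_ _ s_perm) :=
  same_type_rotation_bool.
have in5 n : (n \in iota 0 5) = (n < 5)%N by rewrite mem_iota.
have sameT : same_type (zlist x) (zlist y) s.
  apply/allP => i; rewrite in5 => i5; apply/allP => j; rewrite in5 => j5.
  rewrite (nth_s (Ordinal i5)) (nth_s (Ordinal j5)).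
  by rewrite -(linkE (Ordinal i5) (Ordinal j5)) -(succE (Ordinal i5) (Ordinal j5)) !eqxx.
move=> /implyP/(_ sameT)/hasP[n]; rewrite in5 => n5 /allP H.
pose b : 'I_5 := Ordinal n5.
have {}H k : vertices x (pi k) = vertices x (b + k).
  have := H k; rewrite in5 ltn_ord => /(_ isT); rewrite nth_s.
  have -> : ((n + k) %% 5)%N = (b + k : 'I_5) by [].
  by rewrite -vertices_eq_linkn // => /eqP.
exists b => //.
have [cx _ _] := cex.
have [mu [p' [mu1 bal' UE]]] := balance_dact (false, b) cx balx.
have cex' := is_cell_dact (false, b) cex.
have mu0 : mu != 0 by rewrite -normr_eq0 mu1 oner_eq0.
apply: (@unique_position _ _ _ p' q (a / mu)) => //.
- exact: balance_point_inside cex' bal'.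
- by rewrite mulf_neq0 // invr_eq0.
move=> k; set x' := dact x (false, b).
have [_ Vp' _] := bal'.
have uE : unit_directions (vertices x) p (pi k) = unit_directions (vertices x) p (b + k).
  by rewrite /unit_directions H.
have [r r0 E2] : exists2 r : R, 0 < r &
    vertices x' k - p' = r%:C * (mu * unit_directions (vertices x) p (b + k)).
  have r0 : 0 < cmod (vertices x' k - p') by rewrite cmod_gt0 subr_eq0.
  exists (cmod (vertices x' k - p')) => //.
  by rewrite -(UE k) unit_directionsE mulrA -rmorphM divff ?mul1r // gt_eqF.
have [t t0 E1] : exists2 t : R, 0 < t &
    vertices y k - q = t%:C * unit_directions (vertices y) q k.
  have t0 : 0 < cmod (vertices y k - q) by rewrite cmod_gt0 subr_eq0.
  exists (cmod (vertices y k - q)) => //.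
  by rewrite unit_directionsE mulrA -rmorphM divff ?mul1r // gt_eqF.
exists (t / r); first by rewrite divr_gt0.
rewrite E1 E E2 uE; set u := unit_directions _ _ _.
have -> : t%:C = (t / r)%:C * r%:C by rewrite -rmorphM divfK // gt_eqF.
rewrite -mulrA; congr (_ * _); rewrite [RHS]mulrCA; congr (_ * _).
by rewrite -mulrA mulKf.
Qed.

End CombinatorialType.

(** * Equality of classes in the moduli space *)

Section Relation.
Variable R : realType.
Implicit Types (x y : 'rV[R]_5) (s t : 'S_5) (p q : R[i]).

Lemma cell_is_cell (x : cell R 5) : is_cell (\val x).
Proof. by apply/cellP/set_mem; exact: valP. Qed.

Definition mk_cell x (cex : is_cell x) : cell R 5 :=
  exist _ x (mem_set ((cellP x).2 cex)).

Lemma val_mk_cell x (cex : is_cell x) : \val (mk_cell cex) = x.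
Proof. by []. Qed.

(** An explicit form of [same_class]: once [polygon_classE] is proved, balance points no longer
    enter the argument. *)
Definition related x s y t := exists g : dih,
  y = dact x g /\ forall k, vertices x (s k) = vertices x (dvert g (t k)).

Lemma vertices_dact_eq x g (i j : 'I_5) : closes_up x ->
  (vertices (dact x g) i == vertices (dact x g) j) =
  (vertices x (dvert g i) == vertices x (dvert g j)).
Proof.
move=> cx; have [_ [mu [w [mu1 VE]]]] := dact_vertices g cx.
have mu0 : mu != 0 by rewrite -normr_eq0 mu1 oner_eq0.
by rewrite VE VE (inj_eq (addIr w)) (inj_eq (mulfI mu0)) (inj_eq (can_inj (conj_ifK g.1))).
Qed.

Lemma related_sym x s y t : closes_up x -> related x s y t -> related y t x s.
Proof.
move=> cx [g [-> H]]; exists (dinv g); split; first by rewrite dactK.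
move=> k; apply/eqP; by rewrite vertices_dact_eq // dvertVK H.
Qed.

Lemma conjc_mul (u v : R[i]) : conjc (u * v) = conjc u * conjc v.
Proof. exact: rmorphM. Qed.

Lemma polygon_class_sub x y s t p e : closes_up x -> related x s y t ->
  balance_point (vertices x) p ->
  similar_edges (fun k => unit_directions (vertices x) p (s k)) e ->
  exists2 q, balance_point (vertices y) q &
    similar_edges (fun k => unit_directions (vertices y) q (t k)) e.
Proof.
move=> cx [g [-> H]] bal sim.
have [mu [p' [mu1 bal' UE]]] := balance_dact g cx bal.
have mu0 : mu != 0 by rewrite -normr_eq0 mu1 oner_eq0.
exists p' => //; have {}UE k : unit_directions (vertices (dact x g)) p' (t k) =
    mu * conj_if g.1 (unit_directions (vertices x) p (s k)).
  by rewrite UE /unit_directions H.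
have E k : unit_directions (vertices x) p (s k) = conj_if g.1 (mu^-1) *
    conj_if g.1 (unit_directions (vertices (dact x g)) p' (t k)).
  by rewrite UE -conj_ifM mulKf // conj_ifK.
have c0 b : conj_if b mu^-1 != 0 by case: b; rewrite /= ?conjc_eq0 invr_eq0.
have [a a0 [ea|ea]] := sim.
  exists (a * conj_if g.1 mu^-1); first by rewrite mulf_neq0.
  by case: (g.1) E => E; [right|left] => k; rewrite ea E mulrA.
exists (a * conj_if (~~ g.1) mu^-1); first by rewrite mulf_neq0.
by case: (g.1) E => /= E; [left|right] => k; rewrite ea E conjc_mul ?conjcK ?conjcK mulrA.
Qed.

Lemma polygon_classE (c d : copies R 5) :
  polygon_class c = polygon_class d <->
  related (\val (projT2 c)) (projT1 c) (\val (projT2 d)) (projT1 d).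
Proof.
case: c d => s X [t Y]; rewrite /polygon_class.
have cex := cell_is_cell X; have cey := cell_is_cell Y.
rewrite [projT1 _]/= [projT1 _]/= [projT2 _]/= [projT2 _]/=.
move: (\val X) (\val Y) cex cey => x y cex cey {X Y}.
have [cx _ _] := cex; have [cy _ _] := cey; split=> [E|rel]; last first.
  apply/seteqP; split=> e /= [p bal sim].
    exact: polygon_class_sub cx rel bal sim.
  exact: polygon_class_sub cy (related_sym cx rel) bal sim.
have [p bal] := balance_point_exists cex.
have : [set e | exists2 p, balance_point (vertices x) p &
    similar_edges (fun k => unit_directions (vertices x) p (s k)) e]
    (fun k => unit_directions (vertices x) p (s k)).
  exists p => //; exists 1; first exact: oner_neq0.
  by left => k; rewrite mul1r.
rewrite E => -[q baly [a a0 H]] {E}.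
have main x' s' p' (a' : R[i]) : is_cell x' -> balance_point (vertices x') p' -> a' != 0 ->
    (forall k, unit_directions (vertices x') p' (s' k) =
               a' * unit_directions (vertices y) q (t k)) ->
    related x' s' y t.
  move=> cex' bal' a'0 E.
  have E' k : unit_directions (vertices y) q k =
      a'^-1 * unit_directions (vertices x') p' ((t^-1 * s')%g k).
    by rewrite permM E permKV mulKf.
  have a'V : a'^-1 != 0 by rewrite invr_eq0.
  have [b -> Hb] := direct_similarity cex' cey bal' baly a'V E'.
  by exists (false, b); split=> // k; rewrite -Hb permM permK.
case: H => H; first exact: main H.
(* An orientation-reversing similarity is reduced to the direct case by first reflecting [x]. *)
pose g0 : dih := (true, 0).
have [mu [p' [mu1 bal' UE]]] := balance_dact g0 cx bal.
have mu0 : mu != 0 by rewrite -normr_eq0 mu1 oner_eq0.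
pose s' := (s * perm (@dvert_inj g0))%g.
have [] := main (dact x g0) s' p' (mu * conjc a) (is_cell_dact g0 cex) bal'.
- by rewrite mulf_neq0 // conjc_eq0.
- move=> k; rewrite UE permM permE -[X in dvert g0 X]/(dvert (dinv g0) (s k)) dvertVK H /=.
  by rewrite conjc_mul conjcK mulrA.
move=> g [yE Hg]; exists (dcomp g0 g); split; first by rewrite yE dact_comp.
move=> k; have /eqP := Hg k; rewrite vertices_dact_eq // permM permE.
by rewrite -[X in dvert g0 X]/(dvert (dinv g0) (s k)) dvertVK -dvert_comp => /eqP.
Qed.

Lemma cell_mapP s t (x y : cell R 5) :
  cell_map s x = cell_map t y <-> related (\val x) s (\val y) t.
Proof.
rewrite /cell_map; split=> [/eqmodP/asboolP/polygon_classE//|H].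
by apply/eqmodP/asboolP/polygon_classE.
Qed.

Lemma cell_map_surj (z : moduli R 5) : exists s (x : cell R 5), cell_map s x = z.
Proof.
by elim/quotW: z => -[s x]; exists s, x.
Qed.

End Relation.

(** * Topology of the moduli space *)

Section Stars.
Variable R : realType.
Implicit Types (x y : cell R 5) (s t w : 'S_5) (W : {set 'S_5}) (U : set (cell R 5)).

Lemma rV_continuous (T : topologicalType) n (f : T -> 'rV[R]_n) :
  (forall k, continuous (fun u => f u 0 k)) -> continuous f.
Proof.
move=> cf u B [P nP sub].
suff : nbhs u [set u' | forall ij : 'I_1 * 'I_n, P ij.1 ij.2 (f u' ij.1 ij.2)].
  by apply: filterS => u' H; apply: sub => i j; exact: (H (i, j)).
apply: filter_forall => -[i j] /=; rewrite (ord1 i).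
by apply: (cf j u); have := nP 0 j.
Qed.

Lemma cell_val_continuous : continuous (fun x : cell R 5 => \val x).
Proof. exact: initial_continuous. Qed.

Lemma cell_coord_continuous (k : 'I_5) : continuous (fun x : cell R 5 => \val x 0 k).
Proof.
move=> x; apply: (@continuous_comp _ _ _ _ (fun v : 'rV[R]_5 => v 0 k)).
  exact: cell_val_continuous.
exact: coord_continuous.
Qed.

Lemma cell_continuous (T : topologicalType) (f : T -> cell R 5) :
  (forall k, continuous (fun u => \val (f u) 0 k)) -> continuous f.
Proof.
by move=> cf; apply: continuous_comp_initial; exact: rV_continuous.
Qed.

Lemma cell_near x e : 0 < e ->
  nbhs x [set y : cell R 5 | forall k, `|\val y 0 k - \val x 0 k| < e].
Proof.
move=> e0; apply: (@filter_forall _ _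
  (fun k (y : cell R 5) => `|\val y 0 k - \val x 0 k| < e) (nbhs x)) => k.
have /cvgrPdist_lt/(_ e e0) := @cell_coord_continuous k x.
by apply: filterS => y; rewrite distrC.
Qed.

Lemma cell_nbhsP x (N : set (cell R 5)) : nbhs x N ->
  exists2 e, 0 < e & forall y, (forall k, `|\val y 0 k - \val x 0 k| < e) -> N y.
Proof.
move=> [_ [[D oD <-] /= Dx sub]].
have /nbhs_ballP[e /= e0 He] : nbhs (\val x) D by exact: open_nbhs_nbhs.
exists e => // y H; apply: sub; apply: He; split=> // i k; rewrite (ord1 i).
by rewrite /ball /= distrC.
Qed.

Lemma is_cell_val_dact x g : is_cell (dact (\val x) g).
Proof. exact: is_cell_dact (cell_is_cell x). Qed.

Definition dactc x g : cell R 5 := mk_cell (is_cell_val_dact x g).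

Lemma cell_closes_up x : closes_up (\val x).
Proof. by case: (cell_is_cell x). Qed.

Lemma dactc_continuous g : continuous (dactc ^~ g).
Proof.
apply: cell_continuous => k.
rewrite (_ : (fun x => _) = (fun x => \val x 0 (dside g k))).
  exact: cell_coord_continuous.
by apply/funext => x; rewrite mxE.
Qed.

Definition dperm g : 'S_5 := perm (@dvert_inj g).

Lemma dpermE g k : dperm g k = dvert g k. Proof. by rewrite permE. Qed.

(** The permutations [w] for which the copies [s] and [s * w] are glued at [x] with no dihedral
    symmetry involved. *)
Definition fixes x : {set 'S_5} :=
  [set w : 'S_5 | [forall k, vertices (\val x) (w k) == vertices (\val x) k]]%SET.

Lemma fixesP x w :
  reflect (forall k, vertices (\val x) (w k) = vertices (\val x) k) (w \in fixes x).
Proof. by rewrite inE; apply: (iffP forallP) => H k; apply/eqP. Qed.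

Lemma cell_map_dihedral s x g : cell_map (s * dperm g)%g x = cell_map s (dactc x g).
Proof.
by apply/cell_mapP; exists g; split=> // k; rewrite permM dpermE.
Qed.

Lemma cell_map_fixes s w x : w \in fixes x -> cell_map (s * w)%g x = cell_map s x.
Proof.
move=> /fixesP Hw; apply/cell_mapP; exists (false, 0); split=> [|k].
  by apply/rowP => k; rewrite !mxE /dside /= add0r.
by rewrite permM Hw /dvert /= add0r.
Qed.

(** [x] lies in the closure of the face containing [y]; thus [specializes x] is the open star of [x]
    in the cell. *)
Definition specializes x y := forall k, \val y 0 k = 0 -> \val x 0 k = 0.

Lemma specializes_vertices x y (i j : 'I_5) : specializes x y ->
  vertices (\val y) i = vertices (\val y) j -> vertices (\val x) i = vertices (\val x) j.
Proof.
move=> sp /eqP H; apply/eqP; move: H.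
have -> : i = j + (i - j) by ring.
rewrite !vertices_eq; try exact: cell_is_cell.
case/or3P => [->//|/andP[-> /eqP/sp ->]|/andP[-> /eqP/sp ->]].
  by rewrite eqxx orbT.
by rewrite eqxx !orbT.
Qed.

Lemma specializes_fixes x y : specializes x y -> fixes y \subset fixes x.
Proof.
move=> sp; apply/fintype.subsetP => w /fixesP H; apply/fixesP => k.
exact: specializes_vertices sp (H k).
Qed.

Lemma specializes_near x : nbhs x (specializes x).
Proof.
apply: (@filter_forall _ _ (fun k (y : cell R 5) => \val y 0 k = 0 -> \val x 0 k = 0) (nbhs x)) => k.
have [->|xk] := eqVneq (\val x 0 k) 0; first exact: nearW.
have : 0 < `|\val x 0 k| by rewrite normr_gt0.
move=> /(cell_near x); apply: filterS => y /(_ k) H yk.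
by move: H; rewrite yk sub0r normrN ltxx.
Qed.

(** With [W = fixes x] this collects the copies glued around [cell_map s x]. Keeping [W] a parameter
    instead of [x] lets a base of the topology be indexed by countable data. *)
Definition star W s U : set (moduli R 5) :=
  [set z | exists y w, [/\ U y, w \in W & z = cell_map (s * w)%g y]].

(** The trace of a star on the copy [t]: openness in the quotient becomes openness of preimages of
    [U] under dihedral symmetries. *)
Lemma star_dihedral x s U t y : U `<=` specializes x ->
  star (fixes x) s U (cell_map t y) <->
  exists g, U (dactc y g) /\ (s^-1 * t * dperm (dinv g))%g \in fixes x.
Proof.
move=> Ux; split=> [[y' [w [Uy' Hw /cell_mapP[g [E H]]]]]|[g [Ug Hw]]].
  exists g; have Ey : y' = dactc y g by apply: val_inj.
  split; first by rewrite -Ey.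
  apply/fixesP => k; rewrite !permM dpermE.
  have := specializes_vertices (Ux _ Uy') (i := dvert (dinv g) (t (s^-1%g k)))
    (j := w k); rewrite E => ->; first by apply/fixesP.
  apply/eqP; rewrite vertices_dact_eq; last exact: cell_closes_up.
  by rewrite dvertVK H permM permKV.
exists (dactc y g), (s^-1 * t * dperm (dinv g))%g; split=> //.
rewrite -mulgA mulKVg -cell_map_dihedral; congr (cell_map _ y).
apply/permP => k; rewrite !permM !dpermE.
by rewrite dvertVK.
Qed.

Lemma moduli_openP (O : set (moduli R 5)) :
  open O <-> forall t, open [set y | O (cell_map t y)].
Proof.
rewrite /open /= /quotient_open; split=> [/sigT_openP //|H].
by apply/sigT_openP.
Qed.

Lemma star_open x s U : open U -> U `<=` specializes x -> open (star (fixes x) s U).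
Proof.
move=> oU Ux; apply/moduli_openP => t.
rewrite (_ : [set y | _] = \bigcup_(g in [set g | (s^-1 * t * dperm (dinv g))%g \in fixes x])
    ((dactc ^~ g) @^-1` U)); last first.
  apply/seteqP; split=> y /=.
    by move=> /(star_dihedral _ _ _ Ux)[g [Ug Hg]]; exists g.
  by move=> [g Hg Ug]; apply/(star_dihedral _ _ _ Ux); exists g.
apply: bigcup_open => g _; apply: open_comp => // y _; exact: dactc_continuous.
Qed.

Lemma cell_map_continuous s : continuous (@cell_map R 5 s).
Proof.
apply/continuousP => O /moduli_openP /(_ s) //.
Qed.

Lemma fixes1 x : 1%g \in fixes x.
Proof. by apply/fixesP => k; rewrite perm1. Qed.

Lemma star_mem x s U : U x -> star (fixes x) s U (cell_map s x).
Proof. by move=> Ux; exists x, 1%g; rewrite mulg1 fixes1. Qed.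

Lemma uniform_positive (I : finType) (P : I -> R -> Prop) :
  (forall i e e', 0 < e' -> e' <= e -> P i e -> P i e') ->
  (forall i, exists2 e, 0 < e & P i e) -> exists2 e, 0 < e & forall i, P i e.
Proof.
move=> mono H; pose d i := sval (cid2 (H i)).
have d0 i : 0 < d i by rewrite /d; case: cid2.
have e0 : 0 < \big[Order.min/1]_i d i by apply: lt_bigmin.
exists (\big[Order.min/1]_i d i) => // i.
by apply: (mono i (d i)) => //; [exact: bigmin_le|rewrite /d; case: cid2].
Qed.

(** If two small stars met, a symmetry [g] would take a point near [x] to one near [y]. The bound
    [e], common to all [g], then forces [dactc x g = y], and the condition on labels specializes to
    the centres, so the two classes are equal. *)
Lemma moduli_hausdorff : hausdorff_space (moduli R 5).
Proof.
rewrite open_hausdorff => p q; have [s [x <-]] := cell_map_surj p.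
have [t [y <-]] := cell_map_surj q => /eqP npq.
pose sep g (e : R) := dactc x g <> y ->
  exists k, e *+ 2 <= `|\val (dactc x g) 0 k - \val y 0 k|.
have [e e0 He] : exists2 e, 0 < e & forall g, sep g e.
  apply: uniform_positive => [g e e' e'0 ee sepe ne|g].
    have [k Hk] := sepe ne; exists k; apply: le_trans Hk.
    by rewrite lerMn2r orbC ee.
  have [E|ne] := pselect (dactc x g = y); first by exists 1.
  have /existsP[k xk] : [exists k, \val (dactc x g) 0 k != \val y 0 k].
    apply: contra_notT ne; rewrite negb_exists => /forallP xk.
    by apply: val_inj; apply/rowP => k; apply/eqP; have := xk k; rewrite negbK.
  have d0 : 0 < `|\val (dactc x g) 0 k - \val y 0 k| by rewrite normr_gt0 subr_eq0.
  exists (`|\val (dactc x g) 0 k - \val y 0 k| / 2); first by rewrite divr_gt0.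
  by move=> _; exists k; rewrite -[X in X <= _]mulr_natr divfK.
pose ball_at z := interior [set z' | specializes z z' /\
  forall k, `|\val z' 0 k - \val z 0 k| < e].
have ball_spec z : ball_at z `<=` specializes z.
  by move=> z' /interior_subset[].
have ball_mem z : ball_at z z.
  by apply: filterI; [exact: specializes_near|exact: cell_near].
exists (star (fixes x) s (ball_at x), star (fixes y) t (ball_at y)).
  by split; rewrite inE; apply: star_mem.
split; try by apply: star_open => //; exact: open_interior.
apply/eqP/seteqP; split=> // z [] /= [x1 [w [Bx1 Hw ->]]] [y1 [w' [By1 Hw' /cell_mapP]]].
move=> [g [E H]]; apply: npq; apply/cell_mapP; exists g.
have [spx dx] := interior_subset Bx1; have [spy dy] := interior_subset By1.
have Ey : dactc x g = y.
  apply: contrapT => /He[k]; rewrite leNgt => /negP; apply.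
  have := dx (dside g k); have := dy k; rewrite E /= !mxE.
  move: (x1) (x) (y) => -[x1' ?] [x' ?] [y' ?] /=; rewrite mulr2n => h1 h2.
  by rewrite (le_lt_trans (ler_distD (x1' 0 (dside g k)) _ _)) // ltrD // distrC.
split=> [|k]; first by rewrite -Ey.
transitivity (vertices (\val x) (w (s k))); first by rewrite (fixesP _ _ Hw).
have := H k; rewrite !permM => /(specializes_vertices spx) ->.
apply/eqP; rewrite -vertices_dact_eq; last exact: cell_closes_up.
have -> : dact (\val x) g = \val y by rewrite -Ey.
exact/eqP/fixesP.
Qed.

Lemma moduli_second_countable : @second_countable (moduli R 5).
Proof.
pose idx : countType := ({set 'S_5} * 'S_5 * ('rV[rat]_5 * 'rV[rat]_5))%type.
pose box (ab : 'rV[rat]_5 * 'rV[rat]_5) : set (cell R 5) :=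
  [set y : cell R 5 | forall k, ratr (ab.1 0 k) < \val y 0 k < ratr (ab.2 0 k)].
pose f (i : idx) : set (moduli R 5) := star i.1.1 i.1.2 (box i.2).
exists [set A | open A /\ exists i, A = f i].
  apply: (@sub_countable _ _ _ (f @` setT)).
    by apply: subset_card_le => A [_ [i ->]]; exists i.
  by apply: card_le_trans (card_image_le _ _) _; exact: countableP.
split=> [A []//|z A]; rewrite nbhsE => -[A' [oA' A'z] sub].
have [s [x xz]] := cell_map_surj z.
(* At [good] points every copy glued at [x] is still sent into [A']; a rational box inside this
   neighbourhood gives the basic star. *)
pose good (y : cell R 5) := specializes x y /\
  forall w : 'S_5, w \in fixes x -> A' (cell_map (s * w)%g y).
have /cell_nbhsP[e e0 He] : nbhs x good.
  apply: filterI; first exact: specializes_near.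
  apply: (@filter_forall _ _ (fun (w : 'S_5) y => w \in fixes x -> A' (cell_map (s * w)%g y)) (nbhs x)) => w.
  have [wx|_] := boolP (w \in fixes x); last exact: nearW.
  have := (moduli_openP A').1 oA' (s * w)%g => ow.
  have : nbhs x [set y | A' (cell_map (s * w)%g y)].
    by apply: open_nbhs_nbhs; split=> //=; rewrite cell_map_fixes // xz.
  exact: filterS.
have lo k : exists q : rat, \val x 0 k - e < ratr q < \val x 0 k.
  have [|q] := @rat_in_itvoo R (\val x 0 k - e) (\val x 0 k); first by rewrite gtrBl.
  by rewrite in_itv /= => Hq; exists q.
have hi k : exists q : rat, \val x 0 k < ratr q < \val x 0 k + e.
  have [|q] := @rat_in_itvoo R (\val x 0 k) (\val x 0 k + e); first by rewrite ltrDl.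
  by rewrite in_itv /= => Hq; exists q.
pose a : 'rV[rat]_5 := \row_k sval (cid (lo k)).
pose b : 'rV[rat]_5 := \row_k sval (cid (hi k)).
have aP k : \val x 0 k - e < ratr (a 0 k) < \val x 0 k by rewrite mxE; case: cid.
have bP k : \val x 0 k < ratr (b 0 k) < \val x 0 k + e by rewrite mxE; case: cid.
have box_good y : box (a, b) y -> good y.
  move=> By; apply: He => k; have := aP k; have := bP k; have := By k => /=.
  rewrite ltr_norml; move: (ratr _) (ratr _) (\val x 0 k) (\val y 0 k).
  by clear=> a' b' x' y' /andP[? ?] /andP[? ?] /andP[? ?]; apply/andP; split; lra.
have box_open : open (box (a, b)).
  rewrite openE => y By; rewrite /interior /=.
  apply: (@filter_forall _ _ (fun k (y : cell R 5) => ratr (a 0 k) < \val y 0 k < ratr (b 0 k)) (nbhs y)) => k.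
  have /andP[ya yb] := By k.
  have cy := @cell_coord_continuous k y.
  have h1 : nbhs (\val y 0 k) [set r : R | ratr (a 0 k) < r].
    by apply: open_nbhs_nbhs; split => //; exact: open_gt.
  have h2 : nbhs (\val y 0 k) [set r : R | r < ratr (b 0 k)].
    by apply: open_nbhs_nbhs; split => //; exact: open_lt.
  have c1 : nbhs y [set y : cell R 5 | ratr (a 0 k) < \val y 0 k] by exact: cy h1.
  have c2 : nbhs y [set y : cell R 5 | \val y 0 k < ratr (b 0 k)] by exact: cy h2.
  apply: (@filterS _ (nbhs y) _ _ _ _ (filterI c1 c2)) => y' [c1' c2'].
  by apply/andP; split.
exists (f (fixes x, s, (a, b))); last first.
  by move=> z' [y [w [By Hw ->]]]; apply: sub; exact: (box_good _ By).2.
split; last first.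
  rewrite -xz; apply: star_mem => k /=.
  by have /andP[_ ->] := aP k; have /andP[->] := bP k.
split; last by exists (fixes x, s, (a, b)).
by apply: star_open => // y /box_good[].
Qed.

End Stars.

(** * Hyperbolic charts *)

Section LorentzCoordinates.
Variable R : realType.
Implicit Types (x y : 'rV[R]_5) (v : 'rV[R]_3).

(** With [scaleS], the square roots of the absolute coefficients of [gram], which make [toH] an
    isometry to the standard Lorentz form. *)
Definition scaleT : R := Num.sqrt (sn / 2 * (1 - psi)).
Definition scaleS : R := Num.sqrt (sn / 2 * (1 + psi)).

Lemma scaleT_gt0 : 0 < scaleT.
Proof.
have /andP[_ p1] := @psi_bounds R; have s0 := @sn_gt0 R.
by rewrite sqrtr_gt0 mulr_gt0 ?divr_gt0 //; lra.
Qed.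

Lemma scaleS_gt0 : 0 < scaleS.
Proof.
have p0 := @psi_gt0 R; have s0 := @sn_gt0 R.
by rewrite sqrtr_gt0 mulr_gt0 ?divr_gt0 // addr_gt0.
Qed.

Lemma scaleT2 : scaleT ^+ 2 = sn / 2 * (1 - psi).
Proof. by rewrite sqr_sqrtr // ltW // -sqrtr_gt0 scaleT_gt0. Qed.

Lemma scaleS2 : scaleS ^+ 2 = sn / 2 * (1 + psi).
Proof. by rewrite sqr_sqrtr // ltW // -sqrtr_gt0 scaleS_gt0. Qed.

Definition row3 (a b c : R) : 'rV[R]_3 := \row_(i < 3) nth 0 [:: a; b; c] i.

Lemma row3E (a b c : R) : (row3 a b c 0 0 = a) * (row3 a b c 0 1 = b) * (row3 a b c 0 2%:R = c).
Proof. by rewrite !mxE. Qed.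

Lemma row3P v : v = row3 (v 0 0) (v 0 1) (v 0 2%:R).
Proof.
apply/rowP => -[[|[|[|//]]] i3]; rewrite mxE /=; congr (v 0 _); exact: val_inj.
Qed.

Definition toH x : 'rV[R]_3 := row3 (scaleT * tcoord x) (scaleS * x 0 1) (scaleS * x 0 3).

Definition ofH v : 'rV[R]_5 :=
  let t := v 0 0 / scaleT in let a := v 0 1 / scaleS in let b := v 0 2%:R / scaleS in
  \row_(k < 5) nth 0 [:: psi * t - (1 + psi) * a; a; t - (1 + psi) * (a + b); b;
                         psi * t - (1 + psi) * b] k.

Lemma toH_form x y : lorentz_form (toH x) (toH y) = gram x y.
Proof.
rewrite /lorentz_form /toH !row3E /gram.
transitivity (scaleT ^+ 2 * (tcoord x * tcoord y) -
  scaleS ^+ 2 * (x 0 1 * y 0 1 + x 0 3 * y 0 3)); first by ring.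
by rewrite scaleT2 scaleS2; ring.
Qed.

Lemma ofHE v :
  (ofH v 0 0 = psi * (v 0 0 / scaleT) - (1 + psi) * (v 0 1 / scaleS)) *
  (ofH v 0 1 = v 0 1 / scaleS) *
  (ofH v 0 2 = v 0 0 / scaleT - (1 + psi) * (v 0 1 / scaleS + v 0 2%:R / scaleS)) *
  (ofH v 0 3 = v 0 2%:R / scaleS) *
  (ofH v 0 4 = psi * (v 0 0 / scaleT) - (1 + psi) * (v 0 2%:R / scaleS)).
Proof. by rewrite !mxE. Qed.

Lemma ofH_coords v :
  [/\ ofH v 0 1 = v 0 1 / scaleS, ofH v 0 3 = v 0 2%:R / scaleS &
      tcoord (ofH v) = v 0 0 / scaleT].
Proof. by rewrite /tcoord !mxE /=; split=> //; ring. Qed.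

Lemma ofH_closes_up v : closes_up (ofH v).
Proof.
have [e1 e3 et] := ofH_coords v; apply/closes_upP; rewrite e1 e3 et.
by rewrite !mxE /=.
Qed.

Lemma ofHK v : toH (ofH v) = v.
Proof.
have [e1 e3 et] := ofH_coords v; rewrite /toH e1 e3 et [RHS]row3P.
have sT := scaleT_gt0; have sS := scaleS_gt0.
by congr row3; rewrite mulrC divfK // gt_eqF.
Qed.

Lemma toHK x : closes_up x -> ofH (toH x) = x.
Proof.
move=> cx; have /closes_upP[e0 e4] := cx; apply/rowP; apply: ord5P;
  rewrite mxE /= !row3E ?e0 ?e4; have sT := gt_eqF scaleT_gt0; have sS := gt_eqF scaleS_gt0;
  rewrite ![_ * _ / _]mulrAC !divff ?sT ?sS // !mul1r //.
by rewrite /tcoord; ring.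
Qed.

Lemma gram_ofH v w : gram (ofH v) (ofH w) = lorentz_form v w.
Proof. by rewrite -toH_form !ofHK. Qed.

Lemma is_cell_tcoord x : is_cell x -> 0 < tcoord x.
Proof.
move=> [_ gx x0]; have p0 := @psi_gt0 R; have s0 := @sn_gt0 R.
rewrite lt_def; apply/andP; split; last by rewrite /tcoord addr_ge0 ?mulr_ge0 ?addr_ge0 // ltW.
apply: contra_eq_neq gx => t0; rewrite /gram t0 !mul0r mulr0 sub0r mulrN.
have x11 : 0 <= x 0 1 * x 0 1 by exact: mulr_ge0.
have x33 : 0 <= x 0 3 * x 0 3 by exact: mulr_ge0.
have h : 0 <= sn / 2 * ((1 + psi) * (x 0 1 * x 0 1 + x 0 3 * x 0 3)).
  apply: mulr_ge0; first by rewrite divr_ge0 // ltW.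
  by apply: mulr_ge0; rewrite addr_ge0 // ltW.
by rewrite lt_eqF // (@le_lt_trans _ _ 0) // oppr_le0.
Qed.

Lemma toH_hplane x : is_cell x -> hplane (toH x).
Proof.
move=> cex; split; first by rewrite toH_form; case: cex.
by rewrite /toH row3E mulr_gt0 ?scaleT_gt0 ?is_cell_tcoord.
Qed.

Lemma ofH_continuous : continuous ofH.
Proof.
have cc (i : 'I_3) : continuous (fun v : 'rV[R]_3 => v 0 i) by exact: coord_continuous.
have cM (f : 'rV[R]_3 -> R) (r : R) : continuous f -> continuous (fun v => f v * r).
  by move=> cf v; apply: (@continuousM _ _ f (cst r)); [exact: cf|exact: cst_continuous].
have cD (f g : 'rV[R]_3 -> R) : continuous f -> continuous g -> continuous (fun v => f v + g v).
  by move=> cf cg v; apply: (@continuousD _ R^o); [exact: cf|exact: cg].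
have [sT sS] := (lt0r_neq0 scaleT_gt0, lt0r_neq0 scaleS_gt0).
apply: rV_continuous; apply: (ord5P (P := fun k => continuous (fun v => ofH v 0 k))).
- rewrite (_ : (fun v => _) = fun v => v 0 0 * (psi / scaleT) + v 0 1 * (- (1 + psi) / scaleS)).
    by apply: cD; apply: cM.
  by apply/funext => v; rewrite ofHE; field; rewrite sT sS.
- by rewrite (_ : (fun v => _) = fun v => v 0 1 * (scaleS)^-1); [exact: cM|apply/funext => v; rewrite ofHE].
- rewrite (_ : (fun v => _) = fun v => v 0 0 * (1 / scaleT) +
    (v 0 1 * (- (1 + psi) / scaleS) + v 0 2%:R * (- (1 + psi) / scaleS))).
    by apply: (cD); [exact: cM|apply: (cD); exact: cM].
  by apply/funext => v; rewrite ofHE; field; rewrite sT sS.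
- by rewrite (_ : (fun v => _) = fun v => v 0 2%:R * (scaleS)^-1); [exact: cM|apply/funext => v; rewrite ofHE].
- rewrite (_ : (fun v => _) = fun v => v 0 0 * (psi / scaleT) + v 0 2%:R * (- (1 + psi) / scaleS)).
    by apply: cD; apply: cM.
  by apply/funext => v; rewrite ofHE; field; rewrite sT sS.
Qed.

Lemma apexE :
  (ofH (row3 1 0 0) 0 0 = psi / scaleT) * (ofH (row3 1 0 0) 0 1 = 0) *
  (ofH (row3 1 0 0) 0 2 = 1 / scaleT) * (ofH (row3 1 0 0) 0 3 = 0) *
  (ofH (row3 1 0 0) 0 4 = psi / scaleT).
Proof. by rewrite !ofHE !row3E !mul0r !addr0 !mulr0 !subr0 mul1r. Qed.

Lemma apex_is_cell : is_cell (ofH (row3 1 0 0)).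
Proof.
split; first exact: ofH_closes_up.
  by rewrite gram_ofH /lorentz_form !row3E; ring.
have sT := scaleT_gt0; have p0 := @psi_gt0 R.
by apply: (ord5P (P := fun k => 0 <= ofH (row3 1 0 0) 0 k)); rewrite apexE // divr_ge0 // ltW.
Qed.

(** The corner where the sides [1] and [3] collapse. It is the origin of the hyperboloid, and the
    two sides of the cell through it lie on coordinate planes. *)
Definition apex : cell R 5 := mk_cell apex_is_cell.

Lemma apex_zeros : (\val apex 0 1 = 0) * (\val apex 0 3 = 0).
Proof. by rewrite /apex val_mk_cell !apexE. Qed.

Lemma apex_gt0 : [/\ 0 < \val apex 0 0, 0 < \val apex 0 2 & 0 < \val apex 0 4].
Proof.
have sT := scaleT_gt0; have p0 := @psi_gt0 R.
by rewrite /apex val_mk_cell !apexE; split; rewrite divr_gt0.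
Qed.

Lemma specializes_apex (y : cell R 5) : specializes apex y <->
  [/\ 0 < \val y 0 0, 0 < \val y 0 2 & 0 < \val y 0 4].
Proof.
have [a0 a2 a4] := apex_gt0; have [_ _ y0] := cell_is_cell y; split=> [H|[y00 y2 y4]].
  have pos k : 0 < \val apex 0 k -> 0 < \val y 0 k.
    by move=> ak; rewrite lt_def y0 andbT; apply/eqP => /H e; rewrite e ltxx in ak.
  by split; apply: pos.
apply: (ord5P (P := fun k => \val y 0 k = 0 -> \val apex 0 k = 0)); rewrite ?apex_zeros // => e.
- by rewrite e ltxx in y00.
- by rewrite e ltxx in y2.
- by rewrite e ltxx in y4.
Qed.

(** The side [1] joins the vertices [0] and [1], the side [3] the vertices [2] and [3]; at [apex]
    the labels in each pair are interchangeable. *)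
Definition swaps (a b : bool) (k : 'I_5) : 'I_5 :=
  nth 0 [:: (if a then 1 else 0); (if a then 0 else 1);
            (if b then 3 else 2); (if b then 2 else 3); 4] k.

Lemma swaps_comp a b a' b' k : swaps a b (swaps a' b' k) = swaps (a (+) a') (b (+) b') k.
Proof. by move: k; case: a b a' b' => [] [] [] []; apply: ord5P. Qed.

Lemma swapsK a b : involutive (swaps a b).
Proof.
by move=> k; rewrite swaps_comp !addbb; move: k; apply: ord5P; apply: val_inj.
Qed.

Definition swaps_perm a b : 'S_5 := perm (can_inj (swapsK a b)).

Definition flip1 (w : 'S_5) : bool := w 1 != 1.
Definition flip3 (w : 'S_5) : bool := w 3 != 3.

(** Halving a label numbers the three distinct vertices, labelled [{0, 1}], [{2, 3}] and [{4}]. *)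
Lemma apex_vertices (i j : 'I_5) : (vertices (\val apex) i == vertices (\val apex) j) =
  (i./2 == j./2).
Proof.
have [a0 a2 a4] := apex_gt0.
rewrite vertices_eq_linkn; last exact: cell_is_cell.
have -> : zlist (\val apex) = [:: false; true; false; true; false].
  apply: (@eq_from_nth _ false) => // n; rewrite size_mkseq => n5.
  rewrite -[n]/(val (Ordinal n5)) nth_zlist; move: (Ordinal n5).
  by apply: ord5P; rewrite ?apex_zeros ?eqxx ?(gt_eqF a0) ?(gt_eqF a2) ?(gt_eqF a4).
by move: i j; apply: ord5P; apply: ord5P.
Qed.

End LorentzCoordinates.
Arguments scaleT {R}.
Arguments scaleS {R}.

(** * Unfolding four tiles at a corner *)

Section Charts.
Variable R : realType.
Implicit Types (x y : cell R 5) (s w : 'S_5).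

Lemma dperm_fixes x g : dperm g \in fixes x -> g = (false, 0).
Proof.
move=> /fixesP H; have cex := cell_is_cell x.
have {}H i m : dvert g i = i + m ->
    [|| m == 0, (m == 1) && (\val x 0 (i + 1) == 0) | (m == 4) && (\val x 0 i == 0)].
  by move=> e; rewrite -vertices_eq // -e -dpermE H.
case: g H => [[] a] H.
  (* As [3] is the inverse of [2] modulo 5, the reflection moves the label [3 * (a - 2)] by [2], and
     vertices two apart never coincide. A rotation by one step would need two adjacent collapsed
     sides. *)
  have := H (3 * (a - 2)) 2; rewrite /dvert /= => /(_ _) H'.
  have : a - 3 * (a - 2) = 3 * (a - 2) + 2 by move: a {H H'}; apply: ord5P; apply: val_inj.
  by move=> /H'.
have {}H i : [|| a == 0, (a == 1) && (\val x 0 (i + 1) == 0) | (a == 4) && (\val x 0 i == 0)].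
  by apply: H; rewrite /dvert /= addrC.
have nz k := @no_adjacent_zeros _ (\val x) k cex.
congr (_, _); have /or3P[/eqP //|/andP[/eqP a1 /eqP x1]|/andP[/eqP a4 /eqP x0]] := H 0;
  have /or3P[/eqP //|/andP[/eqP a1' /eqP x2]|/andP[/eqP a4' /eqP x1']] := H 1.
- by rewrite add0r in x1; have := nz _ x1; rewrite x2 ltxx.
- by have := congr1 val (etrans (esym a1) a4').
- by have := congr1 val (etrans (esym a4) a1').
- by have := nz _ x0; rewrite add0r x1' ltxx.
Qed.

Lemma fixes_apexP w : reflect (forall k, w k = swaps (flip1 w) (flip3 w) k) (w \in fixes (apex R)).
Proof.
apply: (iffP idP) => [/fixesP H|H].
  have {}H k : (w k)./2 = k./2 by apply/eqP; rewrite -(@apex_vertices R) H.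
  have h0 (i : 'I_5) : i./2 = 0%N -> i = 0 \/ i = 1.
    by move: i; apply: ord5P => // _; [left|right].
  have h1 (i : 'I_5) : i./2 = 1%N -> i = 2 \/ i = 3.
    by move: i; apply: ord5P => // _; [left|right].
  have h2 (i : 'I_5) : i./2 = 2%N -> i = 4 by move: i; apply: ord5P.
  have n01 : w 0 != w 1 by rewrite (inj_eq perm_inj).
  have n23 : w 2 != w 3 by rewrite (inj_eq perm_inj).
  apply: ord5P; rewrite /flip1 /flip3 /swaps /=; last by apply: h2; rewrite H.
  - by move: n01; case: (h0 _ (H 0)) (h0 _ (H 1)) => [->|->] [->|->].
  - by case: (h0 _ (H 1)) => ->.
  - by move: n23; case: (h1 _ (H 2)) (h1 _ (H 3)) => [->|->] [->|->].
  - by case: (h1 _ (H 3)) => ->.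
apply/fixesP => k; apply/eqP; rewrite apex_vertices H.
by move: (flip1 w) (flip3 w) k => [] []; apply: ord5P.
Qed.

Lemma swaps_perm_flips a b : (flip1 (swaps_perm a b) = a) * (flip3 (swaps_perm a b) = b).
Proof. by rewrite /flip1 /flip3 !permE; case: a b => [] []. Qed.

Lemma swaps_perm_fixes a b : swaps_perm a b \in fixes (apex R).
Proof. by apply/fixes_apexP => k; rewrite !swaps_perm_flips permE. Qed.

Lemma swaps_link y a b a' b' k :
  \val y 0 1 = 0 \/ a = a' -> \val y 0 3 = 0 \/ b = b' ->
  vertices (\val y) (swaps a b k) = vertices (\val y) (swaps a' b' k).
Proof.
have cy := cell_closes_up y; move=> h1 h3.
have V1 : \val y 0 1 = 0 -> vertices (\val y) 1 = vertices (\val y) 0.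
  move=> y1; have := vertices_stepS 0 cy.
  by rewrite add0r y1 mul0r addr0.
have V3 : \val y 0 3 = 0 -> vertices (\val y) 3 = vertices (\val y) 2.
  move=> y3; have := vertices_stepS 2 cy; rewrite (_ : 2 + 1 = 3); last exact: val_inj.
  by rewrite y3 mul0r addr0.
move: k; apply: ord5P; rewrite /swaps /=.
- by case: h1 => [/V1 e|-> //]; case: a a' => [] []; rewrite ?e.
- by case: h1 => [/V1 e|-> //]; case: a a' => [] []; rewrite ?e.
- by case: h3 => [/V3 e|-> //]; case: b b' => [] []; rewrite ?e.
- by case: h3 => [/V3 e|-> //]; case: b b' => [] []; rewrite ?e.
- by [].
Qed.

Definition sgnb (b : bool) : R := if b then -1 else 1.

(** The point of the copy [s * w] is drawn in the quadrant whose signs are the flags of [w]. *)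
Definition chart_value y w : 'rV[R]_3 :=
  row3 (scaleT * tcoord (\val y)) (sgnb (flip1 w) * (scaleS * \val y 0 1))
       (sgnb (flip3 w) * (scaleS * \val y 0 3)).

Lemma sgnb_eq (a a' : bool) (r r' : R) : 0 <= r -> 0 <= r' ->
  sgnb a * (scaleS * r) = sgnb a' * (scaleS * r') -> r = r' /\ (r = 0 \/ a = a').
Proof.
have s0 := @scaleS_gt0 R; move=> r0 r'0.
have E : sgnb a * (scaleS * r) = scaleS * (sgnb a * r) by rewrite mulrCA.
have E' : sgnb a' * (scaleS * r') = scaleS * (sgnb a' * r') by rewrite mulrCA.
rewrite E E' => /(mulfI (lt0r_neq0 s0)).
case: a a' {E E'} => [] []; rewrite /sgnb ?mulN1r ?mul1r => e.
- by split; [exact: oppr_inj|right].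
- have [re re'] : r = 0 /\ r' = 0 by lra.
  by rewrite re re'; split; [|left].
- have [re re'] : r = 0 /\ r' = 0 by lra.
  by rewrite re re'; split; [|left].
- by split; [|right].
Qed.

(** Well-definedness and injectivity of the chart at once. The symmetry relating the two pairs fixes
    the vertices of [apex], so it is trivial by [dperm_fixes]; and a sign is lost exactly when its
    coordinate vanishes, that is, when the swapped labels coincide. *)
Lemma chart_value_eq s y y' w w' : specializes (apex R) y -> specializes (apex R) y' ->
  w \in fixes (apex R) -> w' \in fixes (apex R) ->
  cell_map (s * w)%g y = cell_map (s * w')%g y' <-> chart_value y w = chart_value y' w'.
Proof.
move=> sy sy' fw fw'; have [cy _ y0] := cell_is_cell y; have [cy' _ y'0] := cell_is_cell y'.
have Hw := fixes_apexP _ fw; have Hw' := fixes_apexP _ fw'.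
have link_iff : (forall j, vertices (\val y) (w j) = vertices (\val y) (w' j)) <->
    (\val y 0 1 = 0 \/ flip1 w = flip1 w') /\ (\val y 0 3 = 0 \/ flip3 w = flip3 w').
  split=> [H|[h1 h3] j]; last by rewrite Hw Hw'; exact: swaps_link.
  have cex := cell_is_cell y.
  have e01 := vertices_eq 0 1 cex; have e23 := vertices_eq 2 1 cex.
  rewrite /= orbF add0r in e01; rewrite /= orbF (_ : 2 + 1 = 3) in e23; last exact: val_inj.
  have := H 1; have := H 3; rewrite !Hw !Hw' /swaps /= => h3 h1; split.
    move: h1; case: (flip1 w) (flip1 w') => [] [] h1; try (by right);
      by left; apply/eqP; rewrite -e01 h1.
  move: h3; case: (flip3 w) (flip3 w') => [] [] h3; try (by right);
    by left; apply/eqP; rewrite -e23 h3.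
split=> [/cell_mapP[g [E H]]|].
  have {}H j : vertices (\val y) (w j) = vertices (\val y) (dvert g (w' j)).
    by have := H (s^-1%g j); rewrite !permM permKV.
  have g1 : g = (false, 0).
    apply: (@dperm_fixes (apex R)); apply/fixesP => k; rewrite dpermE.
    have := H (w'^-1%g k); rewrite permKV => /(specializes_vertices sy) <-.
    by rewrite (fixesP _ _ fw) -[in RHS](permKV w' k) (fixesP _ _ fw').
  have Ey : y' = y.
    by apply: val_inj; rewrite E g1; apply/rowP => k; rewrite mxE /dside /= add0r.
  have /link_iff[h1 h3] : forall j, vertices (\val y) (w j) = vertices (\val y) (w' j).
    by move=> j; rewrite H g1 /dvert /= add0r.
  rewrite Ey /chart_value; congr row3.
    by case: h1 => ->; rewrite ?mulr0.
  by case: h3 => ->; rewrite ?mulr0.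
move=> E; have := congr1 (fun v : 'rV[R]_3 => v 0 0) E.
have := congr1 (fun v : 'rV[R]_3 => v 0 1) E; have := congr1 (fun v : 'rV[R]_3 => v 0 2%:R) E.
rewrite /chart_value /= !row3E => e3 e1 /(mulfI (lt0r_neq0 (@scaleT_gt0 R))) e0.
have [y1 l1] := sgnb_eq (y0 1) (y'0 1) e1; have [y3 l3] := sgnb_eq (y0 3) (y'0 3) e3.
have Ey : y = y'.
  by apply: val_inj; rewrite -(toHK cy) -(toHK cy') /toH e0 y1 y3.
rewrite -Ey; apply/cell_mapP; exists (false, 0); split.
  by apply/rowP => k; rewrite mxE /dside /= add0r.
by move=> k; rewrite /dvert /= add0r !permM; apply: (link_iff.2 (conj l1 l3)).
Qed.

(** Where the flags differ, a term with coefficient [- scaleS ^+ 2] changes sign; this is the origin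
    of the factor [2 * scaleS ^+ 2 = sn * (1 + psi)]. *)
Lemma chart_value_form y y' w w' : w \in fixes (apex R) -> w' \in fixes (apex R) ->
  lorentz_form (chart_value y w) (chart_value y' w') = gram (\val y) (\val y') +
    sn * (1 + psi) * ((flip1 w (+) flip1 w')%:R * (\val y 0 1 * \val y' 0 1) +
                      (flip3 w (+) flip3 w')%:R * (\val y 0 3 * \val y' 0 3)).
Proof.
move=> _ _; rewrite /lorentz_form /chart_value !row3E /gram.
transitivity (scaleT ^+ 2 * (tcoord (\val y) * tcoord (\val y')) - scaleS ^+ 2 *
  (sgnb (flip1 w) * sgnb (flip1 w') * (\val y 0 1 * \val y' 0 1) +
   sgnb (flip3 w) * sgnb (flip3 w') * (\val y 0 3 * \val y' 0 3))); first by ring.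
rewrite scaleT2 scaleS2.
by case: (flip1 w) (flip1 w') (flip3 w) (flip3 w') => [] [] [] []; rewrite /sgnb /=; field.
Qed.

(* For points of two tiles which are images of one another under reflections
   in common sides, this is the Lorentz product after unfolding. *)
Definition unfolded_form y s y' s' : R := gram (\val y) (\val y') +
  sn * (1 + psi) * \sum_k
    (((s^-1 * s')%g (k - 1) == k) && ((s^-1 * s')%g k == k - 1))%:R *
    (\val y 0 k * \val y' 0 k).

(** Passing to a chart at another corner amounts to such a symmetry, so this invariance is what
    makes charts compatible. *)
Lemma unfolded_form_dihedral y s y' s' g :
  unfolded_form (dactc y g) (s * dperm (dinv g))%g (dactc y' g) (s' * dperm (dinv g))%g =
  unfolded_form y s y' s'.
Proof.
have [cy _ _] := cell_is_cell y; have [cy' _ _] := cell_is_cell y'.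
rewrite /unfolded_form dact_gram //; congr (_ + _ * _).
rewrite [RHS](reindex_inj (@dside_inj g)) /=; apply: eq_bigr => k _.
rewrite !mxE; congr (_%:R * _).
have E j : ((s * dperm (dinv g))^-1 * (s' * dperm (dinv g)))%g j =
    dvert (dinv g) ((s^-1 * s')%g (dvert g j)).
  rewrite invMg -!mulgA !permM !dpermE; congr (dvert _ (s' (s^-1%g _))).
  by apply: (@perm_inj _ (dperm (dinv g))); rewrite permKV dpermE dvertK.
rewrite !E; move: (s^-1 * s')%g => u.
have eqg i j : (dvert (dinv g) i == j) = (i == dvert g j).
  by rewrite (can2_eq (dvertVK g) (dvertK g)).
rewrite !eqg; case: g {E eqg} => [[] a]; rewrite /dvert /dside /=.
  have -> : a - (k - 1) = a + 1 - k by ring.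
  have -> : a - k = a + 1 - k - 1 by ring.
  by rewrite andbC.
by rewrite addrA.
Qed.

Lemma unfolded_form_chart s y y' w w' : w \in fixes (apex R) -> w' \in fixes (apex R) ->
  unfolded_form y (s * w)%g y' (s * w')%g =
  lorentz_form (chart_value y w) (chart_value y' w').
Proof.
move=> fw fw'; rewrite chart_value_form //; congr (_ + _ * _).
have -> : ((s * w)^-1 * (s * w') = w^-1 * w')%g by rewrite invMg -mulgA mulKg.
have E j : (w^-1 * w')%g j = swaps (flip1 w (+) flip1 w') (flip3 w (+) flip3 w') j.
  have -> : w^-1%g = w :> 'S_5.
    by apply/permP => i; apply: (@perm_inj _ w); rewrite permKV !(fixes_apexP _ fw) swapsK.
  rewrite permM (fixes_apexP _ fw).
  by rewrite (fixes_apexP _ fw') swaps_comp addbC [flip3 w' (+) _]addbC.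
rewrite sum5 !E; move: (flip1 w (+) flip1 w') (flip3 w (+) flip3 w') => a b.
set y1 := _ * \val y' 0 1; set y3 := _ * \val y' 0 3.
by case: a b => [] []; rewrite /swaps /= ?mul0r ?mul1r ?add0r ?addr0.
Qed.

(** A representing pair is chosen, with the default [0] outside the star; [chart_fun_atE] shows that
    the choice does not matter. *)
Definition chart_fun_at s (z : moduli R 5) : 'rV[R]_3 :=
  match pselect (exists p : cell R 5 * 'S_5, [/\ specializes (apex R) p.1,
      p.2 \in fixes (apex R) & z = cell_map (s * p.2)%g p.1]) with
  | left h => let p := sval (cid h) in chart_value p.1 p.2
  | right _ => 0
  end.

Lemma chart_fun_atE s y w : specializes (apex R) y -> w \in fixes (apex R) ->
  chart_fun_at s (cell_map (s * w)%g y) = chart_value y w.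
Proof.
move=> sy fw; rewrite /chart_fun_at; case: pselect => [h|[]]; last by exists (y, w).
case: cid => -[y' w'] /= [sy' fw' E].
by apply/esym/(chart_value_eq s sy sy' fw fw').
Qed.

Definition star_chart s : chart R (moduli R 5) :=
  Chart (star (fixes (apex R)) s (specializes (apex R))) (chart_fun_at s).

Definition star_atlas : set (chart R (moduli R 5)) := [set star_chart s | s in setT].

End Charts.

(** * The charts form a hyperbolic surface *)

Section Surface.
Variable R : realType.
Implicit Types (x y : cell R 5) (s w : 'S_5) (v : 'rV[R]_3).

Lemma specializes_trans x y z : specializes x y -> specializes y z -> specializes x z.
Proof. by move=> xy yz k /yz /xy. Qed.

Lemma specializes_dactc x y g : specializes x y -> specializes (dactc x g) (dactc y g).
Proof. by move=> xy k /=; rewrite !mxE => /xy. Qed.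

Lemma star_nbhs x s (U : set (cell R 5)) : nbhs x U ->
  nbhs (cell_map s x) (star (fixes x) s U).
Proof.
move=> nU; pose U' := interior (U `&` specializes x).
have nU' : U' x by apply: filterI => //; exact: specializes_near.
have sub : star (fixes x) s U' `<=` star (fixes x) s U.
  by move=> z [y [w [/interior_subset[Uy _] fw ->]]]; exists y, w.
apply: filterS sub _; apply: open_nbhs_nbhs; split; last exact: star_mem.
by apply: star_open => [|y /interior_subset[]]; first exact: open_interior.
Qed.

Lemma star_chart_dom s t y : chart_dom (star_chart R s) (cell_map t y) <->
  exists g, specializes (apex R) (dactc y g) /\
            (s^-1 * t * dperm (dinv g))%g \in fixes (apex R).
Proof. exact: star_dihedral. Qed.

Lemma cell_map_dinv t y g : cell_map t y = cell_map (t * dperm (dinv g))%g (dactc y g).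
Proof.
rewrite -cell_map_dihedral -mulgA; congr (cell_map _ y); apply/permP => k.
by rewrite !permM !dpermE dvertVK.
Qed.

Lemma star_chart_value s t y g : specializes (apex R) (dactc y g) ->
  (s^-1 * t * dperm (dinv g))%g \in fixes (apex R) ->
  chart_fun (star_chart R s) (cell_map t y) =
  chart_value (dactc y g) (s^-1 * t * dperm (dinv g))%g.
Proof.
move=> sy fw; rewrite (cell_map_dinv t y g) /=.
have -> : (t * dperm (dinv g))%g = (s * (s^-1 * t * dperm (dinv g)))%g.
  by rewrite -!mulgA mulKVg.
exact: chart_fun_atE.
Qed.

Lemma fixes_conj x u g : u \in fixes x ->
  ((dperm (dinv g))^-1 * u * dperm (dinv g))%g \in fixes (dactc x g).
Proof.
move=> /fixesP H; apply/fixesP => k; apply/eqP.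
rewrite vertices_dact_eq; last exact: cell_closes_up.
rewrite !permM dpermE dvertVK H; apply/eqP; congr vertices.
by apply: (@perm_inj _ (dperm (dinv g))); rewrite permKV dpermE dvertK.
Qed.

Lemma row3_continuous (T : topologicalType) (f0 f1 f2 : T -> R) :
  continuous f0 -> continuous f1 -> continuous f2 ->
  continuous (fun u => row3 (f0 u) (f1 u) (f2 u)).
Proof.
move=> c0 c1 c2; apply: rV_continuous => -[[|[|[|//]]] i3].
- by rewrite (_ : (fun u => _) = f0) //; apply/funext => u; rewrite mxE.
- by rewrite (_ : (fun u => _) = f1) //; apply/funext => u; rewrite mxE.
- by rewrite (_ : (fun u => _) = f2) //; apply/funext => u; rewrite mxE.
Qed.

Lemma chart_value_continuous w : continuous (fun y : cell R 5 => chart_value y w).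
Proof.
have cc (i : 'I_5) := @cell_coord_continuous R i.
have cM (f : cell R 5 -> R) (r : R) : continuous f -> continuous (fun y => r * f y).
  by move=> cf y; apply: (@continuousM _ _ (cst r) f); [exact: cst_continuous|exact: cf].
have cD (f g : cell R 5 -> R) : continuous f -> continuous g -> continuous (fun y => f y + g y).
  by move=> cf cg y; apply: (@continuousD _ R^o); [exact: cf|exact: cg].
apply: row3_continuous.
- apply: (cM); apply: (cD) => //; apply: (cM); exact: cD.
- by apply: (cM); exact: cM.
- by apply: (cM); exact: cM.
Qed.

Lemma within_continuous_open (X T : topologicalType) (A : set X) (f : X -> T) :
  open A -> (forall z, A z -> {for z, continuous f}) -> {within A, continuous f}.
Proof.
by move=> oA H; rewrite continuous_open_subspace // => z /set_mem /H.
Qed.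

Lemma star_chart_continuous s z : chart_dom (star_chart R s) z ->
  {for z, continuous (chart_fun (star_chart R s))}.
Proof.
move=> [x [w [sx fw ->]]] B; rewrite [chart_fun _ _]chart_fun_atE // => nB.
have sub := specializes_fixes sx.
(* Near [x] only the finitely many copies [w * u] with [u] in [fixes x] occur, and their chart
   values agree at [x]. *)
have nU : nbhs x [set y | specializes x y /\ forall u : 'S_5, u \in fixes x ->
    B (chart_value y (w * u)%g)].
  apply: filterI; first exact: specializes_near.
  apply: (@filter_forall _ _ (fun (u : 'S_5) y => u \in fixes x ->
    B (chart_value y (w * u)%g)) (nbhs x)) => u.
  have [fu|_] := boolP (u \in fixes x); last exact: nearW.
  have fwu : (w * u)%g \in fixes (apex R).
    apply/fixesP => k; rewrite permM (fixesP _ _ (fintype.subsetP sub _ fu)).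
    exact: (fixesP _ _ fw).
  have E : chart_value x (w * u)%g = chart_value x w.
    by apply/(chart_value_eq 1 sx sx fwu fw); rewrite mulgA !mul1g cell_map_fixes.
  have h : nbhs x [set y | B (chart_value y (w * u)%g)].
    by apply: chart_value_continuous; rewrite E.
  by apply: filterS h.
apply: filterS (star_nbhs (s * w)%g nU) => z' [y [u [[spy H] fu ->]]].
rewrite /= -mulgA chart_fun_atE; first exact: H.
  exact: specializes_trans sx spy.
apply/fixesP => k; rewrite permM (fixesP _ _ (fintype.subsetP sub _ fu)).
exact: (fixesP _ _ fw).
Qed.

(** Folds the four quadrants onto the one carrying the cell; [ofH (absH v)] is the pentagon drawn at
    [v]. *)
Definition absH v : 'rV[R]_3 := row3 (v 0 0) `|v 0 1| `|v 0 2%:R|.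

Lemma absH_continuous : continuous absH.
Proof.
have cN (i : 'I_3) : continuous (fun v : 'rV[R]_3 => `|v 0 i|).
  move=> v; apply: (@continuous_comp _ _ _ (fun v : 'rV[R]_3 => v 0 i) (fun r : R => `|r|)).
    exact: coord_continuous.
  exact: norm_continuous.
by apply: row3_continuous => //; exact: coord_continuous.
Qed.

Lemma is_cell_absH v : hplane v -> 0 < ofH (absH v) 0 0 -> 0 < ofH (absH v) 0 2 ->
  0 < ofH (absH v) 0 4 -> is_cell (ofH (absH v)).
Proof.
move=> [v1 v0] p0 p2 p4; split; first exact: ofH_closes_up.
  by rewrite gram_ofH /lorentz_form /absH !row3E -!normrM !ger0_norm -?expr2 ?sqr_ge0.
have s0 := @scaleS_gt0 R.
by apply: (ord5P (P := fun k => 0 <= ofH (absH v) 0 k)); try exact: ltW;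
  rewrite ofHE row3E divr_ge0 // ltW.
Qed.

Definition quadrant (a b : bool) : set 'rV[R]_3 :=
  [set v | 0 <= sgnb R a * v 0 1 /\ 0 <= sgnb R b * v 0 2%:R].

Lemma quadrant_nbhs a b v : ~ quadrant a b v -> nbhs v (~` quadrant a b).
Proof.
move=> nq; apply: open_nbhs_nbhs; split=> //; apply: closed_openC.
have cM (r : R) (i : 'I_3) : continuous (fun v : 'rV[R]_3 => r * v 0 i).
  move=> u; apply: (@continuousM _ _ (cst r) (fun v : 'rV[R]_3 => v 0 i)).
    exact: cst_continuous.
  exact: coord_continuous.
by apply: closedI; apply: (@preimage_closed _ _ _ [set r : R | 0 <= r]) => //;
  try exact: closed_ge; move=> u _; exact: cM.
Qed.

Lemma mem_quadrant v : exists a b, quadrant a b v.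
Proof.
exists (v 0 1 < 0), (v 0 2%:R < 0); split; rewrite /sgnb; case: ltP => h;
  by rewrite ?mul1r // mulN1r oppr_ge0 ltW.
Qed.

Lemma sgnb_norm (a : bool) (r : R) : 0 <= sgnb R a * r -> sgnb R a * `|r| = r.
Proof.
case: a; rewrite /sgnb ?mulN1r ?mul1r => h; last by rewrite ger0_norm.
by rewrite oppr_ge0 in h; rewrite ler0_norm // opprK.
Qed.

Lemma star_chart_open s : open (chart_dom (star_chart R s)).
Proof.
apply: star_open => //; rewrite openE => y sy; apply: filterS (specializes_near y) => y'.
exact: specializes_trans.
Qed.

Lemma sgnb_agree a b (r : R) : 0 <= r -> 0 <= sgnb R a * (sgnb R b * r) ->
  sgnb R a * r = sgnb R b * r.
Proof. by case: a b => [] []; rewrite /sgnb ?mulN1r ?mul1r => r0 h; lra. Qed.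

Lemma hyperbolic_star_chart s : hyperbolic_chart (star_chart R s).
Proof.
have sS := @scaleS_gt0 R.
have domE z : chart_dom (star_chart R s) z -> exists y w,
    [/\ specializes (apex R) y, w \in fixes (apex R) & z = cell_map (s * w)%g y] by [].
split.
- exact: star_chart_open.
- by apply: within_continuous_open; [exact: star_chart_open|exact: star_chart_continuous].
- move=> z z' /set_mem /domE[y [w [sy fw ->]]] /set_mem /domE[y' [w' [sy' fw' ->]]].
  by rewrite /= !chart_fun_atE // => /(chart_value_eq s sy sy' fw fw').
move=> W oW sub.
(* Adding the complement of the hyperboloid gives an ambient set; it remains to see that it is a
   neighbourhood of each image point. *)
exists (interior (chart_fun (star_chart R s) @` W `|` ~` @hplane R)); first exact: open_interior.
apply/seteqP; split=> v; last by move=> [/interior_subset[//|nh] h].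
move=> [z Wz <-]; have [x [w [sx fw zE]]] := domE _ (sub _ Wz).
have vE : chart_fun (star_chart R s) z = chart_value x w by rewrite zE /= chart_fun_atE.
have cex := cell_is_cell x; have [cx gx x0] := cex.
have hv : hplane (chart_value x w).
  split; first by rewrite chart_value_form // !addbb !mul0r addr0 mulr0 addr0.
  by rewrite /chart_value row3E mulr_gt0 ?scaleT_gt0 ?is_cell_tcoord.
rewrite vE; split=> //; move v'E: (chart_value x w) hv => v' hv.
have absv : ofH (absH v') = \val x.
  rewrite -[RHS](toHK cx); congr ofH; rewrite -v'E /absH /chart_value !row3E /toH.
  have nsg a (r : R) : 0 <= r -> `|sgnb R a * (scaleS * r)| = scaleS * r.
    move=> r0; rewrite normrM [X in _ * X]ger0_norm; last by rewrite mulr_ge0 // ltW.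
    by case: a; rewrite /sgnb ?normrN1 ?normr1 mul1r.
  by rewrite !nsg.
have near_x e : 0 < e -> nbhs v' [set v | forall k, `|ofH (absH v) 0 k - \val x 0 k| < e].
  move=> e0; apply: (@filter_forall _ _
    (fun k (v : 'rV[R]_3) => `|ofH (absH v) 0 k - \val x 0 k| < e) (nbhs v')) => k.
  have cf : continuous (fun v => ofH (absH v) 0 k).
    move=> u; apply: (@continuous_comp _ _ _ (fun v => ofH (absH v)) (fun y : 'rV[R]_5 => y 0 k)).
      by apply: continuous_comp; [exact: absH_continuous|exact: ofH_continuous].
    exact: coord_continuous.
  have /cvgrPdist_lt/(_ e e0) := cf v'; rewrite absv.
  by apply: filterS => u; rewrite distrC.
(* Near [v'], a point of a closed quadrant containing [v'] is folded back and placed in the copy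
   with the signs of that quadrant; the other quadrants are avoided by shrinking. *)
pose good (ab : bool * bool) : set 'rV[R]_3 := [set v | quadrant ab.1 ab.2 v -> hplane v ->
  exists2 cv : is_cell (ofH (absH v)), specializes (apex R) (mk_cell cv) &
    W (cell_map (s * swaps_perm ab.1 ab.2)%g (mk_cell cv))].
have ngood ab : nbhs v' (good ab).
  have [qv|nq] := pselect (quadrant ab.1 ab.2 v'); last first.
    by apply: filterS (quadrant_nbhs nq) => u nqu qu; case: nqu.
  have fab := swaps_perm_fixes R ab.1 ab.2.
  have zab : cell_map (s * swaps_perm ab.1 ab.2)%g x = z.
    rewrite zE; apply/(chart_value_eq s sx sx fab fw).
    rewrite v'E [RHS]row3P /chart_value; move: qv; rewrite -v'E /quadrant /chart_value /= !row3E.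
    move=> [q1 q2]; rewrite !swaps_perm_flips.
    by congr row3; apply: sgnb_agree => //; rewrite mulr_ge0 // ltW.
  have nW : nbhs x [set y | specializes (apex R) y /\ W (cell_map (s * swaps_perm ab.1 ab.2)%g y)].
    apply: filterI.
      by apply: filterS (specializes_near x) => y; exact: specializes_trans.
    by apply: open_nbhs_nbhs; split; [exact: (moduli_openP W).1|rewrite /= zab].
  have [e e0 He] := cell_nbhsP nW.
  have [x00 x2 x4] := (specializes_apex x).1 sx.
  apply: filterS (filterI (near_x _ e0) (filterI (near_x _ x00)
    (filterI (near_x _ x2) (near_x _ x4)))) => u /= [ue [u0 [u2 u4]]] qu hu.
  have pos (k : 'I_5) : `|ofH (absH u) 0 k - \val x 0 k| < \val x 0 k -> 0 < ofH (absH u) 0 k.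
    by rewrite ltr_norml => /andP[]; rewrite ltrBrDr addNr.
  have cu := is_cell_absH hu (pos _ (u0 0)) (pos _ (u2 2)) (pos _ (u4 4)).
  by have [su Wu] := He (mk_cell cu) ue; exists cu.
have ng : nbhs v' [set u | forall ab, good ab u] by exact: filter_forall ngood.
rewrite /interior; apply: filterS ng => u gu.
have [hu|nhu] := pselect (hplane u); last by right.
left; have [a [b qab]] := mem_quadrant u.
have [cu su Wu] := gu (a, b) qab hu.
exists (cell_map (s * swaps_perm a b)%g (mk_cell cu)) => //=.
rewrite chart_fun_atE //; last exact: swaps_perm_fixes.
have [c1 c3 ct] := ofH_coords (absH u).
rewrite /chart_value !swaps_perm_flips val_mk_cell c1 c3 ct /absH !row3E [RHS]row3P.
have [q1 q2] := qab.
have sT := @scaleT_gt0 R.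
by congr row3; rewrite ?[scaleT * _]mulrC ?[scaleS * _]mulrC ?divfK ?gt_eqF // sgnb_norm.
Qed.

Lemma star_atlas_covers z : exists2 phi, @star_atlas R phi & chart_dom phi z.
Proof.
have [s [x <-]] := cell_map_surj z; have cex := cell_is_cell x.
have [_ _ x0] := cex; have nz k := @no_adjacent_zeros _ (\val x) k cex.
(* A rotation by [a] brings three noncollapsed sides to [0], [2] and [4], those that remain at
   [apex]. *)
have [a [h0 h2 h4]] : exists a, [/\ \val x 0 a != 0, \val x 0 (a + 2) != 0 &
    \val x 0 (a + 4) != 0].
  have nz2 (k j : 'I_5) : val j = val (k + 1) -> \val x 0 k = 0 -> \val x 0 j != 0.
    by move=> /val_inj -> /nz; rewrite lt_def => /andP[].
  have pick (a b c : 'I_5) : val b = val (a + 2) -> val c = val (a + 4) ->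
      \val x 0 a != 0 -> \val x 0 b != 0 -> \val x 0 c != 0 ->
      exists a, [/\ \val x 0 a != 0, \val x 0 (a + 2) != 0 & \val x 0 (a + 4) != 0].
    by move=> /val_inj -> /val_inj -> ? ? ?; exists a.
  have n01 := nz2 0 1 erefl; have n12 := nz2 1 2 erefl; have n23 := nz2 2 3 erefl.
  have n34 := nz2 3 4 erefl; have n40 := nz2 4 0 erefl.
  have [e0|x00] := eqVneq (\val x 0 0) 0.
    have x1 := n01 e0; have x4 : \val x 0 4 != 0 by apply: contra_eq_neq e0 => /n40.
    have [e2|x2] := eqVneq (\val x 0 2) 0.
      by apply: (@pick 4 1 3) => //; exact: n23.
    by apply: (@pick 2 4 1).
  have [e1|x1] := eqVneq (\val x 0 1) 0.
    have x2 := n12 e1; have [e3|x3] := eqVneq (\val x 0 3) 0.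
      by apply: (@pick 0 2 4) => //; exact: n34.
    by apply: (@pick 3 0 2).
  have [e3|x3] := eqVneq (\val x 0 3) 0.
    have x4 := n34 e3; have x2 : \val x 0 2 != 0 by apply: contra_eq_neq e3 => /n23.
    by apply: (@pick 2 4 1).
  have [e4|x4] := eqVneq (\val x 0 4) 0.
    by apply: (@pick 1 3 0).
  by apply: (@pick 4 1 3).
pose g : dih := (false, a).
exists (star_chart R (s * dperm (dinv g))%g); first by exists (s * dperm (dinv g))%g.
apply/star_chart_dom; exists g; split; last by rewrite -mulgA mulVg fixes1.
have pos k : \val x 0 k != 0 -> 0 < \val x 0 k by rewrite lt_def x0 => ->.
by apply/specializes_apex; rewrite /= !mxE /dside /= addr0; split; apply: pos.
Qed.

Lemma star_charts_compatible s s' :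
  compatible_charts (star_chart R s) (star_chart R s').
Proof.
move=> z [x [w [sx fw ->]]] /star_chart_dom[g [sx' fv]].
have sub := specializes_fixes sx; have sub' := specializes_fixes sx'.
have fM (u v : 'S_5) : u \in fixes (apex R) -> v \in fixes (apex R) -> (u * v)%g \in fixes (apex R).
  by move=> /fixesP Hu /fixesP Hv; apply/fixesP => k; rewrite permM Hv Hu.
exists (star (fixes x) (s * w)%g (specializes x)).
  by apply: star_nbhs; exact: specializes_near.
set d := dperm (dinv g) in fv *; set v := (s'^-1 * (s * w) * d)%g in fv *.
(* The point written with [w * u] in the first chart is written with [v] times a conjugate of [u] in
   the second, after the symmetry [g]. *)
have main y u : specializes x y -> u \in fixes x -> exists u' : 'S_5,
    [/\ (w * u)%g \in fixes (apex R), u' \in fixes (apex R),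
     (s' * u')%g = (s * (w * u) * d)%g,
     chart_fun (star_chart R s) (cell_map (s * w * u)%g y) = chart_value y (w * u)%g &
     chart_fun (star_chart R s') (cell_map (s * w * u)%g y) = chart_value (dactc y g) u'].
  move=> xy fu; exists (v * (d^-1 * u * d))%g.
  have fwu : (w * u)%g \in fixes (apex R) by apply: fM => //; exact: fintype.subsetP sub _ fu.
  have fu' : (v * (d^-1 * u * d))%g \in fixes (apex R).
    by apply: fM => //; apply: (fintype.subsetP sub'); exact: fixes_conj.
  have E : (s' * (v * (d^-1 * u * d)) = s * (w * u) * d)%g.
    by rewrite /v -!mulgA mulKVg mulKVg.
  split=> //.
    by rewrite /= -mulgA chart_fun_atE //; exact: specializes_trans sx xy.
  rewrite /= (cell_map_dinv _ y g) -/d -[(s * w * u)%g]mulgA -E chart_fun_atE //.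
  exact: specializes_trans sx' (@specializes_dactc _ _ g xy).
move=> y1 y2 [a1 [u1 [xa1 fu1 ->]]] [a2 [u2 [xa2 fu2 ->]]] _.
have [u1' [f1 f1' E1 -> ->]] := main a1 u1 xa1 fu1.
have [u2' [f2 f2' E2 -> ->]] := main a2 u2 xa2 fu2.
rewrite /hdist -(unfolded_form_chart s a1 a2 f1 f2).
by rewrite -(unfolded_form_chart s' (dactc a1 g) (dactc a2 g) f1' f2') E1 E2 unfolded_form_dihedral.
Qed.

Lemma star_atlas_surface : hyperbolic_surface (@star_atlas R).
Proof.
split.
- by split; [exact: moduli_hausdorff|exact: moduli_second_countable].
- by move=> _ [s _ <-]; exact: hyperbolic_star_chart.
- exact: star_atlas_covers.
- by move=> _ _ [s _ <-] [s' _ <-]; exact: star_charts_compatible.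
Qed.

Lemma star_atlas_induced : induced_structure (@star_atlas R).
Proof.
move=> s _ x [t _ <-] _ /star_chart_dom[g [sx fw]].
exists (specializes x); first exact: specializes_near.
move=> y y' xy _ xy' _.
have sy := specializes_trans sx (@specializes_dactc _ _ g xy).
have sy' := specializes_trans sx (@specializes_dactc _ _ g xy').
split; try by apply/star_chart_dom; exists g.
rewrite !(star_chart_value (g := g)) // /hdist chart_value_form // !addbb !mul0r addr0 mulr0 addr0.
rewrite /lorentz_dist area_formE; try exact: cell_closes_up.
by rewrite dact_gram //; exact: cell_closes_up.
Qed.

End Surface.

(** * Cell structure *)

Section Parametrizations.
Variable R : realType.
Implicit Types (x y : 'rV[R]_5).

Lemma gram_gt0 x : closes_up x -> (forall k, 0 <= x 0 k) -> x != 0 -> 0 < gram x x.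
Proof.
move=> cx x0 xn0; have /closes_upP[e0 e4] := cx.
have p0 := @psi_gt0 R; have s0 := @sn_gt0 R; have p2 := @psi2 R.
have e2 : x 0 2 = tcoord x - (1 + psi) * (x 0 1 + x 0 3) by rewrite /tcoord; ring.
have t0 : 0 < tcoord x.
  rewrite lt_def; apply/andP; split; last by rewrite /tcoord addr_ge0 ?mulr_ge0 ?addr_ge0 // ltW.
  apply: contra_neq xn0 => t0; have := x0 0; have := x0 4; have := x0 1; have := x0 3.
  rewrite e0 e4 t0 mulr0 !sub0r => h3 h1 h4 h0.
  have x3 : x 0 3 = 0 by nra.
  have x1 : x 0 1 = 0 by nra.
  apply/rowP; apply: (ord5P (P := fun k => x 0 k = (0 : 'rV[R]_5) 0 k)); rewrite mxE //.
  - by rewrite e0 t0 x1 !mulr0 subr0.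
  - by rewrite e2 t0 x1 x3 addr0 mulr0 subr0.
  - by rewrite e4 t0 x3 !mulr0 subr0.
(* A sum of products of lengths. It vanishes only if [x 0 2 = 0] and one side in each of the pairs
   [0, 1] and [3, 4] vanishes; all these cases contradict closing up. *)
have -> : gram x x = sn / 2 * (psi ^+ 2 * (tcoord x * x 0 2) + x 0 1 * x 0 0 + x 0 3 * x 0 4).
  by rewrite /gram e0 e4 e2; ring: p2.
rewrite mulr_gt0 ?divr_gt0 // lt_def.
have a1 : 0 <= x 0 1 * x 0 0 by exact: mulr_ge0.
have a3 : 0 <= x 0 3 * x 0 4 by exact: mulr_ge0.
have a2 : 0 <= psi ^+ 2 * (tcoord x * x 0 2).
  by apply: mulr_ge0; [exact: sqr_ge0|apply: mulr_ge0 => //; exact: ltW].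
apply/andP; split; last by rewrite !addr_ge0.
apply/eqP => s; have {s a1 a2 a3} [h2 h1 h3] : [/\ psi ^+ 2 * (tcoord x * x 0 2) = 0,
    x 0 1 * x 0 0 = 0 & x 0 3 * x 0 4 = 0] by split; lra.
have x2 : x 0 2 = 0.
  apply: (mulfI (lt0r_neq0 t0)); apply: (mulfI (lt0r_neq0 (exprn_gt0 2 p0))).
  by rewrite h2 !mulr0.
move: (tcoord x) (x 0 1) (x 0 3) (x 0 0) (x 0 4) (x0 0) (x0 4) (x0 1) (x0 3) e0 e4 e2 h1 h3 t0.
rewrite x2 => t a b y0 y4 y00 y40 a0 b0 E0 E4 E2 h1 h3 t0.
have /andP[p35 p23] := @psi_bounds R.
have [az|/eqP az] := eqVneq a 0.
  have tb : t = (1 + psi) * b by rewrite az in E2; lra.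
  have : y4 = (psi - 1) * ((1 + psi) * b) by rewrite E4 tb; ring.
  have : 0 < (1 + psi) * b by rewrite -tb.
  by move=> *; nra.
have [bz|/eqP bz] := eqVneq b 0.
  have ta : t = (1 + psi) * a by rewrite bz in E2; lra.
  have : y0 = (psi - 1) * ((1 + psi) * a) by rewrite E0 ta; ring.
  have : 0 < (1 + psi) * a by rewrite -ta.
  by move=> *; nra.
have y0z : y0 = 0 by move/eqP: h1; rewrite mulf_eq0 => /orP[/eqP|/eqP].
have y4z : y4 = 0 by move/eqP: h3; rewrite mulf_eq0 => /orP[/eqP|/eqP].
have : (1 - 2 * psi) * t = 0 by lra.
by move/eqP; rewrite mulf_eq0 (gt_eqF t0) orbF => /eqP; lra.
Qed.

Definition norm1 x := (Num.sqrt (gram x x))^-1 *: x.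

Lemma gramZ (r : R) x : gram (r *: x) (r *: x) = r ^+ 2 * gram x x.
Proof. by rewrite /gram /tcoord !mxE; ring. Qed.

Lemma is_cell_norm1 x : closes_up x -> (forall k, 0 <= x 0 k) -> x != 0 ->
  is_cell (norm1 x).
Proof.
move=> cx x0 xn0; have g0 := gram_gt0 cx x0 xn0.
split; first exact: closes_upZ.
  by rewrite gramZ exprVn sqr_sqrtr ?mulVf ?gt_eqF // ltW.
by move=> k; rewrite mxE mulr_ge0 // invr_ge0 sqrtr_ge0.
Qed.

Lemma norm1_eq0 x k : 0 < gram x x -> (norm1 x 0 k == 0) = (x 0 k == 0).
Proof.
by move=> g0; rewrite mxE mulf_eq0 invr_eq0 gt_eqF // sqrtr_gt0.
Qed.

Lemma norm1Z (r : R) x : 0 < r -> norm1 (r *: x) = norm1 x.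
Proof.
move=> r0; rewrite /norm1 gramZ sqrtrM ?sqr_ge0 // sqrtr_sqr gtr0_norm //.
by rewrite scalerA invfM mulrAC mulVf ?mul1r // gt_eqF.
Qed.

Lemma norm1_cell x : is_cell x -> norm1 x = x.
Proof. by move=> [_ gx _]; rewrite /norm1 gx sqrtr1 invr1 scale1r. Qed.

(** Characteristic maps and tile maps are total functions, so points off the cell receive the
    arbitrary value [apex]. *)
Definition cellify x : cell R 5 :=
  match pselect (is_cell x) with left h => mk_cell h | right _ => apex R end.

Lemma cellifyE x : is_cell x -> \val (cellify x) = x.
Proof. by move=> cex; rewrite /cellify; case: pselect. Qed.

Lemma cellifyK (y : cell R 5) : cellify (\val y) = y.
Proof. by apply: val_inj; rewrite cellifyE //; exact: cell_is_cell. Qed.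

(** The segment of closed pentagons with [x 0 1 = 0] and [tcoord = 1]. At [r = -1] the side [3]
    vanishes, at [r = 1] the side [4]; the latter means [x 0 3 = psi / (1 + psi) = psi ^+ 2]. *)
Definition side_pt (r : R) : 'rV[R]_5 := \row_(k < 5)
  nth 0 [:: psi; 0; 1 - psi * ((1 + r) / 2); psi ^+ 2 * ((1 + r) / 2);
            psi * ((1 - r) / 2)] k.

Lemma side_ptE (r : R) : (side_pt r 0 0 = psi) * (side_pt r 0 1 = 0) *
  (side_pt r 0 2 = 1 - psi * ((1 + r) / 2)) * (side_pt r 0 3 = psi ^+ 2 * ((1 + r) / 2)) *
  (side_pt r 0 4 = psi * ((1 - r) / 2)).
Proof. by rewrite !mxE. Qed.

Lemma side_pt_closes_up r : closes_up (side_pt r).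
Proof.
have p2 := @psi2 R.
by apply/closes_upP; rewrite /tcoord !side_ptE; split; field: p2.
Qed.

Lemma side_pt_tcoord r : tcoord (side_pt r) = 1.
Proof. by have p2 := @psi2 R; rewrite /tcoord !side_ptE; field: p2. Qed.

Lemma side_pt2_gt0 r : r <= 1 -> 0 < side_pt r 0 2.
Proof. by have /andP[_ p23] := @psi_bounds R; have p0 := @psi_gt0 R; rewrite side_ptE => *; nra. Qed.

Lemma side_pt_neq0 r : side_pt r != 0.
Proof.
apply: contra_neq (lt0r_neq0 (@psi_gt0 R)) => e.
by rewrite -(side_ptE r).1.1.1.1 e mxE.
Qed.

Lemma side_pt_ge0 r : -1 <= r <= 1 -> forall k, 0 <= side_pt r 0 k.
Proof.
move=> /andP[r0 r1]; have p0 := @psi_gt0 R.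
apply: (ord5P (P := fun k => 0 <= side_pt r 0 k)); last first.
- by rewrite side_ptE mulr_ge0 ?divr_ge0 ?subr_ge0 // ltW.
- by rewrite side_ptE mulr_ge0 ?sqr_ge0 ?divr_ge0 //; lra.
- exact/ltW/side_pt2_gt0.
- by rewrite side_ptE.
- by rewrite side_ptE ltW.
Qed.

Lemma side_pt_gram r : -1 <= r <= 1 -> 0 < gram (side_pt r) (side_pt r).
Proof.
by move=> r1; apply: gram_gt0; [exact: side_pt_closes_up|exact: side_pt_ge0|exact: side_pt_neq0].
Qed.

Lemma is_cell_side_pt r : -1 <= r <= 1 -> is_cell (norm1 (side_pt r)).
Proof.
by move=> r1; apply: is_cell_norm1; [exact: side_pt_closes_up|exact: side_pt_ge0|exact: side_pt_neq0].
Qed.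

Lemma side_pt_inj r r' : -1 <= r <= 1 -> -1 <= r' <= 1 ->
  norm1 (side_pt r) = norm1 (side_pt r') -> r = r'.
Proof.
move=> r1 r1'; have g := side_pt_gram r1; have g' := side_pt_gram r1'.
rewrite /norm1; set c := _^-1; set c' := _^-1 => E.
have tE (d : R) x : tcoord (d *: x) = d * tcoord x by rewrite /tcoord !mxE; ring.
have ZE (d : R) x : (d *: x) 0 4 = d * x 0 4 by rewrite mxE.
have cc : c = c'.
  by have := congr1 (@tcoord R) E; rewrite !tE !side_pt_tcoord !mulr1.
have := congr1 (fun x : 'rV[R]_5 => x 0 4) E.
have c0 : c' != 0 by rewrite invr_eq0 gt_eqF // sqrtr_gt0.
have p0 := lt0r_neq0 (@psi_gt0 R).
rewrite /= ZE ZE cc => /(mulfI c0); rewrite !side_ptE => /(mulfI p0); lra.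
Qed.

Lemma side_pt_surj x : is_cell x -> x 0 1 = 0 -> 0 < x 0 3 -> 0 < x 0 4 ->
  exists2 r, -1 < r < 1 & norm1 (side_pt r) = x.
Proof.
move=> cex x1 x3 x4; have [cx _ x0] := cex; have t0 := is_cell_tcoord cex.
have p0 := @psi_gt0 R; have p2 := @psi2 R; have pn := lt0r_neq0 p0; have tn := lt0r_neq0 t0.
have /closes_upP[e0 e4] := cx.
pose r := 2 * x 0 3 / (psi ^+ 2 * tcoord x) - 1.
have xE : x = tcoord x *: side_pt r.
  have e2 : x 0 2 = tcoord x - (1 + psi) * (x 0 1 + x 0 3) by rewrite /tcoord; ring.
  have pp : psi * (1 + psi) = 1 :> R by ring: p2.
  have rr : psi * ((1 + r) / 2) = x 0 3 / (psi * tcoord x).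
    by rewrite /r; field; rewrite pn tn.
  have iv : psi^-1 = 1 + psi :> R by apply: (mulfI pn); rewrite mulfV // pp.
  apply/rowP; apply: (ord5P (P := fun k => x 0 k = (tcoord x *: side_pt r) 0 k));
    rewrite [RHS]mxE side_ptE.
  - by rewrite e0 x1 mulr0 subr0 mulrC.
  - by rewrite x1 mulr0.
  - by rewrite rr invfM iv e2 x1 add0r; field.
  - by rewrite expr2 -mulrA rr; field; rewrite pn tn.
  - have -> : psi * ((1 - r) / 2) = psi - psi * ((1 + r) / 2) by field.
    by rewrite rr invfM iv e4; field.
exists r; last by rewrite -[RHS](norm1_cell cex) [in RHS]xE norm1Z.
apply/andP; split.
  have pq : 0 < psi ^+ 2 * tcoord x by apply: mulr_gt0 => //; exact: exprn_gt0.
  have : 0 < 2 * x 0 3 / (psi ^+ 2 * tcoord x) by rewrite divr_gt0 // mulr_gt0.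
  by rewrite /r; lra.
have : 0 < side_pt r 0 4.
  by have := x4; rewrite xE mxE pmulr_rgt0.
by rewrite side_ptE pmulr_rgt0 // pmulr_lgt0 ?invr_gt0 // subr_gt0.
Qed.

End Parametrizations.

(** * The cell as a disk *)

Section Disk.
Variable R : realType.
Implicit Types (u v : 'rV[R]_2) (x : 'rV[R]_5).

(** Closed pentagons of perimeter 0, parametrized by their sides [1] and [3]: the deformations of
    the regular pentagon with constant perimeter. *)
Definition zero_sum u : 'rV[R]_5 := \row_(k < 5)
  nth 0 [:: psi * u 0 1 - u 0 0; u 0 0; - psi * (u 0 0 + u 0 1); u 0 1;
            psi * u 0 0 - u 0 1] k.

Lemma zero_sumE u : (zero_sum u 0 0 = psi * u 0 1 - u 0 0) * (zero_sum u 0 1 = u 0 0) *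
  (zero_sum u 0 2 = - psi * (u 0 0 + u 0 1)) * (zero_sum u 0 3 = u 0 1) *
  (zero_sum u 0 4 = psi * u 0 0 - u 0 1).
Proof. by rewrite !mxE. Qed.

Lemma zero_sum_closes_up u : closes_up (zero_sum u).
Proof.
by have p2 := @psi2 R; apply/closes_upP; rewrite /tcoord !zero_sumE; split; ring: p2.
Qed.

Lemma sum_zero_sum u : \sum_k zero_sum u 0 k = 0.
Proof. by rewrite sum5 !zero_sumE; ring. Qed.

Lemma zero_sumP x : closes_up x -> \sum_k x 0 k = 0 ->
  exists2 u, x = zero_sum u & u = \row_(i < 2) x 0 (if i == 0 then 1 else 3).
Proof.
move=> cx; rewrite sum5 => s0; eexists; last reflexivity.
have p2 := @psi2 R; have p0 := @psi_gt0 R.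
have /closes_upP[] := cx; rewrite /tcoord => e0 e4.
have t : (1 + 2 * psi) * (x 0 2 + psi * (x 0 1 + x 0 3)) = 0.
  rewrite -[RHS]s0 e0 e4; ring: p2.
have e2 : x 0 2 = - psi * (x 0 1 + x 0 3).
  by move/eqP: t; rewrite mulf_eq0 => /orP[/eqP|/eqP]; lra.
apply/rowP; apply: (ord5P (P := fun k => x 0 k = zero_sum _ 0 k)); rewrite zero_sumE !mxE //=.
- by rewrite e0 e2; ring: p2.
- by rewrite e4 e2; ring: p2.
Qed.

Lemma zero_sumZ (r : R) u : zero_sum (r *: u) = r *: zero_sum u.
Proof. by apply/rowP; apply: (ord5P (P := fun k => zero_sum (r *: u) 0 k = (r *: zero_sum u) 0 k));
  rewrite [RHS]mxE !zero_sumE !mxE; ring. Qed.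

(** The Minkowski functional of the pentagon where all entries of [zero_sum u] are at least [-1]. *)
Definition gauge u : R :=
  Num.max (- zero_sum u 0 0) (Num.max (- zero_sum u 0 1) (Num.max (- zero_sum u 0 2)
    (Num.max (- zero_sum u 0 3) (- zero_sum u 0 4)))).

Lemma gauge_ge u k : - zero_sum u 0 k <= gauge u.
Proof. by rewrite /gauge; move: k; apply: ord5P; rewrite !le_max lexx ?orbT. Qed.

Lemma gauge_attained u : exists k, gauge u = - zero_sum u 0 k.
Proof.
rewrite /gauge; do 4 (case: leP => _; last by eexists).
by eexists.
Qed.

Lemma gaugeZ (r : R) u : 0 <= r -> gauge (r *: u) = r * gauge u.
Proof.
move=> r0; have lZ k : - zero_sum (r *: u) 0 k = r * - zero_sum u 0 k by rewrite zero_sumZ mxE mulrN.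
apply/le_anti/andP; split.
  by have [k ->] := gauge_attained (r *: u); rewrite lZ ler_wpM2l // gauge_ge.
by have [k ->] := gauge_attained u; rewrite -lZ gauge_ge.
Qed.

(** The gauge bounds entries from below only; the upper bound holds because each entry is minus the
    sum of the other four. *)
Lemma zero_sum_le u k : `|zero_sum u 0 k| <= 4 * gauge u.
Proof.
have g0 := gauge_ge u 0; have g1 := gauge_ge u 1; have g2 := gauge_ge u 2.
have g3 := gauge_ge u 3; have g4 := gauge_ge u 4.
have := sum_zero_sum u; rewrite sum5 ler_norml => s.
by move: k; apply: ord5P; apply/andP; split; lra.
Qed.

Lemma gauge_gt0 u : u != 0 -> 0 < gauge u.
Proof.
move=> un0; rewrite ltNge; apply: contra_neqN un0 => g0.
have l0 k : zero_sum u 0 k = 0.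
  apply/eqP; rewrite -normr_le0; apply: le_trans (zero_sum_le u k) _; lra.
apply/rowP => -[[|[|//]] i]; rewrite mxE.
- by rewrite -[RHS](l0 1) zero_sumE; congr (u 0 _); exact: val_inj.
- by rewrite -[RHS](l0 3) zero_sumE; congr (u 0 _); exact: val_inj.
Qed.

Definition len n (u : 'rV[R]_n) : R := Num.sqrt (sqnorm u).

Lemma sqnorm_ge0 n (u : 'rV[R]_n) : 0 <= sqnorm u.
Proof. by apply: sumr_ge0 => i _; exact: sqr_ge0. Qed.

Lemma len_ge0 n (u : 'rV[R]_n) : 0 <= len u.
Proof. exact: sqrtr_ge0. Qed.

Lemma lenZ n (r : R) (u : 'rV[R]_n) : 0 <= r -> len (r *: u) = r * len u.
Proof.
move=> r0; rewrite /len (_ : sqnorm _ = r ^+ 2 * sqnorm u).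
  by rewrite sqrtrM ?sqr_ge0 // sqrtr_sqr ger0_norm.
by rewrite /sqnorm mulr_sumr; apply: eq_bigr => i _; rewrite mxE exprMn.
Qed.

Lemma len_eq0 n (u : 'rV[R]_n) : (len u == 0) = (u == 0).
Proof.
rewrite sqrtr_eq0; apply/idP/eqP => [u0|->]; last first.
  by rewrite /sqnorm big1 // => i _; rewrite mxE expr0n.
have {}u0 : sqnorm u = 0 by apply/le_anti; rewrite u0 sqnorm_ge0.
move/eqP: u0; rewrite psumr_eq0 => [/allP H|i _]; last exact: sqr_ge0.
apply/rowP => i; rewrite mxE; apply/eqP; rewrite -sqrf_eq0.
by apply: (implyP (H i _)); rewrite ?mem_index_enum.
Qed.

Lemma sqnorm_le1 n (u : 'rV[R]_n) : (sqnorm u <= 1) = (len u <= 1).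
Proof. by rewrite -[X in _ = (_ <= X)]sqrtr1 ler_sqrt. Qed.

Lemma sqnorm_lt1 n (u : 'rV[R]_n) : (sqnorm u < 1) = (len u < 1).
Proof. by rewrite -[X in _ = (_ < X)]sqrtr1 ltr_sqrt. Qed.

(* The closed disk is mapped onto the pentagon [zero_sum u >= -1] along the rays
   from its center; at [u = 0] the quotient [0 / 0] is [0]. *)
Definition disk_pt u : 'rV[R]_5 := const_mx 1 + (len u / gauge u) *: zero_sum u.

Lemma disk_ptE u k : disk_pt u 0 k = 1 + len u / gauge u * zero_sum u 0 k.
Proof. by rewrite !mxE. Qed.

Lemma disk_pt_closes_up u : closes_up (disk_pt u).
Proof. by apply: closes_upD; [exact: closes_up1|apply: closes_upZ; exact: zero_sum_closes_up]. Qed.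

Lemma disk_pt_sum u : \sum_k disk_pt u 0 k = 5.
Proof.
rewrite (eq_bigr (fun k => 1 + len u / gauge u * zero_sum u 0 k)) => [|k _]; last exact: disk_ptE.
rewrite big_split /= -mulr_sumr sum_zero_sum mulr0 addr0.
by rewrite sumr_const card_ord.
Qed.

(** Together with [disk_pt_attained]: the shortest side is [1 - len u], so the polygon determines
    [len u], and for [len u <= 1] a side collapses only on the unit circle. *)
Lemma disk_pt_ge u k : 1 - len u <= disk_pt u 0 k.
Proof.
rewrite disk_ptE lerD2l; have [->|/gauge_gt0 g] := eqVneq u 0.
  have /eqP -> : len (0 : 'rV[R]_2) == 0 by rewrite len_eq0.
  by rewrite mul0r mul0r oppr0.
rewrite -mulrN1 -mulrA ler_wpM2l ?len_ge0 // ler_pdivlMl // mulrN1.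
by rewrite lerNl gauge_ge.
Qed.

Lemma disk_pt_attained u : exists k, disk_pt u 0 k = 1 - len u.
Proof.
have [->|/gauge_gt0 g] := eqVneq u 0.
  have /eqP l0 : len (0 : 'rV[R]_2) == 0 by rewrite len_eq0.
  by exists 0; rewrite disk_ptE l0 mul0r mul0r addr0 subr0.
have [k gk] := gauge_attained u; exists k; rewrite disk_ptE.
by rewrite (_ : zero_sum u 0 k = - gauge u) ?mulrN ?divfK ?gt_eqF // gk opprK.
Qed.

Lemma disk_pt_ge0 u : len u <= 1 -> forall k, 0 <= disk_pt u 0 k.
Proof. by move=> u1 k; apply: le_trans (disk_pt_ge u k); rewrite subr_ge0. Qed.

Lemma disk_pt_neq0 u : disk_pt u != 0.
Proof.
have f0 : (5 : R) != 0 by rewrite pnatr_eq0.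
apply: contra_neq f0 => e; rewrite -(disk_pt_sum u) e.
by rewrite big1 // => k _; rewrite mxE.
Qed.

Lemma disk_pt_gram u : len u <= 1 -> 0 < gram (disk_pt u) (disk_pt u).
Proof.
move=> u1; apply: gram_gt0; [exact: disk_pt_closes_up|exact: disk_pt_ge0|exact: disk_pt_neq0].
Qed.

Lemma is_cell_disk_pt u : len u <= 1 -> is_cell (norm1 (disk_pt u)).
Proof.
move=> u1; apply: is_cell_norm1; [exact: disk_pt_closes_up|exact: disk_pt_ge0|exact: disk_pt_neq0].
Qed.

Lemma disk_pt_inj u v : len u <= 1 -> len v <= 1 ->
  norm1 (disk_pt u) = norm1 (disk_pt v) -> u = v.
Proof.
move=> u1 v1; have g := disk_pt_gram u1; have g' := disk_pt_gram v1.
rewrite /norm1; set c := _^-1; set c' := _^-1 => E.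
(* Both pentagons have perimeter 5 before normalization, so the two scale factors are equal. *)
have cc : c = c'.
  have f0 : (5 : R) != 0 by rewrite pnatr_eq0.
  apply: (mulIf f0); rewrite -{1}(disk_pt_sum u) -(disk_pt_sum v) !mulr_sumr.
  by apply: eq_bigr => k _; have := congr1 (fun x : 'rV[R]_5 => x 0 k) E; rewrite !mxE.
have c0 : c' != 0 by rewrite invr_eq0 gt_eqF // sqrtr_gt0.
rewrite cc in E; have {E c0 g g' cc c c'} E := scalerI c0 E.
have L : len u = len v.
  apply: le_anti; apply/andP; split.
    by have [k ek] := disk_pt_attained u; have := disk_pt_ge v k; rewrite -E ek; lra.
  by have [k ek] := disk_pt_attained v; have := disk_pt_ge u k; rewrite E ek; lra.
have [u0|un0] := eqVneq u 0.
  have /eqP l0 : len v == 0 by rewrite -L len_eq0 u0.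
  by move/eqP: l0; rewrite len_eq0 u0 => /eqP.
have vn0 : v != 0 by rewrite -len_eq0 -L len_eq0.
have gu := lt0r_neq0 (gauge_gt0 un0); have gv := lt0r_neq0 (gauge_gt0 vn0).
have l0 : len u != 0 by rewrite len_eq0.
have {E} E : (gauge u)^-1 *: u = (gauge v)^-1 *: v.
  have e k : (gauge u)^-1 * zero_sum u 0 k = (gauge v)^-1 * zero_sum v 0 k.
    have := congr1 (fun x : 'rV[R]_5 => x 0 k) E; rewrite /= !disk_ptE -L => /addrI.
    by rewrite -!mulrA => /(mulfI l0).
  apply/rowP => -[[|[|//]] i]; rewrite !mxE.
    by rewrite (_ : Ordinal i = 0) -?(zero_sumE _).1.1.1.2 ?e //; exact: val_inj.
  by rewrite (_ : Ordinal i = 1) -?(zero_sumE _).1.2 ?e //; exact: val_inj.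
have gg : gauge u = gauge v.
  have := congr1 (@len 2) E; rewrite !lenZ ?invr_ge0 ?ltW ?gauge_gt0 // -L => /(mulIf l0).
  exact: invr_inj.
by move: E; rewrite gg; apply: scalerI; rewrite invr_eq0.
Qed.

Lemma disk_pt_surj x : is_cell x -> (forall k, 0 < x 0 k) ->
  exists2 u, len u < 1 & norm1 (disk_pt u) = x.
Proof.
move=> cex x0; have [cx _ _] := cex.
pose s := (\sum_k x 0 k) / 5; have s0 : 0 < s by rewrite divr_gt0 ?is_cell_sum.
have five : (5 : R) != 0 by rewrite pnatr_eq0.
pose y := s^-1 *: x - const_mx 1.
have cy : closes_up y.
  rewrite /y -scaleN1r; apply: closes_upD; apply: closes_upZ => //; exact: closes_up1.
have sy : \sum_k y 0 k = 0.
  rewrite (eq_bigr (fun k => s^-1 * x 0 k - 1)) => [|k _]; last by rewrite !mxE.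
  rewrite sumrB -mulr_sumr sumr_const card_ord.
  have -> : \sum_k x 0 k = s * 5 by rewrite divfK.
  by rewrite mulrA mulVf ?gt_eqF // mul1r subrr.
have [v yv _] := zero_sumP cy sy.
have xE : x = s *: (const_mx 1 + zero_sum v).
  by rewrite -yv /y addrC subrK scalerA mulfV ?scale1r // gt_eqF.
have x1 k : - zero_sum v 0 k < 1.
  by rewrite -yv !mxE opprB ltrBlDr ltrDl mulr_gt0 // invr_gt0.
have [v0|vn0] := eqVneq v 0.
  exists 0; first by have /eqP -> : len (0 : 'rV[R]_2) == 0 by rewrite len_eq0.
  have l0 : zero_sum 0 = 0.
    by have := zero_sumZ 0 0; rewrite scaler0 scale0r.
  have xs : x = s *: disk_pt 0 by rewrite xE v0 /disk_pt l0 scaler0.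
  by rewrite -[RHS](norm1_cell cex) [in RHS]xs norm1Z.
have gv := gauge_gt0 vn0.
have lv : 0 < len v by rewrite lt_def len_eq0 vn0 len_ge0.
have r0 : 0 < gauge v / len v by rewrite divr_gt0.
have [gn ln] := (lt0r_neq0 gv, lt0r_neq0 lv).
(* The point on the ray of [v] whose length is [gauge v], which is less than 1 because all sides of
   [x] are positive. *)
exists ((gauge v / len v) *: v).
  rewrite lenZ ?ltW // divfK //.
  by have [k ->] := gauge_attained v.
have xs : x = s *: disk_pt ((gauge v / len v) *: v).
  rewrite xE /disk_pt zero_sumZ gaugeZ ?ltW // lenZ ?ltW // scalerA.
  by rewrite (_ : _ * _ = 1) ?scale1r //; field; rewrite gn ln.
by rewrite -[RHS](norm1_cell cex) [in RHS]xs norm1Z.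
Qed.

End Disk.

(** * Continuity of the parametrizations *)

Section Continuity.
Variable R : realType.

Lemma is_cell_continuous n (A : set 'rV[R]_n) (g : 'rV[R]_n -> 'rV[R]_5) :
  continuous g -> (forall u, A u -> 0 < gram (g u) (g u)) ->
  (forall u, A u -> is_cell (norm1 (g u))) ->
  {within A, continuous (fun u => cellify (norm1 (g u)))}.
Proof.
move=> cg g0 cex.
have cgk k : continuous (fun u => g u 0 k).
  by move=> u; apply: (@continuous_comp _ _ _ g (fun v : 'rV[R]_5 => v 0 k));
    [exact: cg|exact: coord_continuous].
have cM (f h : 'rV[R]_n -> R) : continuous f -> continuous h -> continuous (fun u => f u * h u).
  by move=> cf ch u; apply: continuousM; [exact: cf|exact: ch].
have cD (f h : 'rV[R]_n -> R) : continuous f -> continuous h -> continuous (fun u => f u + h u).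
  by move=> cf ch u; apply: (@continuousD _ R^o); [exact: cf|exact: ch].
have cB (f h : 'rV[R]_n -> R) : continuous f -> continuous h -> continuous (fun u => f u - h u).
  by move=> cf ch u; apply: (@continuousB _ R^o); [exact: cf|exact: ch].
have cc (r : R) : continuous (fun _ : 'rV[R]_n => r) by exact: cst_continuous.
have cgram : continuous (fun u => gram (g u) (g u)).
  rewrite /gram /tcoord; apply: (cM) => //; apply: (cB); apply: (cM) => //.
    by apply: (cM); apply: (cD) => //; apply: (cM) => //; exact: cD.
  by apply: (cD); apply: (cM).
apply: cell_continuous => k.
apply: (@subspace_eq_continuous _ A R (fun u => norm1 (g u) 0 k)).
  by move=> u /set_mem Au; rewrite cellifyE //; exact: cex.
apply: continuous_in_subspaceT => u /set_mem Au.
rewrite (_ : (fun u => _) = fun u => (Num.sqrt (gram (g u) (g u)))^-1 * g u 0 k); last first.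
  by apply/funext => v; rewrite mxE.
apply: (@continuousM _ _ (fun u => (Num.sqrt (gram (g u) (g u)))^-1) (fun u => g u 0 k)); last exact: cgk.
apply: continuousV; first by rewrite gt_eqF // sqrtr_gt0; exact: g0.
by apply: continuous_comp; [exact: cgram|exact: sqrt_continuous].
Qed.

Lemma side_pt_continuous : continuous (fun u : 'rV[R]_1 => side_pt (u 0 0)).
Proof.
have cM (f h : 'rV[R]_1 -> R) : continuous f -> continuous h -> continuous (fun u => f u * h u).
  by move=> cf ch u; apply: continuousM; [exact: cf|exact: ch].
have cD (f h : 'rV[R]_1 -> R) : continuous f -> continuous h -> continuous (fun u => f u + h u).
  by move=> cf ch u; apply: (@continuousD _ R^o); [exact: cf|exact: ch].
have cc (r : R) : continuous (fun _ : 'rV[R]_1 => r) by exact: cst_continuous.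
have cu : continuous (fun u : 'rV[R]_1 => u 0 0) by exact: coord_continuous.
have affine (f : 'rV[R]_1 -> R) (a b : R) : (forall u, f u = a + b * u 0 0) -> continuous f.
  by move=> /funext ->; apply: (cD) => //; exact: cM.
apply: rV_continuous.
apply: (ord5P (P := fun k => continuous (fun u : 'rV[R]_1 => side_pt (u 0 0) 0 k))).
- by apply: (affine _ psi 0) => u; rewrite side_ptE mul0r addr0.
- by apply: (affine _ 0 0) => u; rewrite side_ptE mul0r addr0.
- by apply: (affine _ (1 - psi / 2) (- psi / 2)) => u; rewrite side_ptE; field.
- by apply: (affine _ (psi ^+ 2 / 2) (psi ^+ 2 / 2)) => u; rewrite side_ptE; field.
- by apply: (affine _ (psi / 2) (- psi / 2)) => u; rewrite side_ptE; field.
Qed.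

Lemma disk_pt_continuous : continuous (@disk_pt R).
Proof.
have cM (f h : 'rV[R]_2 -> R) : continuous f -> continuous h -> continuous (fun u => f u * h u).
  by move=> cf ch u; apply: continuousM; [exact: cf|exact: ch].
have cD (f h : 'rV[R]_2 -> R) : continuous f -> continuous h -> continuous (fun u => f u + h u).
  by move=> cf ch u; apply: (@continuousD _ R^o); [exact: cf|exact: ch].
have cc (r : R) : continuous (fun _ : 'rV[R]_2 => r) by exact: cst_continuous.
have cu (i : 'I_2) : continuous (fun u : 'rV[R]_2 => u 0 i) by exact: coord_continuous.
have clam k : continuous (fun u : 'rV[R]_2 => zero_sum u 0 k).
  have linear (f : 'rV[R]_2 -> R) (a b : R) : (forall u, f u = a * u 0 0 + b * u 0 1) -> continuous f.
    by move=> /funext ->; apply: (cD); exact: cM.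
  move: k; apply: (ord5P (P := fun k => continuous (fun u : 'rV[R]_2 => zero_sum u 0 k))).
  - by apply: (linear _ (-1) psi) => u; rewrite zero_sumE; ring.
  - by apply: (linear _ 1 0) => u; rewrite zero_sumE; ring.
  - by apply: (linear _ (- psi) (- psi)) => u; rewrite zero_sumE; ring.
  - by apply: (linear _ 0 1) => u; rewrite zero_sumE; ring.
  - by apply: (linear _ psi (-1)) => u; rewrite zero_sumE; ring.
have clN k : continuous (fun u : 'rV[R]_2 => - zero_sum u 0 k).
  by move=> u; apply: (@continuousN _ R^o); exact: clam.
have cmax (f h : 'rV[R]_2 -> R) : continuous f -> continuous h ->
    continuous (fun u => Num.max (f u) (h u)).
  by move=> cf ch u; apply: (@continuous_max R^o); [exact: cf|exact: ch].
have cgauge : continuous (@gauge R) by rewrite /gauge; do 4 (apply: (cmax) => //).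
have clen : continuous (@len R 2).
  move=> u; apply: (@continuous_comp _ _ _ (@sqnorm R 2) Num.sqrt); last exact: sqrt_continuous.
  rewrite (_ : @sqnorm R 2 = fun u => u 0 0 * u 0 0 + u 0 1 * u 0 1); last first.
    apply/funext => v; rewrite /sqnorm big_ord_recr big_ord1 /= !expr2.
    by congr (v 0 _ * v 0 _ + v 0 _ * v 0 _); exact: val_inj.
  by apply: (cD); exact: cM.
move=> u; apply: (@rV_continuous _ _ _ _) => k {}u.
rewrite (_ : (fun u => _) = fun u => 1 + len u / gauge u * zero_sum u 0 k); last first.
  by apply/funext => v; rewrite disk_ptE.
apply: (@continuousD _ R^o _ (cst 1) (fun u => len u / gauge u * zero_sum u 0 k)).
  exact: cst_continuous.
have [->|un0] := eqVneq u 0; last first.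
  apply: continuousM; last exact: clam.
  apply: continuousM; first exact: clen.
  by apply: continuousV; [rewrite gt_eqF // gauge_gt0|exact: cgauge].
have /eqP l0 : len (0 : 'rV[R]_2) == 0 by rewrite len_eq0.
(* At the centre the quotient has no limit to refer to; by [zero_sum_le] the deviation is at most
   [4 * len v]. *)
apply/(@cvgrPdist_lt R R^o _ (nbhs (0 : 'rV[R]_2))) => e e0 /=; rewrite l0 !mul0r.
have /cvgrPdist_lt/(_ (e / 4)) := clen 0; rewrite divr_gt0 // => /(_ isT).
apply: filterS => v; rewrite l0 !sub0r !normrN => lv.
have [->|vn0] := eqVneq v 0; first by rewrite l0 !mul0r normr0.
have gv := gauge_gt0 vn0.
rewrite normrM; apply: le_lt_trans (_ : `|len v / gauge v| * (4 * gauge v) < _).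
  by rewrite ler_wpM2l // zero_sum_le.
rewrite ger0_norm; last by rewrite divr_ge0 ?len_ge0 // ltW.
move: lv; rewrite ger0_norm ?len_ge0 // ltr_pdivlMr // => lv.
suff -> : len v / gauge v * (4 * gauge v) = len v * 4 by [].
by field; rewrite gt_eqF.
Qed.

End Continuity.

(** * Faces of the cell and their stabilizers *)

Section Faces.
Variable R : realType.
Implicit Types (x y : cell R 5) (s t u : 'S_5) (g : dih) (d : nat).

(** One model face in each dimension, with collapsed sides [1] and [3], only [1], or none;
    [face_of_cell] moves any point to one of them. *)
Definition face_zeros d (k : 'I_5) : bool := (d < 2)%N && (k == 1) || (d == 0)%N && (k == 3).

Definition in_face d y := forall k, (\val y 0 k == 0) = face_zeros d k.

Definition face_syms d : {set dih * (bool * bool)} :=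
  [set p | [&& [forall k, face_zeros d (dside p.1 k) == face_zeros d k],
    p.2.1 ==> (d < 2)%N & p.2.2 ==> (d == 0)%N]]%SET.

(** The permutations [s] for which the model face of the copy [s] coincides with that of the copy
    [1]; the two inclusions are [face_setP] and [face_set_act]. *)
Definition face_set d : {set 'S_5} :=
  [set (dperm p.1 * swaps_perm p.2.1 p.2.2)%g | p in face_syms d]%SET.

Lemma in_face_dactc d y g : in_face d y -> in_face d (dactc y g) <->
  forall k, face_zeros d (dside g k) = face_zeros d k.
Proof.
move=> fy; split=> H k; first by rewrite -fy -H mxE.
by rewrite mxE fy H.
Qed.

Lemma in_face_specializes d y : in_face d y -> specializes (apex R) y.
Proof.
move=> fy k /eqP; rewrite fy => /orP[/andP[_ /eqP ->]|/andP[_ /eqP ->]];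
  by rewrite ?apex_zeros.
Qed.

Lemma in_face_fixes d y u : in_face d y -> (u \in fixes y) =
  [&& u == swaps_perm (flip1 u) (flip3 u), flip1 u ==> (d < 2)%N & flip3 u ==> (d == 0)%N].
Proof.
move=> fy; have cex := cell_is_cell y; apply/idP/and3P => [fu|[/eqP -> H1 H3]].
  have /fixes_apexP ua : u \in fixes (apex R).
    by apply: fintype.subsetP fu; apply: specializes_fixes; exact: in_face_specializes fy.
  have /fixesP H := fu; split.
  - by apply/eqP/permP => k; rewrite permE.
  - apply/implyP => f1; have := H 1; rewrite ua f1 /= => /eqP; rewrite eq_sym.
    rewrite -[X in vertices _ X == _](add0r (1 : 'I_5)) vertices_eq // add0r fy.
    by rewrite /face_zeros eqxx andbT !andbF !orbF.
  - apply/implyP => f3; have := H 3; rewrite ua f3 /= => /eqP; rewrite eq_sym.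
    have -> : 3 = 2 + 1 :> 'I_5 by exact: val_inj.
    rewrite vertices_eq // fy (_ : 2 + 1 = 3 :> 'I_5); last exact: val_inj.
    by rewrite /face_zeros eqxx andbT !andbF !orbF.
rewrite !swaps_perm_flips in H1 H3.
apply/fixesP => k; rewrite permE.
have -> : k = swaps false false k by move: k; apply: ord5P; exact: val_inj.
rewrite swaps_comp !addbF; apply: swaps_link.
- by case: (flip1 u) H1 => /= [d2|_]; [left; apply/eqP; rewrite fy /face_zeros d2|right].
- by case: (flip3 u) H3 => /= [d0|_]; [left; apply/eqP; rewrite fy /face_zeros d0 orbT|right].
Qed.

Lemma cell_map_transl u s t x y : cell_map s x = cell_map t y ->
  cell_map (u * s)%g x = cell_map (u * t)%g y.
Proof.
move=> /cell_mapP[g [yg H]]; apply/cell_mapP; exists g; split=> // k.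
by rewrite !permM H.
Qed.

Lemma cell_mapE s t x y : cell_map s x = cell_map t y ->
  exists g u, [/\ y = dactc x g, u \in fixes x & s = (t * dperm g * u)%g].
Proof.
move=> /cell_mapP[g [yg H]]; exists g, ((t * dperm g)^-1 * s)%g; split.
- exact: val_inj.
- by apply/fixesP => k; rewrite permM H -dpermE -permM permKV.
- by rewrite mulKVg.
Qed.

Lemma cell_map_inj s : injective (@cell_map R 5 s).
Proof.
move=> x y /cell_mapE[g [u [-> fu /esym]]].
rewrite -mulgA -[RHS]mulg1 => /mulgI e.
have : dperm g \in fixes x.
  apply/fixesP => k; have /fixesP/(_ (dperm g k)) <- := fu.
  by rewrite -permM e perm1.
by move=> /dperm_fixes ->; apply: val_inj; apply/rowP => k; rewrite mxE /dside /= add0r.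
Qed.

Lemma face_setP d s x y : in_face d x -> in_face d y -> cell_map s x = cell_map 1 y ->
  s \in face_set d.
Proof.
move=> fx fy /cell_mapE[g [u [yg fu ->]]]; move: fu; rewrite (in_face_fixes _ fx).
move=> /and3P[/eqP eu u1 u3]; rewrite mul1g eu.
apply/imsetP; exists (g, (flip1 u, flip3 u)) => //; rewrite inE u1 u3 !andbT.
by apply/forallP => k; apply/eqP; move: k; apply/(in_face_dactc g fx); rewrite -yg.
Qed.

Lemma face_set_act d s x : in_face d x -> s \in face_set d ->
  exists2 y, in_face d y & cell_map s x = cell_map 1 y.
Proof.
move=> fx /imsetP[[g [a b]] /[!inE] /and3P[/forallP /= gz a1 b3] ->].
exists (dactc x g); first by apply/(in_face_dactc g fx) => k; apply/eqP.
rewrite cell_map_fixes; first by rewrite -[in LHS](mul1g (dperm g)) cell_map_dihedral.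
by rewrite (in_face_fixes _ fx) !swaps_perm_flips eqxx a1.
Qed.

Lemma cell_map_coset d s t x y : in_face d x -> in_face d y ->
  cell_map s x = cell_map t y -> (t^-1 * s)%g \in face_set d.
Proof.
move=> fx fy /(cell_map_transl t^-1); rewrite mulVg; exact: face_setP.
Qed.

Lemma cell_map_coset_rep d s t x : in_face d x -> (t^-1 * s)%g \in face_set d ->
  exists2 y, in_face d y & cell_map s x = cell_map t y.
Proof.
move=> fx /(face_set_act fx)[y fy /(cell_map_transl t)]; rewrite mulKVg mulg1.
by exists y.
Qed.

Lemma in_face_dim_le d d' s t x y : in_face d x -> in_face d' y ->
  cell_map s x = cell_map t y -> (d < 3)%N -> (d <= d')%N.
Proof.
move=> fx fy /cell_mapE[g [u [yg _ _]]].
have H k : face_zeros d' k = face_zeros d (dside g k) by rewrite -fy yg mxE fx.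
have := H 1; have := H 3; rewrite /face_zeros.
have n13 : dside g 1 != dside g 3 by rewrite (inj_eq (@dside_inj g)).
case: d d' {fx fy H} => [|[|[|//]]] [|[|d']] //= /esym h3 /esym.
by rewrite !orbF in h3 *; move=> /eqP h1; move: n13; rewrite h1 (eqP h3) eqxx.
Qed.

Lemma in_face_dim d d' s t x y : in_face d x -> in_face d' y ->
  cell_map s x = cell_map t y -> (d < 3)%N -> (d' < 3)%N -> d = d'.
Proof.
move=> fx fy E d3 d3'; apply/eqP; rewrite eqn_leq.
by rewrite (in_face_dim_le fx fy E) // (in_face_dim_le fy fx (esym E)).
Qed.

(** Collapsed sides are not adjacent, so there are none, one, or two at cyclic distance two. In the
    last case a rotation serves for [k] and [k + 2], a reflection for [k] and [k + 3]. *)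
Lemma face_of_cell y : exists d g, (d < 3)%N /\ in_face d (dactc y g).
Proof.
have cey := cell_is_cell y; have [_ _ y0] := cey.
have nz k := @no_adjacent_zeros _ (\val y) k cey.
have [/existsP[k /eqP yk]|/existsPn all] := boolP [exists k, \val y 0 k == 0]; last first.
  by exists 2, (false, 0); split=> // k; rewrite mxE (negbTE (all _)).
have shift (i j : 'I_5) : \val y 0 i = 0 -> j = i + 1 -> (\val y 0 j == 0) = false.
  by move=> /nz h ->; rewrite gt_eqF.
have shift' (i j : 'I_5) : \val y 0 i = 0 -> j + 1 = i -> (\val y 0 j == 0) = false.
  by move=> yi e; apply/negP => /eqP/nz; rewrite e yi ltxx.
have [e2|n2] := eqVneq (\val y 0 (k + 2)) 0.
  exists 0, (false, k - 1); split=> //.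
  apply: (ord5P (P := fun j => (\val (dactc y _) 0 j == 0) = face_zeros 0 j)); rewrite mxE /dside /=.
  - by rewrite (shift' k) //; ring.
  - by rewrite subrK yk eqxx.
  - by rewrite (shift k) //; ring: (erefl (3 : 'I_5)).
  - rewrite (_ : k - 1 + 3 = k + 2) ?e2 ?eqxx // -addrA; congr (_ + _); exact: val_inj.
  - by rewrite (shift (k + 2)) // -!addrA; congr (_ + _); apply: val_inj.
have [e3|n3] := eqVneq (\val y 0 (k + 3)) 0.
  exists 0, (true, k); split=> //.
  apply: (ord5P (P := fun j => (\val (dactc y _) 0 j == 0) = face_zeros 0 j)); rewrite mxE /dside /=.
  - by rewrite (shift k) // subr0.
  - by rewrite addrK yk eqxx.
  - by rewrite (shift' k) //; ring.
  - rewrite (_ : k + 1 - 3 = k + 3) ?e3 ?eqxx // -addrA; congr (_ + _); exact: val_inj.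
  - by rewrite (shift' (k + 3)) // -!addrA; congr (_ + _); apply: val_inj.
exists 1, (false, k - 1); split=> //.
apply: (ord5P (P := fun j => (\val (dactc y _) 0 j == 0) = face_zeros 1 j)); rewrite mxE /dside /=.
- by rewrite (shift' k) //; ring.
- by rewrite subrK yk eqxx.
- by rewrite (shift k) // -!addrA; congr (_ + _); apply: val_inj.
- rewrite (_ : k - 1 + 3 = k + 2) ?(negbTE n2) // -addrA; congr (_ + _); exact: val_inj.
- rewrite (_ : k - 1 + 4 = k + 3) ?(negbTE n3) // -addrA; congr (_ + _); exact: val_inj.
Qed.

Lemma face_repr s x : exists d t y,
  [/\ (d < 3)%N, in_face d y & cell_map s x = cell_map t y].
Proof.
have [d [g [d3 fy]]] := face_of_cell x.
exists d, (s * dperm (dinv g))%g, (dactc x g); split=> //.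
exact: cell_map_dinv.
Qed.

End Faces.

(** * Orders of the stabilizers *)

Section FaceCounts.
Variable R : realType.
Implicit Types (d : nat) (g h : dih).

Definition side_mid : cell R 5 := cellify (norm1 (side_pt 0)).
Definition centre : cell R 5 := cellify (norm1 (disk_pt 0)).

Definition face_pt d : cell R 5 :=
  if d is d'.+1 then if d' is _.+1 then centre else side_mid else apex R.

Lemma in_face_apex : in_face 0 (apex R).
Proof.
have [a0 a2 a4] := @apex_gt0 R; apply: ord5P; rewrite ?apex_zeros ?eqxx //.
- by rewrite gt_eqF.
- by rewrite gt_eqF.
- by rewrite gt_eqF.
Qed.

Lemma in_face_side (r : R) : -1 < r < 1 -> in_face 1 (cellify (norm1 (side_pt r))).
Proof.
move=> /andP[r0 r1]; have r01 : -1 <= r <= 1 by rewrite !ltW.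
have p0 := @psi_gt0 R; move=> k; rewrite cellifyE; last exact: is_cell_side_pt.
rewrite norm1_eq0; last exact: side_pt_gram.
move: k; apply: (ord5P (P := fun k => (side_pt r 0 k == 0) = face_zeros 1 k)); rewrite side_ptE.
- by rewrite gt_eqF.
- by rewrite eqxx.
- by rewrite -(side_ptE r).1.1.2 gt_eqF // side_pt2_gt0 // ltW.
- by rewrite gt_eqF // mulr_gt0 ?exprn_gt0 ?divr_gt0 //; lra.
- by rewrite gt_eqF // mulr_gt0 ?divr_gt0 // subr_gt0.
Qed.

Lemma in_face_disk (u : 'rV[R]_2) : len u < 1 -> in_face 2 (cellify (norm1 (disk_pt u))).
Proof.
move=> u1 k; rewrite cellifyE; last exact/is_cell_disk_pt/ltW.
rewrite norm1_eq0; last exact/disk_pt_gram/ltW.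
rewrite gt_eqF //; apply: lt_le_trans (disk_pt_ge u k); by rewrite subr_gt0.
Qed.

Lemma in_face_pt d : (d < 3)%N -> in_face d (face_pt d).
Proof.
case: d => [|[|[|//]]] _; [exact: in_face_apex| |].
  by apply: in_face_side; rewrite ltrN10 ltr01.
have -> : face_pt 2 = cellify (norm1 (disk_pt 0)) by [].
apply: in_face_disk; have /eqP -> : len (0 : 'rV[R]_2) == 0 by rewrite len_eq0.
exact: ltr01.
Qed.

(** The group law comes from the gluing and not from a calculation with products: two
    identifications of the model face compose, and [face_pt] supplies a point to follow. *)
Lemma face_group_set d : (d < 3)%N -> group_set (face_set d).
Proof.
move=> d3; have fp := in_face_pt d3; apply/group_setP; split.
  by apply: (face_setP fp fp).
move=> s t hs ht; have [y fy e] := face_set_act fp ht; have [z fz e'] := face_set_act fy hs.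
by apply: (face_setP fp fz); rewrite (cell_map_transl s e) mulg1.
Qed.

Lemma card_all5 (T : finType) (e : seq T) (A : {set T}) : uniq e -> (forall z, z \in e) ->
  #|A| = count [in A] e.
Proof.
move=> ue ae; rewrite -size_filter.
rewrite -(card_uniqP (filter_uniq _ ue)); apply: eq_card => z.
by rewrite mem_filter ae andbT.
Qed.

Lemma swaps_permM a b a' b' :
  (swaps_perm a b * swaps_perm a' b')%g = swaps_perm (a (+) a') (b (+) b').
Proof. by apply/permP => k; rewrite permM !permE swaps_comp addbC (addbC b). Qed.

Lemma dperm_inj : injective dperm.
Proof.
move=> [b a] [b' a'] e.
have := congr1 (fun s : 'S_5 => s 0) e; have := congr1 (fun s : 'S_5 => s 1) e.
rewrite /= !dpermE /dvert /=; case: b b' {e} => [] []; rewrite ?addr0 ?subr0 => /[swap] -> //;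
  by move: a'; apply: ord5P => /(congr1 val).
Qed.

(** The product decomposition is unique: a dihedral permutation that is also a swap fixes all
    vertices of [apex], hence is trivial. *)
Lemma card_face_set d : #|face_set d| = #|face_syms d|.
Proof.
apply: card_in_imset => -[g [a b]] [g' [a' b']] _ _ /= e.
have gg : g = g'.
  have E : dperm (dcomp g (dinv g')) = swaps_perm (a' (+) a) (b' (+) b).
    rewrite -swaps_permM; apply/permP => k.
    have := congr1 (fun s : 'S_5 => swaps_perm a b (s (dvert (dinv g') k))) e.
    by rewrite !permM !dpermE dvert_comp !permE swapsK dvertVK.
  have := swaps_perm_fixes R (a' (+) a) (b' (+) b); rewrite -E => /dperm_fixes e0.
  apply: dperm_inj; apply/permP => k; rewrite !dpermE.
  by rewrite -{1}(dvertK g' k) -dvert_comp e0 {1}/dvert /= add0r.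
rewrite gg in e *; have {}e := mulgI _ _ _ e.
have := congr1 flip1 e; have := congr1 flip3 e; rewrite !swaps_perm_flips.
by move=> -> ->.
Qed.

(** Dihedral symmetries of the model face times admissible swaps: [2 * 4], [2 * 2] and [10 * 1],
    counted along an explicit list. *)
Lemma card_face_syms d : (d < 3)%N -> #|face_syms d| = nth 0 [:: 8; 4; 10] d.
Proof.
pose e5 : seq 'I_5 := [:: 0; 1; 2; 3; 4].
have m5 k : k \in e5 by move: k; apply: ord5P.
pose b2 := [:: false; true]; have m2 b : b \in b2 by case: b.
pose e := [seq (g, p) | g <- [seq (b, a) | b <- b2, a <- e5], p <- [seq (b, c) | b <- b2, c <- b2]].
have ue : uniq e by vm_compute.
have me (p : dih * (bool * bool)) : p \in e.
  by case: p => [[b a] [c c']]; rewrite !allpairs_f.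
move=> d3; rewrite (card_all5 _ ue me).
have E p : (p \in face_syms d) =
    [&& all (fun k => face_zeros d (dside p.1 k) == face_zeros d k) e5,
      p.2.1 ==> (d < 2)%N & p.2.2 ==> (d == 0)%N].
  rewrite inE; congr (_ && _); apply/forallP/allP => [H k _|H k]; apply: H.
  exact: m5.
rewrite (eq_count E) {E}.
by case: d d3 => [|[|[|//]]] _; vm_compute.
Qed.

Lemma left_transversal (gT : finGroupType) (H : {group gT}) n : #|gT| = (n * #|H|)%N ->
  exists r : 'I_n -> gT, (forall s, exists j, ((r j)^-1 * s)%g \in H) /\
    (forall i j, ((r i)^-1 * r j)%g \in H -> i = j).
Proof.
move=> cn.
have nE : #|lcosets H [set: gT]%G| = n.
  have := card_lcosets [set: gT]%G H; rewrite -divgS ?finset.subsetT //.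
  by rewrite cardsT cn mulnK.
pose C (j : 'I_n) := enum_val (cast_ord (esym nE) j).
have CP j : exists x, C j = (x *: H)%g.
  by have /lcosetsP[x _ e] := enum_valP (cast_ord (esym nE) j); exists x.
exists (fun j => repr (C j)); have rP j : C j = (repr (C j) *: H)%g.
  by have [x ->] := CP j; apply/esym/lcoset_eqP/mem_repr; exact: lcoset_refl.
split=> [s|i j].
  have sH : (s *: H)%g \in lcosets H [set: gT]%G by apply/lcosetsP; exists s; rewrite ?inE.
  exists (cast_ord nE (enum_rank_in sH (s *: H)%g)).
  rewrite -mem_lcoset -rP /C cast_ordK enum_rankK_in //; exact: lcoset_refl.
rewrite -mem_lcoset => /lcoset_eqP; rewrite -!rP => /enum_val_inj.
by move=> /cast_ord_inj.
Qed.

Definition face_count d : nat := nth 0 [:: 15; 30; 12] d.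

Lemma face_transversal d : (d < 3)%N -> exists r : 'I_(face_count d) -> 'S_5,
  (forall s, exists j, ((r j)^-1 * s)%g \in face_set d) /\
  (forall i j, ((r i)^-1 * r j)%g \in face_set d -> i = j).
Proof.
move=> d3; apply: (@left_transversal _ (group (face_group_set d3))).
rewrite card_Sn card_face_set card_face_syms //.
by case: d d3 => [|[|[|//]]].
Qed.

End FaceCounts.

(** * The CW structure *)

Section CellComplex.
Variable R : realType.
Implicit Types (d : nat) (x y : cell R 5).

Definition face_param d : 'rV[R]_d -> cell R 5 :=
  match d with
  | 1 => fun u => cellify (norm1 (side_pt (u 0 0)))
  | 2 => fun u => cellify (norm1 (disk_pt u))
  | _ => fun=> apex R
  end.

Lemma sqnorm1 (u : 'rV[R]_1) : sqnorm u = u 0 0 ^+ 2.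
Proof. by rewrite /sqnorm big_ord1. Qed.

Lemma sqnorm1_le (u : 'rV[R]_1) : sqnorm u <= 1 -> -1 <= u 0 0 <= 1.
Proof. by rewrite sqnorm1 -real_normK ?num_real // expr_le1 // ler_norml. Qed.

Lemma sqnorm1_lt (u : 'rV[R]_1) : (sqnorm u < 1) = (-1 < u 0 0 < 1).
Proof. by rewrite sqnorm1 -real_normK ?num_real // expr_lt1 // ltr_norml. Qed.

Lemma face_param_continuous d : (d < 3)%N ->
  {within [set u | sqnorm u <= 1], continuous (@face_param d)}.
Proof.
case: d => [|[|[|//]]] _.
- exact/continuous_subspaceT/cst_continuous.
- apply: (@is_cell_continuous _ _ _ (fun u : 'rV[R]_1 => side_pt (u 0 0))) => [|u|u].
  + exact: side_pt_continuous.
  + by move=> /sqnorm1_le; exact: side_pt_gram.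
  + by move=> /sqnorm1_le; exact: is_cell_side_pt.
- apply: is_cell_continuous => [|u|u].
  + exact: disk_pt_continuous.
  + by rewrite /= sqnorm_le1; exact: disk_pt_gram.
  + by rewrite /= sqnorm_le1; exact: is_cell_disk_pt.
Qed.

Lemma in_face_param d (u : 'rV[R]_d) : (d < 3)%N -> sqnorm u < 1 ->
  in_face d (face_param u).
Proof.
case: d u => [|[|[|//]]] u _.
- by move=> _; exact: in_face_apex.
- by rewrite sqnorm1_lt; exact: in_face_side.
- by rewrite sqnorm_lt1; exact: in_face_disk.
Qed.

Lemma face_param_inj d (u w : 'rV[R]_d) : (d < 3)%N -> sqnorm u < 1 -> sqnorm w < 1 ->
  face_param u = face_param w -> u = w.
Proof.
case: d u w => [|[|[|//]]] u w _.
- by move=> _ _ _; rewrite (thinmx0 u) (thinmx0 w).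
- move=> /ltW/sqnorm1_le u1 /ltW/sqnorm1_le w1 /(congr1 val).
  rewrite !cellifyE; try exact: is_cell_side_pt.
  by move=> /(side_pt_inj u1 w1) e; apply/rowP => i; rewrite (ord1 i).
- rewrite !sqnorm_lt1 => /ltW u1 /ltW w1 /(congr1 val).
  rewrite !cellifyE; try exact: is_cell_disk_pt.
  exact: disk_pt_inj.
Qed.

Lemma face_param_surj d y : (d < 3)%N -> in_face d y ->
  exists2 u : 'rV[R]_d, sqnorm u < 1 & face_param u = y.
Proof.
move=> d3 fy; have cey := cell_is_cell y; have [_ _ y0] := cey.
have pos k : ~~ face_zeros d k -> 0 < \val y 0 k by rewrite -fy lt_def y0 andbT.
case: d d3 fy pos => [|[|[|//]]] _ fy pos.
- exists 0; first by rewrite /sqnorm big_ord0.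
  have y1 : \val y 0 1 = 0 by apply/eqP; rewrite fy.
  have y3 : \val y 0 3 = 0 by apply/eqP; rewrite fy.
  have [] := toH_hplane cey; rewrite /lorentz_form !row3E y1 y3 !mulr0 !subr0 => t2 t0.
  have t1 : scaleT * tcoord (\val y) = 1.
    by apply/eqP; rewrite -(@eqrXn2 _ 2) ?expr1n ?expr2 ?t2 // ltW.
  apply: val_inj; rewrite /= -[RHS](toHK (cell_closes_up y)).
  by rewrite /toH t1 y1 y3 mulr0.
- have y1 : \val y 0 1 = 0 by apply/eqP; rewrite fy.
  have [r r1 e] := side_pt_surj cey y1 (pos 3 isT) (pos 4 isT).
  exists (const_mx r); first by rewrite sqnorm1_lt mxE.
  by rewrite /= mxE e cellifyK.
- have [u u1 e] := disk_pt_surj cey (fun k => pos k isT).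
  by exists u; [rewrite sqnorm_lt1|rewrite /= e cellifyK].
Qed.

Lemma face_param_boundary d (u : 'rV[R]_d) : (d < 3)%N -> sqnorm u = 1 ->
  (forall k, face_zeros d k -> \val (face_param u) 0 k = 0) /\
  exists2 k, ~~ face_zeros d k & \val (face_param u) 0 k = 0.
Proof.
case: d u => [|[|[|//]]] u _ u1.
- by move: u1 => /eqP; rewrite /sqnorm big_ord0 eq_sym oner_eq0.
- have r1 : -1 <= u 0 0 <= 1 by apply: sqnorm1_le; rewrite u1.
  have cE := is_cell_side_pt r1.
  split=> [k|]; rewrite /= cellifyE //.
    by rewrite /face_zeros /= orbF => /eqP ->; rewrite mxE side_ptE mulr0.
  move: u1; rewrite sqnorm1 => /eqP; rewrite -subr_eq0 -[X in _ - X](expr1n _ 2) subr_sqr.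
  rewrite mulf_eq0 => /orP[/eqP e|/eqP e].
    by exists 4 => //; rewrite mxE side_ptE -opprB e oppr0 mul0r !mulr0.
  by exists 3 => //; rewrite mxE side_ptE addrC e mul0r !mulr0.
- have l1 : len u = 1 by rewrite /len u1 sqrtr1.
  have l1' : len u <= 1 by rewrite l1.
  split=> // ; have [k ek] := disk_pt_attained u; exists k => //=.
  by rewrite cellifyE; [rewrite mxE ek l1 subrr mulr0|exact: is_cell_disk_pt].
Qed.

(** The model face of dimension [d] has [2 - d] collapsed sides and symmetries preserve their
    number, so an additional collapsed side lowers the dimension. *)
Lemma boundary_dim d d' s t x y : in_face d' y -> cell_map s x = cell_map t y ->
  (0 < d)%N -> (d' < 3)%N -> (forall k, face_zeros d k -> \val x 0 k = 0) ->
  (exists2 k, ~~ face_zeros d k & \val x 0 k = 0) -> (d' < d)%N.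
Proof.
move=> fy /cell_mapE[g [_ [yg _ _]]] d0 d3 x0 [k kz xk]; rewrite ltnNge; apply/negP => dd.
have H j : \val x 0 j = 0 -> face_zeros d' (dside (dinv g) j).
  by move=> xj; rewrite -fy yg mxE dsideVK xj.
have := H _ xk; case: d' fy d3 dd {H} (H 1) => [|[|[|//]]] _ _ dd; last by [].
  by rewrite ltnNge dd in d0.
have d1 : d = 1%N by apply/eqP; rewrite eqn_leq dd.
rewrite d1 in x0 kz; move=> /(_ (x0 1 isT)); rewrite /face_zeros /= !orbF => /eqP <-.
by move=> /eqP/(can_inj (dsideVK g)) e; move: kz; rewrite e.
Qed.

Lemma moduli_euler_characteristic : euler_characteristic R (moduli R 5) (-3).
Proof.
pose rr (d : 'I_3) := cid (@face_transversal R d (ltn_ord d)).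
pose r (d : 'I_3) := projT1 (rr d); have rP (d : 'I_3) := projT2 (rr d).
have rsurj (d : 'I_3) s := (rP d).1 s; have rinj (d : 'I_3) i j := (rP d).2 i j.
(* One cell for each coset of [face_set d], parametrized by the model face in the copy of the chosen
   representative. *)
exists {d : 'I_3 & 'I_(face_count d)}, (fun i => val (tag i)).
exists (fun i u => cell_map (r (tag i) (tagged i)) (face_param u)).
split.
  split.
  - exact: moduli_hausdorff.
  - move=> [d j] /=; have c := @face_param_continuous d (ltn_ord d).
    move=> u; apply: continuous_comp; first exact: c.
    exact: cell_map_continuous.
  - move=> z; have [s [x <-]] := cell_map_surj z.
    have [d [t [y [d3 fy ->]]]] := face_repr s x.
    pose d' := Ordinal d3; have [j hj] := rsurj d' t.
    have [y' fy' ->] := cell_map_coset_rep fy hj.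
    have [u u1 <-] := face_param_surj d3 fy'.
    by exists (existT _ d' j), u.
  - move=> [d j] [d' j'] /= u w u1 w1 E.
    have fu := in_face_param (ltn_ord d) u1; have fw := in_face_param (ltn_ord d') w1.
    have dd : d = d' by apply: val_inj; exact: in_face_dim fu fw E (ltn_ord d) (ltn_ord d').
    case: d' / dd j' w w1 E fw => j' w w1 E fw.
    have jj : j' = j by apply: rinj; exact: cell_map_coset fu fw E.
    case: j / jj E => E.
    by rewrite (face_param_inj (ltn_ord d) u1 w1 (cell_map_inj E)).
  - move=> [d j] /= u u1; have [b1 b2] := face_param_boundary (ltn_ord d) u1.
    have d0 : (0 < d)%N.
      case: d u u1 {j b1 b2} => -[|//] i u /eqP.
      by rewrite /sqnorm big_ord0 eq_sym oner_eq0.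
    have [d' [t [y [d3 fy E]]]] := face_repr (r d j) (face_param u).
    pose d'' := Ordinal d3; have [j' hj] := rsurj d'' t.
    exists (existT _ d'' j'); first exact: boundary_dim fy E d0 d3 b1 b2.
    have [y' fy' E'] := cell_map_coset_rep fy hj.
    have [w w1 ew] := face_param_surj d3 fy'.
    by exists w => //=; rewrite ew -E' -E.
rewrite -(@sig_big_dep _ _ _ _ _ xpredT (fun (_ : 'I_3) => xpredT)
  (fun (d : 'I_3) (_ : 'I_(face_count d)) => (-1) ^+ val d : int)) /=.
rewrite (eq_bigr (fun d : 'I_3 => (-1) ^+ val d *+ face_count d)) => [|d _].
  by rewrite !big_ord_recl big_ord0.
by rewrite sumr_const card_ord.
Qed.

End CellComplex.

(** * The tiling *)

Section Tiling.
Variable R : realType.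
Implicit Types (x y : cell R 5) (z : 'rV[R]_3) (s t : 'S_5) (g : dih) (i j k : 'I_5).

Lemma det3 (M : 'M[R]_3) : \det M =
  M 0 0 * (M 1 1 * M 2%:R 2%:R - M 1 2%:R * M 2%:R 1) -
  M 0 1 * (M 1 0 * M 2%:R 2%:R - M 1 2%:R * M 2%:R 0) +
  M 0 2%:R * (M 1 0 * M 2%:R 1 - M 1 1 * M 2%:R 0).
Proof.
pose m (i j : nat) := M (inord i) (inord j).
have E (i j : 'I_3) : M i j = m i j by rewrite /m !inord_val.
rewrite (expand_det_row _ ord0) !big_ord_recl big_ord0 /cofactor.
rewrite !(expand_det_row _ ord0) !big_ord_recl !big_ord0 /cofactor !det_mx11 !mxE.
by rewrite !E /= /bump /=; ring.
Qed.

Lemma orientE (a b c : 'rV[R]_3) : orient a b c =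
  a 0 0 * (b 0 1 * c 0 2%:R - b 0 2%:R * c 0 1) -
  a 0 1 * (b 0 0 * c 0 2%:R - b 0 2%:R * c 0 0) +
  a 0 2%:R * (b 0 0 * c 0 1 - b 0 1 * c 0 0).
Proof.
rewrite /orient det3.
have E0 (j : 'I_3) : (col_mx a (col_mx b c) : 'M[R]_3) 0 j = a 0 j.
  by rewrite -(@col_mxEu _ 1 (1 + 1) 3 a (col_mx b c)); congr (col_mx _ _ _ _); exact: val_inj.
have E1 (j : 'I_3) : (col_mx a (col_mx b c) : 'M[R]_3) 1 j = b 0 j.
  rewrite -(@col_mxEu _ 1 1 3 b c) -(@col_mxEd _ 1 (1 + 1) 3 a (col_mx b c)).
  by congr (col_mx _ _ _ _); exact: val_inj.
have E2 (j : 'I_3) : (col_mx a (col_mx b c) : 'M[R]_3) 2%:R j = c 0 j.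
  rewrite -(@col_mxEd _ 1 1 3 b c) -(@col_mxEd _ 1 (1 + 1) 3 a (col_mx b c)).
  by congr (col_mx _ _ _ _); exact: val_inj.
by rewrite !E0 !E1 !E2.
Qed.

(** The sides [1 + 2 * i] and [3 + 2 * i] collapse here, so consecutive corners share a collapsed
    side; [3] stands for [-2] modulo 5. *)
Definition corner i : cell R 5 := dactc (apex R) (false, 3 * i).

Definition tile_vertex i : 'rV[R]_3 := toH (\val (corner i)).

Lemma corner_gt0 i k : (0 < \val (corner i) 0 k) = (3 * i + k \notin [:: 1; 3]).
Proof.
rewrite /corner /= mxE /dside /=; move: (3 * i + k).
have [a0 a2 a4] := @apex_gt0 R; apply: ord5P; rewrite ?a0 ?a2 ?a4 //.
  by rewrite apex_zeros ltxx.
by rewrite apex_zeros ltxx.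
Qed.

Lemma apex_reflect k : \val (apex R) 0 (4 - k) = \val (apex R) 0 k.
Proof.
have e4 : \val (apex R) 0 0 = \val (apex R) 0 4 by rewrite /apex val_mk_cell !apexE.
have e3 : \val (apex R) 0 1 = \val (apex R) 0 3 by rewrite !apex_zeros.
have v i j : val i = val j -> \val (apex R) 0 i = \val (apex R) 0 j by move=> /val_inj ->.
by move: k; apply: ord5P; [rewrite e4|rewrite e3| |rewrite -e3|rewrite -e4]; apply: v.
Qed.

Lemma dactc_apex g : exists i, dactc (apex R) g = corner i.
Proof.
case: g => [[] a].
  (* By [apex_reflect] the reflection has the effect of a rotation by [3 - a], and this index solves
     [3 * i = 3 - a]. *)
  exists (1 + 3 * a); apply: val_inj; apply/rowP => k; rewrite [LHS]mxE [RHS]mxE -apex_reflect /dside /=.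
  congr (\val (apex R) 0 _); move: a k; apply: ord5P; apply: ord5P; exact: val_inj.
exists (2 * a); apply: val_inj; apply/rowP => k; rewrite [LHS]mxE [RHS]mxE /dside /=.
by congr (\val (apex R) 0 (_ + _)); move: a; apply: ord5P; exact: val_inj.
Qed.

Lemma tile_vertexE i : tile_vertex i = (row3
  (nth 0 [:: 1; 1 + psi; 2 + psi; 2 + psi; 1 + psi] i)
  (scaleS / scaleT * nth 0 [:: 0; psi; 1; psi; 0] i)
  (scaleS / scaleT * nth 0 [:: 0; 0; psi; 1; psi] i)).
Proof.
have p2 := @psi2 R; have sT := lt0r_neq0 (@scaleT_gt0 R); have sS := lt0r_neq0 (@scaleS_gt0 R).
rewrite /tile_vertex /toH /tcoord /corner /= !mxE /dside /=.
move: i; apply: ord5P => /=; congr row3.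
all: by field: p2; rewrite ?sT ?sS.
Qed.

(** Both sides are linear forms on closed pentagons vanishing at the corners [i] and [i + 1], where
    the side [3 + 2 * i] is collapsed. The positive factor, common to all [i], turns the sides of
    the tile into the conditions of [is_cell]. *)
Lemma orient_tile i (x : 'rV[R]_5) : closes_up x ->
  orient (tile_vertex i) (tile_vertex (i + 1)) (toH x) =
  scaleS ^+ 2 / scaleT * psi * x 0 (3 + 2 * i).
Proof.
move=> /closes_upP[e0 e4]; rewrite orientE !tile_vertexE /toH !row3E.
have e2 : x 0 2 = tcoord x - (1 + psi) * (x 0 1 + x 0 3) by rewrite /tcoord; ring.
have p2 := @psi2 R; have sT := lt0r_neq0 (@scaleT_gt0 R).
have v j j' : val j = val j' -> x 0 j = x 0 j' by move=> /val_inj ->.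
move: i; apply: ord5P => /=.
- by rewrite (v (3 + 2 * 0) 3) //; field: p2.
- by rewrite (v (3 + 2 * 1) 0) // e0; field: p2.
- by rewrite (v (3 + 2 * 2) 2) // e2; field: p2.
- by rewrite (v (3 + 2 * 3) 4) // e4; field: p2.
- by rewrite (v (3 + 2 * 4) 1) //; field: p2.
Qed.

Lemma orient_tile_factor : 0 < scaleS ^+ 2 / scaleT * psi :> R.
Proof.
by rewrite mulr_gt0 ?psi_gt0 // divr_gt0 ?exprn_gt0 ?scaleT_gt0 ?scaleS_gt0.
Qed.

Lemma corner_rotate i j : \val (corner (i + j)) = dact (\val (corner i)) (false, 3 * j).
Proof.
by rewrite /corner /= dact_comp /dcomp /=; congr (dact _ (_, _)); ring.
Qed.

Lemma gram_rotate i i' j :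
  gram (\val (corner (i + j))) (\val (corner (i' + j))) =
  gram (\val (corner i)) (\val (corner i')) :> R.
Proof.
by rewrite (corner_rotate i j) (corner_rotate i' j) (dact_gram _ (cell_closes_up _) (cell_closes_up _)).
Qed.

Lemma toward_form (v a b : 'rV[R]_3) : lorentz_form v v = 1 ->
  lorentz_form (toward v a) (toward v b) =
  lorentz_form a b - lorentz_form v a * lorentz_form v b.
Proof.
move=> v1; transitivity (lorentz_form a b + (lorentz_form v v - 2) *
  (lorentz_form v a * lorentz_form v b)); last by rewrite v1; ring.
by rewrite /toward /lorentz_form !mxE; ring.
Qed.

Lemma tile_vertex_form i j : lorentz_form (tile_vertex i) (tile_vertex j) =
  gram (\val (corner i)) (\val (corner j)).
Proof. exact: toH_form. Qed.

Lemma regular_right_angled_tile : regular_right_angled tile_vertex.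
Proof.
split=> [i|i k|i j|i].
- exact/toH_hplane/cell_is_cell.
- rewrite ordS5 => ki ki1; rewrite orient_tile; last exact: cell_closes_up.
  rewrite mulr_gt0 ?orient_tile_factor // corner_gt0.
  by move: i k ki ki1; apply: ord5P; apply: ord5P.
- rewrite /hdist !ordS5 !tile_vertex_form.
  have := gram_rotate 0 1 i; have := gram_rotate 0 1 j.
  by rewrite !add0r ![1 + _]addrC => -> ->.
- rewrite ordS5 ord_pred5 /hangle toward_form; last first.
    by rewrite tile_vertex_form; case: (cell_is_cell (corner i)).
  (* Orthogonality of the two tangent vectors, rotated to the corner [0]: there the vertex is the
     origin of the hyperboloid and its neighbours lie on different coordinate planes. *)
  suff -> : lorentz_form (tile_vertex (i - 1)) (tile_vertex (i + 1)) =
      lorentz_form (tile_vertex i) (tile_vertex (i - 1)) *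
      lorentz_form (tile_vertex i) (tile_vertex (i + 1)).
    by rewrite subrr oppr0 mul0r acos0.
  have g1 := gram_rotate (-1) 1 i; have g2 := gram_rotate 0 (-1) i; have g3 := gram_rotate 0 1 i.
  rewrite add0r in g2; rewrite add0r in g3.
  rewrite !tile_vertex_form (addrC i (-1)) (addrC i 1) g1 g2 g3 -!tile_vertex_form.
  by rewrite !tile_vertexE /lorentz_form !row3E /=; ring.
Qed.

Lemma orient_tile_ofH z i : orient (tile_vertex i) (tile_vertex (ordS i)) z =
  scaleS ^+ 2 / scaleT * psi * ofH z 0 (3 + 2 * i).
Proof. by rewrite ordS5 -orient_tile ?ofHK //; exact: ofH_closes_up. Qed.

Lemma hregionP z : hregion tile_vertex z <-> is_cell (ofH z).
Proof.
have F := orient_tile_factor; split=> [[[z1 z0] H]|cez]; split.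
- exact: ofH_closes_up.
- by rewrite gram_ofH.
(* The tile side on which the side [k] collapses, since [3 + 2 * (3 * k - 4) = k] modulo 5. *)
- move=> k; have := H (3 * k - 4); rewrite orient_tile_ofH pmulr_rge0 //.
  by congr (0 <= ofH z 0 _); move: k; apply: ord5P; exact: val_inj.
- by have := toH_hplane cez; rewrite ofHK.
- by move=> i; rewrite orient_tile_ofH pmulr_rge0 //; case: cez.
Qed.

Lemma hfaceP (J : {set 'I_5}) z : hface tile_vertex J z <->
  is_cell (ofH z) /\ forall i, ofH z 0 (3 + 2 * i) = 0 <-> i \in J.
Proof.
have O0 i : orient (tile_vertex i) (tile_vertex (ordS i)) z = 0 <-> ofH z 0 (3 + 2 * i) = 0.
  rewrite orient_tile_ofH; split=> [/eqP|->]; last by rewrite mulr0.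
  by rewrite mulf_eq0 (gt_eqF orient_tile_factor) => /eqP.
by split=> -[/hregionP cez HJ]; split=> // i; rewrite -?O0 // O0.
Qed.

End Tiling.

(** * Tiles in the moduli space *)

Section TilingTheorem.
Variable R : realType.
Implicit Types (x y : cell R 5) (z : 'rV[R]_3) (s t : 'S_5) (g : dih) (i j k : 'I_5).

Lemma face_set2P s : s \in face_set 2 -> exists g, s = dperm g.
Proof.
move=> /imsetP[[g [a b]]]; rewrite inE /= => /and3P[_]; rewrite !implybF => /negbTE -> /negbTE -> ->.
exists g; apply/permP => k; rewrite permM [LHS]permE /=.
by move: (dperm g k); apply: ord5P; exact: val_inj.
Qed.

Lemma dperm_face_set2 g : dperm g \in face_set 2.
Proof.
apply/imsetP; exists (g, (false, false)); first by rewrite inE /= andbT; apply/forallP => k.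
apply/permP => k; rewrite permM [RHS]permE /=.
by move: (dperm g k); apply: ord5P; exact: val_inj.
Qed.

Definition tile_map s z : moduli R 5 := cell_map s (cellify (ofH z)).

Lemma tile_map_isometry s :
  local_isometry (@star_atlas R) (hregion (@tile_vertex R)) (@hdist R) (tile_map s).
Proof.
move=> phi z aphi /hregionP cez dz.
have [W nW HW] := star_atlas_induced aphi Logic.I dz.
have [e e0 He] := cell_nbhsP nW.
exists [set z' | forall k, `|ofH z' 0 k - ofH z 0 k| < e].
  apply: (@filter_forall _ _ (fun k z' => `|ofH z' 0 k - ofH z 0 k| < e) (nbhs z)) => k.
  have c : continuous (fun z' => ofH z' 0 k).
    by move=> z'; apply: (@continuous_comp _ _ _ (@ofH R) (fun v : 'rV[R]_5 => v 0 k));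
      [exact: ofH_continuous|exact: coord_continuous].
  have /cvgrPdist_lt/(_ e e0) := c z.
  by apply: filterS => z'; rewrite distrC.
move=> t u Wt /hregionP cet Wu /hregionP ceu.
have mem v : (forall k, `|ofH v 0 k - ofH z 0 k| < e) -> is_cell (ofH v) -> W (cellify (ofH v)).
  by move=> Wv cev; apply: He => k; rewrite !cellifyE.
have [d1 d2 ->] := HW _ _ (mem _ Wt cet) Logic.I (mem _ Wu ceu) Logic.I; split=> //.
by rewrite /lorentz_dist /hdist !cellifyE // area_formE ?gram_ofH //; exact: ofH_closes_up.
Qed.

Lemma tile_map_inj s : {in hregion (@tile_vertex R) &, injective (tile_map s)}.
Proof.
move=> z z' /set_mem/hregionP cez /set_mem/hregionP cez' /cell_map_inj /(congr1 val).
by rewrite !cellifyE // => /(congr1 (@toH R)); rewrite !ofHK.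
Qed.

(** The gluing data [g] and [u] found at one common point remain valid on the whole face, because
    [fixes] depends only on which sides are collapsed. *)
Lemma tile_face_sub s t (J K : {set 'I_5}) :
  tile_map s @` hface (@tile_vertex R) J `&` tile_map t @` hface (@tile_vertex R) K !=set0 ->
  tile_map s @` hface (@tile_vertex R) J `<=` tile_map t @` hface (@tile_vertex R) K.
Proof.
move=> [_ [[z1 /hfaceP[c1 J1] <-] [z2 /hfaceP[c2 K2] /esym/cell_mapE[g [u [e fu ->]]]]]].
move=> _ [z /hfaceP[cz Jz] <-].
have {}e := congr1 val e; rewrite /= !cellifyE // in e.
have zeros k : ofH z 0 k = 0 <-> ofH z1 0 k = 0.
  have -> : k = 3 + 2 * (3 * k - 4) by move: k; apply: ord5P; exact: val_inj.
  by rewrite Jz J1.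
have fz : u \in fixes (cellify (ofH z)).
  apply: fintype.subsetP fu; apply: specializes_fixes => k.
  by rewrite !cellifyE // zeros.
exists (toH (dact (ofH z) g)).
  apply/hfaceP; rewrite toHK; last by apply: dact_closes_up; case: cz.
  split; first exact: is_cell_dact.
  by move=> i; rewrite -K2 e [dact (ofH z) g 0 _]mxE [dact (ofH z1) g 0 _]mxE zeros.
rewrite /tile_map toHK; last by apply: dact_closes_up; case: cz.
rewrite cell_map_fixes // cell_map_dihedral; congr cell_map.
apply: val_inj; rewrite /= !cellifyE //; exact: is_cell_dact.
Qed.

Lemma tile_map_vertex s i : tile_map s (tile_vertex R i) = cell_map s (corner R i).
Proof. by rewrite /tile_map /tile_vertex toHK ?cellifyK //; exact: cell_closes_up. Qed.

Lemma dpermM g h : dperm (dcomp g h) = (dperm h * dperm g)%g.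
Proof. by apply/permP => k; rewrite permM !dpermE dvert_comp. Qed.

Lemma dpermV g : dperm (dinv g) = (dperm g)^-1%g.
Proof.
apply: (mulgI (dperm g)); rewrite mulgV; apply/permP => k.
by rewrite permM !dpermE dvertK perm1.
Qed.

Lemma swaps_perm1 : swaps_perm false false = 1%g.
Proof. by apply/permP => k; rewrite permE perm1; move: k; apply: ord5P; exact: val_inj. Qed.

Lemma swaps_permV a b : (swaps_perm a b)^-1%g = swaps_perm a b.
Proof.
by apply: (mulgI (swaps_perm a b)); rewrite mulgV swaps_permM !addbb swaps_perm1.
Qed.

Lemma dactc_comp x g h : dactc x (dcomp g h) = dactc (dactc x g) h.
Proof. by apply: val_inj; rewrite /= dact_comp. Qed.

Lemma corner_inj : injective (corner R).
Proof.
move=> i j e.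
have H k : (3 * i + k \notin [:: 1; 3]) = (3 * j + k \notin [:: 1; 3]).
  by rewrite -!(corner_gt0 R) e.
have := H 0; have := H 1; have := H 2; have := H 3; have := H 4.
by move: i j {e H}; apply: ord5P; apply: ord5P.
Qed.

(** The corners at the vertex correspond to the four permutations in [fixes apex]: the coset of
    [s * swaps_perm a b] gives the tile, its dihedral part the corner. *)
Lemma card_tiles_at_vertex (r : 'I_12 -> 'S_5) (s : 'S_5) :
  (forall t, exists l, ((r l)^-1 * t)%g \in face_set 2) ->
  (forall l m, ((r l)^-1 * r m)%g \in face_set 2 -> l = m) ->
  #|[pred c : 'I_12 * 'I_5 |
    `[< cell_map (r c.1) (corner R c.2) = cell_map s (apex R) >]]| = 4%N.
Proof.
move=> rsurj rinj.
have rinj' l l' g g' : (r l * dperm g)%g = (r l' * dperm g')%g -> l = l'.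
  move=> e; apply: rinj; pose G := group (@face_group_set R 2 isT).
  have -> : ((r l)^-1 * r l' = dperm g * (dperm g')^-1)%g.
    by apply: (mulgI (r l)); rewrite mulKVg mulgA e mulgK.
  by apply: (@groupM _ G); [|rewrite groupV]; exact: dperm_face_set2.
have corner_map l i : cell_map (r l) (corner R i) = cell_map (r l * dperm (false, (3 * i)%R))%g (apex R).
  by rewrite cell_map_dihedral.
pose unfolds (p : bool * bool) (c : 'I_12 * 'I_5) := exists g,
  (s * swaps_perm p.1 p.2 = r c.1 * dperm g)%g /\ dactc (apex R) g = corner R c.2.
have unfold p : exists c, unfolds p c.
  have [l hl] := rsurj (s * swaps_perm p.1 p.2)%g; have [g eg] := face_set2P hl.
  have [i ei] := dactc_apex R g; exists (l, i), g; split=> //=.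
  by rewrite -eg mulKVg.
have [F HF] := choice unfold.
(* The tile index alone separates the four values, so four different tiles meet: otherwise a
   dihedral permutation would equal a nontrivial swap. *)
have F_inj : injective F.
  move=> p p' e; have [g [eg _]] := HF p; have [g' [eg' _]] := HF p'.
  have E : dperm (dcomp g' (dinv g)) = swaps_perm (p.1 (+) p'.1) (p.2 (+) p'.2).
    have {}eg : dperm g = ((r (F p).1)^-1 * (s * swaps_perm p.1 p.2))%g by rewrite eg mulKg.
    have {}eg' : dperm g' = ((r (F p).1)^-1 * (s * swaps_perm p'.1 p'.2))%g by rewrite eg' e mulKg.
    rewrite -swaps_permM dpermM dpermV -{1}swaps_permV eg eg' !invMg invgK -!mulgA.
    by rewrite mulKVg mulKg.
  have := swaps_perm_fixes R (p.1 (+) p'.1) (p.2 (+) p'.2); rewrite -E => /dperm_fixes e0.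
  have := swaps_perm_flips (p.1 (+) p'.1) (p.2 (+) p'.2).
  rewrite -E e0 /flip1 /flip3 !dpermE /dvert /= ?add0r ?eqxx /= => -[].
  by case: p p' {HF e eg eg' E e0} => [[] []] [[] []].
transitivity #|codom F|; last by rewrite (card_codom F_inj) card_prod card_bool.
apply: eq_card => c; rewrite !inE /=; apply/asboolP/codomP => [E|[p ->]]; last first.
  have [g [eg ec]] := HF p.
  by rewrite -ec -cell_map_dihedral -eg cell_map_fixes // swaps_perm_fixes.
have [g [u [ea fu es]]] := cell_mapE (etrans (esym E) (corner_map c.1 c.2)).
exists (flip1 u, flip3 u); have [g' [eg ec]] := HF (flip1 u, flip3 u).
have eu : u = swaps_perm (flip1 u) (flip3 u).
  by apply/permP => k; rewrite permE; exact: (fixes_apexP R u fu).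
have eg' : (s * swaps_perm (flip1 u) (flip3 u) = r c.1 * dperm (dcomp g (false, (3 * c.2)%R)))%g.
  by rewrite es {1}eu -!mulgA swaps_permM !addbb dpermM swaps_perm1 mulg1.
rewrite /= eg' in eg; have el := rinj' _ _ _ _ eg.
rewrite el in eg; have {}eg := dperm_inj (mulgI _ _ _ eg).
move: ec; rewrite -eg dactc_comp -ea => /corner_inj ec.
by case: c el ec {E es eg eg'} => l i /= -> ->; case: (F _).
Qed.

Lemma star_atlas_tiling : regular_right_angled_tiling (@star_atlas R) 12 5 4.
Proof.
have [r [rsurj rinj]] := @face_transversal R 2 isT.
exists (fun _ => @tile_vertex R), (fun l => tile_map (r l)); split.
- move=> l; split; [exact: regular_right_angled_tile|exact: tile_map_inj|].
  exact: tile_map_isometry.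
- apply/seteqP; split=> // z _; have [s [x <-]] := cell_map_surj z.
  have [l hl] := rsurj s; have [g eg] := face_set2P hl.
  exists l => //; exists (toH (\val (dactc x g))).
    by apply/hregionP; rewrite toHK; [exact: cell_is_cell|exact: cell_closes_up].
  rewrite /tile_map toHK; last exact: cell_closes_up.
  by rewrite cellifyK -cell_map_dihedral -eg mulKVg.
- move=> l m [_ [[z1 h1 <-] [z2 h2 E]]]; apply: rinj.
  have face z : hface (@tile_vertex R) finset.set0 z -> in_face 2 (cellify (ofH z)).
    move=> /hfaceP[cz H] k; rewrite cellifyE //; apply/negbTE/eqP.
    have -> : k = 3 + 2 * (3 * k - 4) by move: k; apply: ord5P; exact: val_inj.
    by move=> /H; rewrite inE.
  exact: cell_map_coset (face _ h2) (face _ h1) E.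
- move=> l m J K ne; apply/seteqP; split; apply: tile_face_sub => //.
  by rewrite classical_sets.setIC.
- move=> l i; rewrite -[RHS](@card_tiles_at_vertex r (r l * dperm (false, (3 * i)%R))%g) //.
  apply: eq_card => c; rewrite !inE /=; congr asbool; rewrite !tile_map_vertex.
  by rewrite cell_map_dihedral.
Qed.

End TilingTheorem.

Theorem theorem1p3 (R : realType) :
  exists atlas : set (chart R (moduli R 5)),
    [/\ hyperbolic_surface atlas,
        induced_structure atlas,
        euler_characteristic R (moduli R 5) (-3) &
        regular_right_angled_tiling atlas 12 5 4].
Proof.
exists (@star_atlas R); split.
- exact: star_atlas_surface.
- exact: star_atlas_induced.
- exact: moduli_euler_characteristic.
- exact: star_atlas_tiling.
Qed.
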